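(* Let $N$ be a complex Sasakian manifold with structure $(G,H,J,U,V,u,v,g)$, and let $B$ be the $(0,4)$-tensor on $N$ defined by $$\begin{aligned}B(X,Y,Z,W)={}&a_0R(X,Y,Z,W)+a_1R(X,Z,Y,W)+a_2\rho(Y,Z)g(X,W)+a_3\rho(X,Z)g(Y,W)\\&+a_4\rho(X,Y)g(Z,W)+a_5\rho(X,W)g(Y,Z)+a_6\rho(Y,W)g(X,Z)+a_7\rho(Z,W)g(X,Y)\\&+\tau\{a_8g(X,W)g(Y,Z)+a_9g(X,Z)g(Y,W)+a_{10}g(X,Y)g(Z,W)\},\end{aligned}$$ where $a_0,\dots,a_{10}$ are scalars on $N$; let $B(X,Y)Z$ be the vector field determined by $g(B(X,Y)Z,W)=B(X,Y,Z,W)$ for all $W$. Then $N$ is not $\mathcal{GH}$-$B$-flat; that is, it is not the case that $$G^2\big(B(GX,GY)GZ\big)=0\quad\text{and}\quad H^2\big(B(HX,HY)HZ\big)=0$$ for all vector fields $X,Y,Z$ on $N$.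
   Context: Complex Sasakian manifold. Let $N$ be a complex manifold of complex dimension $2p+1$, $p\ge 1$, with complex structure $J$ and Hermitian metric $g$, and let $\nabla$ be the Levi-Civita connection of $g$. Suppose there is a globally defined holomorphic $1$-form $\eta$ on $N$ with $\eta\wedge(d\eta)^p\neq 0$ everywhere, written $\eta=u-iv$ with $u$ and $v=u\circ J$ real $1$-forms. Let $U$ and $V=-JU$ be the vector fields dual to $u$ and $v$, that is $u(\cdot)=g(U,\cdot)$, $v(\cdot)=g(V,\cdot)$, with $u(U)=v(V)=1$ and $u(V)=v(U)=0$. Suppose there are $(1,1)$-tensor fields $G$ and $H=GJ$ with $$G^2=H^2=-I+u\otimes U+v\otimes V,\quad GJ=-JG,\quad GU=0,\quad g(X,GY)=-g(GX,Y).$$ Exterior derivatives of $1$-forms use the convention $2\,d\omega(X,Y)=X\omega(Y)-Y\omega(X)-\omega([X,Y])$. Put $\sigma(X)=g(\nabla_XU,V)$. A vector field $X$ is horizontal if $u(X)=v(X)=0$; $\mathcal H$ denotes the distribution of horizontal vectors. For a $(1,1)$-tensor $F$ let $[F,F](X,Y)=(\nabla_{FX}F)Y-(\nabla_{FY}F)X-F(\nabla_XF)Y+F(\nabla_YF)X$, and define $$\begin{aligned}S(X,Y)={}&[G,G](X,Y)+2g(X,GY)U-2g(X,HY)V+2(v(Y)HX-v(X)HY)\\&+\sigma(GY)HX-\sigma(GX)HY+\sigma(X)GHY-\sigma(Y)GHX,\\ T(X,Y)={}&[H,H](X,Y)-2g(X,GY)U+2g(X,HY)V+2(u(Y)GX-u(X)GY)\\&+\sigma(HX)GY-\sigma(HY)GX+\sigma(X)GHY-\sigma(Y)GHX.\end{aligned}$$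 The structure is normal if $S(X,Y)=T(X,Y)=0$ for all $X,Y\in\mathcal H$ and $S(X,U)=T(X,V)=0$ for all $X$. $N$ with the structure $(G,H,J,U,V,u,v,g)$ is a complex Sasakian manifold if it is normal and the fundamental $2$-forms $\widetilde G(X,Y)=g(X,GY)$, $\widetilde H(X,Y)=g(X,HY)$ satisfy $\widetilde G=du$ and $\widetilde H=dv$. Curvature conventions: $R(X,Y)Z=\nabla_X\nabla_YZ-\nabla_Y\nabla_XZ-\nabla_{[X,Y]}Z$, $R(X,Y,Z,W)=g(R(X,Y)Z,W)$; $\rho$ is the Ricci tensor and $\tau$ the scalar curvature of $g$.
   Formalization: Added: it is not the case that a_0, a_1, a_2+a_5+2p a_8, a_3+a_6+2p a_9 and a_4+a_7+2p a_10 all vanish identically on N; otherwise (e.g. all a_i=0) B vanishes on horizontal vectors and N is GH-B-flat. The scalars are taken smooth. *)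

(* Defs.v *)
From HB Require Import structures.
From mathcomp Require Export all_boot all_order all_algebra all_fingroup.
From mathcomp Require Export all_classical all_reals all_analysis.
From mathcomp Require Export complex.

Set Implicit Arguments.
Unset Strict Implicit.
Unset Printing Implicit Defensive.

Export Order.TTheory GRing.Theory Num.Theory.
Export numFieldNormedType.Exports.

Local Open Scope classical_set_scope.
Local Open Scope ring_scope.

Definition iterD (R : realType) (n : nat) (W : normedModType R)
    (vs : seq 'rV[R]_n) (f : 'rV[R]_n -> W) : 'rV[R]_n -> W :=
  foldr (fun v h => 'D_v h) f vs.

(* C^oo on an open set O: all iterated directional derivatives exist and are
   continuous at every point of O. *)
Definition smooth_on (R : realType) (n : nat) (W : normedModType R)
    (O : set 'rV[R]_n) (f : 'rV[R]_n -> W) : Prop :=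
  forall (vs : seq 'rV[R]_n) (z : 'rV[R]_n), O z ->
    {for z, continuous (iterD vs f)} /\
    forall w, derivable (iterD vs f) z w.

(* C^m is the real space of rows (x, y) of length m + m standing for x + iy;
   w *m Jmx R m is then multiplication by i: (x, y) |-> (- y, x). *)
Definition Jmx (R : realType) (m : nat) : 'M[R]_(m + m) :=
  block_mx 0 1%:M (- 1%:M) 0.

(* Holomorphic = smooth with complex linear differential. *)
Definition holo_map_on (R : realType) (m : nat) (O : set 'rV[R]_(m + m))
    (f : 'rV[R]_(m + m) -> 'rV[R]_(m + m)) : Prop :=
  smooth_on O f /\
  forall z w, O z -> 'D_(w *m Jmx R m) f z = 'D_w f z *m Jmx R m.

Definition holo_fun_on (R : realType) (m : nat) (O : set 'rV[R]_(m + m))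
    (h : 'rV[R]_(m + m) -> R[i]) : Prop :=
  let a z := complex.Re (h z) in
  let b z := complex.Im (h z) in
  [/\ smooth_on O a, smooth_on O b &
      forall z w, O z ->
        'D_(w *m Jmx R m) a z = - 'D_w b z /\ 'D_(w *m Jmx R m) b z = 'D_w a z].

(* cmap and cinv are total functions; only their values on cdom and on the
   image of cdom are meaningful. *)
Record chart (R : realType) (n : nat) (N : topologicalType) := Chart {
  cdom : set N;
  cmap :> N -> 'rV[R]_n;
  cinv : 'rV[R]_n -> N;
  cdom_open : open cdom;
  cimg_open : open (cmap @` cdom);
  cmapK : forall x, cdom x -> cinv (cmap x) = x;
  cmap_cont : forall x, cdom x -> {for x, continuous cmap};
  cinv_cont : forall z, (cmap @` cdom) z -> {for z, continuous cinv} }.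

Definition cimg (R : realType) (n : nat) (N : topologicalType)
    (c : chart R n N) : set 'rV[R]_n := cmap c @` cdom c.

(* A complex manifold of complex dimension m. The atlas is indexed by the
   points: chart_at x is a holomorphic chart around x. *)
Record cmanifold (R : realType) (m : nat) := CManifold {
  carrier :> topologicalType;
  carrier_hausdorff : hausdorff_space carrier;
  carrier_second_countable : @second_countable carrier;
  chart_at : carrier -> chart R (m + m) carrier;
  chart_at_dom : forall x, cdom (chart_at x) x;
  transition_holo : forall x y,
    holo_map_on (chart_at x @` (cdom (chart_at x) `&` cdom (chart_at y)))
                (chart_at y \o cinv (chart_at x)) }.

Section Calculus.
Variables (R : realType) (m : nat) (N : cmanifold R m).

(* The tangent space at x is identified with R^(m+m) by means of the preferred
   chart chart_at x. As the transitions are holomorphic, the complex structure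
   J of every tangent space is then w |-> w *m Jmx R m. *)
Definition vfield : Type := N -> 'rV[R]_(m + m).
Definition form1 : Type := N -> 'rV[R]_(m + m) -> R.
Definition tensor11 : Type := N -> 'rV[R]_(m + m) -> 'rV[R]_(m + m).
Definition tensor02 : Type := N -> 'rV[R]_(m + m) -> 'rV[R]_(m + m) -> R.

(* Coordinates in the chart c of the tangent vector w at y. *)
Definition tcoord (c : chart R (m + m) N) (y : N) (w : 'rV[R]_(m + m)) :
    'rV[R]_(m + m) :=
  'D_w (cmap c \o cinv (chart_at y)) (chart_at y y).

(* Conversely, the tangent vector at cinv c z with coordinates e in c. *)
Definition tvec (c : chart R (m + m) N) (z e : 'rV[R]_(m + m)) :
    'rV[R]_(m + m) :=
  'D_e (chart_at (cinv c z) \o cinv c) z.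

Definition vrep (c : chart R (m + m) N) (X : vfield) (z : 'rV[R]_(m + m)) :
    'rV[R]_(m + m) :=
  tcoord c (cinv c z) (X (cinv c z)).

Definition smooth_fun (f : N -> R) : Prop :=
  forall x, smooth_on (cimg (chart_at x)) (f \o cinv (chart_at x)).

Definition smooth_vf (X : vfield) : Prop :=
  forall x, smooth_on (cimg (chart_at x)) (vrep (chart_at x) X).

(* The derivative X f. *)
Definition vact (X : vfield) (f : N -> R) : N -> R :=
  fun x => 'D_(X x) (f \o cinv (chart_at x)) (chart_at x x).

(* [X, Y], computed at x in the coordinates chart_at x. *)
Definition lie (X Y : vfield) : vfield := fun x =>
  'D_(X x) (vrep (chart_at x) Y) (chart_at x x)
  - 'D_(Y x) (vrep (chart_at x) X) (chart_at x x).

Definition fmulv (f : N -> R) (X : vfield) : vfield := fun x => f x *: X x.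
Definition ev1 (w : form1) (X : vfield) : N -> R := fun x => w x (X x).
Definition ev2 (g : tensor02) (X Y : vfield) : N -> R :=
  fun x => g x (X x) (Y x).
Definition ap (F : tensor11) (X : vfield) : vfield := fun x => F x (X x).

Definition Jt : tensor11 := fun _ w => w *m Jmx R m.

Definition is_form1 (w : form1) : Prop :=
  (forall x, scalar (w x)) /\
  (forall X, smooth_vf X -> smooth_fun (ev1 w X)).

Definition is_tensor11 (F : tensor11) : Prop :=
  (forall x, linear (F x)) /\
  (forall X, smooth_vf X -> smooth_vf (ap F X)).

(* 2 dw(X, Y) = X w(Y) - Y w(X) - w([X, Y]) *)
Definition dform (w : form1) (X Y : vfield) : N -> R := fun x =>
  (vact X (ev1 w Y) x - vact Y (ev1 w X) x - ev1 w (lie X Y) x) / 2%:R.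

(* A complex valued 1-form is holomorphic if it is of type (1,0) and its
   coefficients in the holomorphic charts are holomorphic functions. A
   (1,0)-form sum_k f_k dz_k takes the value f_k on d/dx_k, so that its values
   on constant coordinate fields are constant combinations of the f_k. *)
Definition holo_form1 (eta : N -> 'rV[R]_(m + m) -> R[i]) : Prop :=
  (forall x w, eta x (Jt x w) = (0 +i* 1)%C * eta x w) /\
  (forall x e, holo_fun_on (cimg (chart_at x))
     (fun z => eta (cinv (chart_at x) z) (tvec (chart_at x) z e))).

Definition is_riemannian (g : tensor02) : Prop :=
  [/\ forall x a b, g x a b = g x b a,
      forall x b, scalar (g x ^~ b),
      forall x a, a != 0 -> 0 < g x a a &
      forall X Y, smooth_vf X -> smooth_vf Y -> smooth_fun (ev2 g X Y)].

Definition is_hermitian (g : tensor02) : Prop :=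
  is_riemannian g /\ forall x a b, g x (Jt x a) (Jt x b) = g x a b.

(* Only the values of nabla on smooth vector fields are meaningful. *)
Record is_levi_civita (g : tensor02) (nabla : vfield -> vfield -> vfield) :
    Prop := IsLeviCivita {
  lc_smooth : forall X Y, smooth_vf X -> smooth_vf Y -> smooth_vf (nabla X Y);
  lc_lin : forall f X Y Z,
    smooth_fun f -> smooth_vf X -> smooth_vf Y -> smooth_vf Z ->
    nabla (fmulv f X + Y) Z = fmulv f (nabla X Z) + nabla Y Z;
  lc_add : forall X Y Z, smooth_vf X -> smooth_vf Y -> smooth_vf Z ->
    nabla X (Y + Z) = nabla X Y + nabla X Z;
  lc_leibniz : forall f X Y, smooth_fun f -> smooth_vf X -> smooth_vf Y ->
    nabla X (fmulv f Y) = fmulv (vact X f) Y + fmulv f (nabla X Y);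
  lc_metric : forall X Y Z, smooth_vf X -> smooth_vf Y -> smooth_vf Z ->
    forall x, vact X (ev2 g Y Z) x
              = ev2 g (nabla X Y) Z x + ev2 g Y (nabla X Z) x;
  lc_torsion : forall X Y, smooth_vf X -> smooth_vf Y ->
    nabla X Y - nabla Y X = lie X Y }.

Section Curvature.
Variables (g : tensor02) (nabla : vfield -> vfield -> vfield).

Definition curv (X Y Z : vfield) : vfield :=
  nabla X (nabla Y Z) - nabla Y (nabla X Z) - nabla (lie X Y) Z.

Definition curv4 (X Y Z W : vfield) : N -> R := ev2 g (curv X Y Z) W.

(* rho(Y, Z) = tr (X |-> R(X, Y)Z); L is the matrix, acting on row vectors, of
   this endomorphism of the tangent space at x. *)
Definition ricci (Y Z : vfield) : N -> R := fun x =>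
  \tr (xget (0 : 'M[R]_(m + m))
    [set L | forall X, smooth_vf X -> curv X Y Z x = X x *m L]).

(* tau = trace of rho with respect to g; L is the matrix of the Ricci operator
   of the tangent space at x. *)
Definition scal : N -> R := fun x =>
  \tr (xget (0 : 'M[R]_(m + m))
    [set L | forall X Y, smooth_vf X -> smooth_vf Y ->
             g x (X x *m L) (Y x) = ricci X Y x]).

Definition Btensor (a : nat -> N -> R) (X Y Z W : vfield) : N -> R := fun x =>
  a 0%N x * curv4 X Y Z W x + a 1%N x * curv4 X Z Y W x
  + a 2%N x * ricci Y Z x * ev2 g X W x + a 3%N x * ricci X Z x * ev2 g Y W x
  + a 4%N x * ricci X Y x * ev2 g Z W x + a 5%N x * ricci X W x * ev2 g Y Z x
  + a 6%N x * ricci Y W x * ev2 g X Z x + a 7%N x * ricci Z W x * ev2 g X Y x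
  + scal x * (a 8%N x * ev2 g X W x * ev2 g Y Z x
              + a 9%N x * ev2 g X Z x * ev2 g Y W x
              + a 10%N x * ev2 g X Y x * ev2 g Z W x).

(* B(X, Y)Z: at x, the tangent vector b with g(b, W) = B(X, Y, Z, W) for all
   W. *)
Definition Bvec (a : nat -> N -> R) (X Y Z : vfield) : vfield := fun x =>
  xget (0 : 'rV[R]_(m + m))
    [set b | forall W, smooth_vf W -> g x b (W x) = Btensor a X Y Z W x].

End Curvature.

End Calculus.

Section ComplexSasakian.
Variables (R : realType) (p : nat) (N : cmanifold R p.*2.+1).

Record ccstruct := CCStruct {
  cs_g : tensor02 N;
  cs_nabla : vfield N -> vfield N -> vfield N;
  cs_G : tensor11 N;
  cs_H : tensor11 N;
  cs_U : vfield N;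
  cs_V : vfield N;
  cs_u : form1 N;
  cs_v : form1 N }.

Variable S : ccstruct.

Local Notation g := (cs_g S).
Local Notation nabla := (cs_nabla S).
Local Notation G := (cs_G S).
Local Notation H := (cs_H S).
Local Notation U := (cs_U S).
Local Notation V := (cs_V S).
Local Notation u := (cs_u S).
Local Notation v := (cs_v S).
Local Notation J := (@Jt R p.*2.+1 N).

Definition eta : N -> 'rV[R]_(p.*2.+1 + p.*2.+1) -> R[i] :=
  fun x w => (u x w -i* v x w)%C.

Definition deta (X Y : vfield N) : N -> R[i] :=
  fun x => (dform u X Y x -i* dform v X Y x)%C.

(* (eta /\ (d eta)^p)(X_0, ..., X_2p), up to a nonzero constant factor which
   depends on the normalization of the exterior product. *)
Definition eta_wedge_deta (X : 'I_(p.*2.+1) -> vfield N) (x : N) : R[i] :=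
  \sum_(s : 'S_(p.*2.+1))
     (-1) ^+ odd_perm s * eta x (X (s ord0) x) *
     \prod_(k < p)
        deta (X (s (inord k.*2.+1))) (X (s (inord k.*2.+2))) x.

(* eta /\ (d eta)^p is nonzero at every point. *)
Definition contact_form : Prop :=
  forall x, exists2 X : 'I_(p.*2.+1) -> vfield N,
    (forall i, smooth_vf (X i)) & eta_wedge_deta X x != 0.

Record is_contact_metric : Prop := IsContactMetric {
  cc_hermitian : is_hermitian g;
  cc_levi_civita : is_levi_civita g nabla;
  cc_u_form : is_form1 u;
  cc_v_form : is_form1 v;
  cc_v : forall x w, v x w = u x (J x w);
  cc_eta_holo : holo_form1 eta;
  cc_contact : contact_form;
  cc_U_smooth : smooth_vf U;
  cc_V_smooth : smooth_vf V;
  cc_V : forall x, V x = - J x (U x);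
  cc_U_dual : forall x w, u x w = g x (U x) w;
  cc_V_dual : forall x w, v x w = g x (V x) w;
  cc_uU : forall x, u x (U x) = 1;
  cc_vV : forall x, v x (V x) = 1;
  cc_uV : forall x, u x (V x) = 0;
  cc_vU : forall x, v x (U x) = 0;
  cc_G_tensor : is_tensor11 G;
  cc_H_tensor : is_tensor11 H;
  cc_H : forall x w, H x w = G x (J x w);
  cc_GG : forall x w, G x (G x w) = - w + u x w *: U x + v x w *: V x;
  cc_HH : forall x w, H x (H x w) = - w + u x w *: U x + v x w *: V x;
  cc_GJ : forall x w, G x (J x w) = - J x (G x w);
  cc_GU : forall x, G x (U x) = 0;
  cc_G_skew : forall x a b, g x a (G x b) = - g x (G x a) b }.

Definition sigma (X : vfield N) : N -> R := ev2 g (nabla X U) V.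

(* (nabla_X F) Y *)
Definition nablaT (X : vfield N) (F : tensor11 N) (Y : vfield N) : vfield N :=
  nabla X (ap F Y) - ap F (nabla X Y).

(* [F, F](X, Y) *)
Definition nijenhuis (F : tensor11 N) (X Y : vfield N) : vfield N :=
  nablaT (ap F X) F Y - nablaT (ap F Y) F X
  - ap F (nablaT X F Y) + ap F (nablaT Y F X).

Definition Stensor (X Y : vfield N) : vfield N := fun x =>
  nijenhuis G X Y x
  + (2%:R * ev2 g X (ap G Y) x) *: U x - (2%:R * ev2 g X (ap H Y) x) *: V x
  + 2%:R *: (ev1 v Y x *: ap H X x - ev1 v X x *: ap H Y x)
  + sigma (ap G Y) x *: ap H X x - sigma (ap G X) x *: ap H Y x
  + sigma X x *: ap G (ap H Y) x - sigma Y x *: ap G (ap H X) x.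

Definition Ttensor (X Y : vfield N) : vfield N := fun x =>
  nijenhuis H X Y x
  - (2%:R * ev2 g X (ap G Y) x) *: U x + (2%:R * ev2 g X (ap H Y) x) *: V x
  + 2%:R *: (ev1 u Y x *: ap G X x - ev1 u X x *: ap G Y x)
  + sigma (ap H X) x *: ap G Y x - sigma (ap H Y) x *: ap G X x
  + sigma X x *: ap G (ap H Y) x - sigma Y x *: ap G (ap H X) x.

Definition horizontal (X : vfield N) : Prop :=
  forall x, u x (X x) = 0 /\ v x (X x) = 0.

Definition is_normal : Prop :=
  (forall X Y, smooth_vf X -> smooth_vf Y -> horizontal X -> horizontal Y ->
     forall x, Stensor X Y x = 0 /\ Ttensor X Y x = 0) /\
  (forall X, smooth_vf X ->
     forall x, Stensor X U x = 0 /\ Ttensor X V x = 0).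

Definition is_complex_sasakian : Prop :=
  [/\ is_contact_metric, is_normal,
      forall X Y, smooth_vf X -> smooth_vf Y ->
        forall x, ev2 g X (ap G Y) x = dform u X Y x &
      forall X Y, smooth_vf X -> smooth_vf Y ->
        forall x, ev2 g X (ap H Y) x = dform v X Y x].

Definition GH_B_flat (a : nat -> N -> R) : Prop :=
  let B := Bvec g nabla a in
  forall X Y Z, smooth_vf X -> smooth_vf Y -> smooth_vf Z ->
    (forall x, ap G (ap G (B (ap G X) (ap G Y) (ap G Z))) x = 0) /\
    (forall x, ap H (ap H (B (ap H X) (ap H Y) (ap H Z))) x = 0).

End ComplexSasakian.

(* On a complex Sasakian manifold rho = - 4 g on horizontal vectors and
   tau = - 8 p. Hence, if all the equations below hold at every point, then
   B(X, Y, Z, W) = 0 for all horizontal X, Y, Z, W, whatever the manifold: these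
   coefficients (for instance a_0 = ... = a_10 = 0, or a_2 = - a_5 = 1 and the
   others 0) have to be excluded. *)
Definition horizontally_trivial (R : realType) (p : nat)
    (N : cmanifold R p.*2.+1) (a : nat -> N -> R) : Prop :=
  forall x : N,
    [/\ a 0%N x = 0, a 1%N x = 0,
        a 2%N x + a 5%N x + 2%:R * p%:R * a 8%N x = 0,
        a 3%N x + a 6%N x + 2%:R * p%:R * a 9%N x = 0 &
        a 4%N x + a 7%N x + 2%:R * p%:R * a 10%N x = 0].

(* Main.v *)
(* The contact condition provides, at every point, global smooth fields X_i such
   that the X_i and J X_i span the tangent space. Hence tangent vectors extend to
   global smooth fields, and Cramer's rule for the Gram matrix of a global field
   of frames yields the tensoriality of the curvature, without cut-off functions.

   Normality and du = g(., G .), dv = g(., H .) give sigma = 0,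
   nabla_X U = - G X and nabla_X V = - H X, then formulas for nabla G and nabla H
   on horizontal vectors, and so the commutators of R(X, Y) with G and H. After
   the O'Neill correction, the horizontal part of R commutes with G and H and has
   the symmetries of a curvature tensor: it is a hyperkaehler curvature tensor,
   hence Ricci-flat. Therefore rho = - 4 g on horizontal vectors and tau = - 8 p.

   On horizontal vectors GH-B-flatness thus becomes
     a0 R(X,Y,Z,W) + a1 R(X,Z,Y,W) + al g(X,W) g(Y,Z) + be g(X,Z) g(Y,W)
       + ga g(X,Y) g(Z,W) = 0,
   where al, be, ga are - 4 times the last three expressions of
   [horizontally_trivial]. Evaluating it on X, HG X, G X, H X with X a horizontal
   unit vector shows that all five coefficients vanish. *)

(* Each tangent space is read in its own chart [chart_at x], and these charts depend on [x] without
   any continuity. Hence [vact] and [lie] must be rewritten in one fixed chart before they can be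
   differentiated again. The chain rule used for this needs Fréchet differentiability, whereas
   [smooth_on] speaks of directional derivatives only.

   No quotient manifold is formed: [KK] adds O'Neill's terms to the curvature inside each tangent
   space, and its hyperkaehler symmetries are checked algebraically. Ricci-flatness comes from the
   Bianchi identity, which makes [rhoK b (f c)] symmetric in [b], [c] for [f] equal to [G], [H] and
   [HG]; the two resulting values of [rhoK b (H (G c))] differ by a sign.

   The constants: - 4 is 1 + 1 from the planes containing [U] and [V], minus 6 from the trace of
   O'Neill's terms; - 8 p is (- 4)(4 p) + 4 p + 4 p, the last two being the Ricci curvatures of [U]
   and [V]. For p = 1 the vectors X, HG X, G X, H X already span the horizontal space, so these four
   have to separate all five coefficients. *)
From HB Require Import structures.
Require Import Defs.
From mathcomp Require Import lra ring.

Set Implicit Arguments.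
Unset Strict Implicit.
Unset Printing Implicit Defensive.

Local Open Scope classical_set_scope.
Local Open Scope ring_scope.

(** * Calculus of smooth functions of several real variables *)

Section LineDerivative.
Context {R : realType} {V : normedModType R}.
Implicit Types (f : V -> R) (z v w : V).

Lemma is_derive_line f z v (t : R) : derivable f (t *: v + z) v ->
  is_derive t 1 (fun h : R => f (h *: v + z)) ('D_v f (t *: v + z)).
Proof.
move=> df.
have E : (fun h : R => h^-1 *: (f ((h *: (1:R) + t) *: v + z) - f (t *: v + z)))
   = (fun h => h^-1 *: (f (h *: v + (t *: v + z)) - f (t *: v + z))).
  by apply/funext => h; rewrite [h *: 1]mulr1 scalerDl addrA.
split; first by rewrite /derivable E.
by rewrite /derive E.
Qed.

Lemma mvt_line f z v :
  (forall t : R, 0 <= t <= 1 -> derivable f (t *: v + z) v) ->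
  exists2 t : R, 0 <= t <= 1 & f (v + z) - f z = 'D_v f (t *: v + z).
Proof.
move=> df.
have [||c cab E] := @MVT R (fun h : R => f (h *: v + z))
   (fun t => 'D_v f (t *: v + z)) 0 1 ltr01.
- move=> x; rewrite in_itv /= => /andP[x0 x1].
  by apply/is_derive_line/df; rewrite !ltW.
- apply: derivable_within_continuous => x; rewrite in_itv /= => x01.
  by have [] := is_derive_line (df _ x01).
exists c; first by move: cab; rewrite in_itv /= => /andP[/ltW-> /ltW->].
by move: E; rewrite scale1r scale0r add0r subr0 mulr1.
Qed.

Lemma derive_scale f z v (k : R) : derivable f z v ->
  derivable f z (k *: v) /\ 'D_(k *: v) f z = k * 'D_v f z.
Proof.
move=> df.
have df0 : derivable f (0 *: v + z) v by rewrite scale0r add0r.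
have /derivable1P D1 := df; pose g (h : R) := f (h *: v + z).
have Dg : is_derive (0 : R) 1 g ('D_v f z).
  by have := is_derive_line df0; rewrite scale0r add0r.
have Dk : is_derive (0 : R) 1 (fun h : R => h * k) k.
  have -> : (fun h : R => h * k) = k \*: (@idfun R).
    by apply/funext => h /=; rewrite mulrC.
  apply: is_derive_eq.
  by rewrite [k *: 1]mulr1.
have Dgk : is_derive (0:R) 1 (g \o (fun h : R => h * k)) (k * 'D_v f z).
  have -> : k * 'D_v f z = 'D_v f z *: k by rewrite mulrC.
  apply: is_derive1_comp.
  by rewrite mul0r.
have E : g \o (fun h : R => h * k) = (fun h : R => f (h *: (k *: v) + z)).
  by apply/funext => h; rewrite /g /= scalerA.
rewrite E in Dgk.
have dk : derivable f z (k *: v) by apply/derivable1P; case: Dgk.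
split=> //.
have dk0 : derivable f (0 *: (k *: v) + z) (k *: v) by rewrite scale0r add0r.
have [_ E1] := is_derive_line dk0; case: Dgk => _ E2.
by rewrite scale0r add0r in E1; rewrite -E1 -E2.
Qed.

(** Precedes differentiability, which relies on it. The step [h (v + w)] is walked in two legs,
    along [h v] and then [h w]; the mean value theorem turns each leg into a derivative at a point
    near [z], and continuity does the rest. *)
Lemma C1_derive_add f z :
  (\forall y \near z, forall v, derivable f y v) ->
  (forall v, {for z, continuous ('D_v f)}) ->
  forall v w, 'D_(v + w) f z = 'D_v f z + 'D_w f z.
Proof.
move=> df cf v w; apply/cvg_lim => //; apply/cvgrPdist_lt => e e0.
have e20 : 0 < e / 2 by rewrite divr_gt0.
have : \forall y \near z, [/\ forall v, derivable f y v,
    `|'D_v f z - 'D_v f y| < e / 2 & `|'D_w f z - 'D_w f y| < e / 2].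
  near=> y; split; first by near: y.
  - by near: y; move/cvgrPdist_lt: (cf v); apply.
  - by near: y; move/cvgrPdist_lt: (cf w); apply.
move=> /nbhs_ballP[r /= r0 Hr].
have Hr' u : `|u| < r -> [/\ forall v, derivable f (u + z) v,
    `|'D_v f z - 'D_v f (u + z)| < e / 2 & `|'D_w f z - 'D_w f (u + z)| < e / 2].
  by move=> ur; apply: Hr; rewrite -ball_normE /= distrC addrK.
near=> h.
have h0 : h != 0 by near: h; exact: nbhs_dnbhs_neq.
have hr : `|h| * (`|v| + `|w| + 1) < r.
  rewrite -ltr_pdivlMr; last by rewrite ltr_wpDl ?addr_ge0.
  by near: h; apply: dnbhs0_lt; rewrite divr_gt0 // ltr_wpDl ?addr_ge0.
have bnd (s t : R) : 0 <= s <= 1 -> 0 <= t <= 1 ->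
    `|s *: (h *: w) + t *: (h *: v)| < r.
  move=> /andP[s0 s1] /andP[t0 t1]; apply: le_lt_trans hr.
  rewrite (le_trans (ler_normD _ _)) // !normrZ (ger0_norm s0) (ger0_norm t0).
  have hv : 0 <= `|h| * `|v| by rewrite mulr_ge0.
  have hw : 0 <= `|h| * `|w| by rewrite mulr_ge0.
  have h1 : 0 <= `|h| by [].
  apply: (@le_trans _ _ (`|h| * `|w| + `|h| * `|v|)).
    by apply: lerD; apply: ler_piMl.
  by rewrite !mulrDr mulr1; lra.
have l01 : 0 <= (0:R) <= 1 by rewrite lexx ler01.
have l11 : 0 <= (1:R) <= 1 by rewrite lexx ler01.
have [t t01 Et] : exists2 t : R, 0 <= t <= 1 &
    f (h *: v + z) - f z = 'D_(h *: v) f (t *: (h *: v) + z).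
  apply: mvt_line => t t01.
  by have [] := Hr' _ (bnd 0 t l01 t01); rewrite scale0r add0r => + _ _; apply.
have [s s01 Es] : exists2 s : R, 0 <= s <= 1 &
    f (h *: w + (h *: v + z)) - f (h *: v + z) =
    'D_(h *: w) f (s *: (h *: w) + (h *: v + z)).
  apply: mvt_line => s s01.
  by have [] := Hr' _ (bnd s 1 s01 l11); rewrite scale1r -addrA => + _ _; apply.
have -> : f ((h *: (v + w)) + z) - f z = h *: ('D_v f (t *: (h *: v) + z)
   + 'D_w f (s *: (h *: w) + (h *: v + z))).
  have [dt _ _] := Hr' _ (bnd 0 t l01 t01).
  have [ds _ _] := Hr' _ (bnd s 1 s01 l11).
  rewrite scale0r add0r in dt; rewrite scale1r -addrA in ds.
  rewrite [RHS](mulrDr h) -(derive_scale _ (dt v)).2 -(derive_scale _ (ds w)).2.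
  by rewrite -Et -Es scalerDr (addrC (h *: v)) -(addrA (h *: w)) [RHS]addrC subrKA.
rewrite (scalerA h^-1 h) mulVf // scale1r.
have [_ Bv _] := Hr' _ (bnd 0 t l01 t01).
have [_ _ Bw] := Hr' _ (bnd s 1 s01 l11).
rewrite scale0r add0r in Bv; rewrite scale1r -addrA in Bw.
rewrite opprD addrACA (le_lt_trans (ler_normD _ _)) // (splitr e).
exact: ltrD.
Unshelve. all: by end_near. Qed.

End LineDerivative.

(** * Continuous directional derivatives imply differentiability *)

Section C1Differentiable.
Context {R : realType} {n : nat}.
Implicit Types (f : 'rV[R]_n -> R) (O : set 'rV[R]_n).

Definition C1_on O f := forall z, O z ->
  (forall v, derivable f z v) /\ (forall v, {for z, continuous ('D_v f)}).

Lemma C1_deriveE O f z v : open O -> C1_on O f -> O z ->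
  'D_v f z = \sum_j v 0 j * 'D_(delta_mx 0 j) f z.
Proof.
move=> oO Cf Oz.
have dn : \forall y \near z, forall v, derivable f y v.
  near=> y; have /Cf[+ _] : O y by near: y; exact: open_nbhs_nbhs.
  exact.
have [d c] := Cf _ Oz.
rewrite {1}[v]row_sum_delta.
have -> : forall (I : seq 'I_n),
  'D_(\sum_(j <- I) v 0 j *: delta_mx 0 j) f z
   = \sum_(j <- I) v 0 j * 'D_(delta_mx 0 j) f z; last by [].
elim=> [|i I IH]; first by rewrite !big_nil derive0.
by rewrite !big_cons (C1_derive_add dn c) IH (derive_scale _ (d _)).2.
Unshelve. all: by end_near. Qed.

Lemma C1_differentiable O f z : open O -> C1_on O f -> O z -> differentiable f z.
Proof.
move=> oO Cf Oz.
pose c := \col_j 'D_(delta_mx 0 j) f z.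
pose l (v : 'rV[R]_n) : R := (v *m c) 0 0.
have ll : linear l by move=> k u v; rewrite /l mulmxDl -scalemxAl !mxE.
pose lM := GRing.isLinear.Build _ _ _ _ _ ll.
pose L : {linear 'rV[R]_n -> R} := HB.pack l lM.
have lE v : l v = \sum_j v 0 j * 'D_(delta_mx 0 j) f z.
  by rewrite /l mxE; apply: eq_bigr => j _; rewrite !mxE.
have cl : continuous L.
  rewrite (_ : (L : _ -> _) = fun v => \sum_j v 0 j * 'D_(delta_mx 0 j) f z); last first.
    by apply/funext => w; rewrite -lE.
  apply: continuous_big => [|j _]; first exact: add_continuous.
  have cj (v : 'rV[R]_n) : {for v, continuous
      (fun v : 'rV[R]_n => v 0 j * 'D_(delta_mx 0 j) f z)}.
    by apply: (@continuousM R _ (fun v : 'rV[R]_n => v 0 j)); [exact: coord_continuous | exact: cst_continuous].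
  exact: cj.
suff exp : f \o shift z = cst (f z) + L +o_ (0 : 'rV[R]_n) id.
  by apply/diff_locallyP; rewrite (diff_unique cl exp).
apply/eqaddoP => _/posnumP[e].
(* Dividing by [n.+1] keeps the bound positive for [n = 0] too; the [n] coordinate errors then add
   up to at most [e]. *)
have e'0 : 0 < e%:num / n.+1%:R by rewrite divr_gt0.
have : \forall y \near z, O y /\
    forall j : 'I_n, `|'D_(delta_mx 0 j) f z - 'D_(delta_mx 0 j) f y| <= e%:num / n.+1%:R.
  near=> y; split; first by near: y; exact: open_nbhs_nbhs.
  near: y; apply: filter_forall => j.
  by move/cvgrPdist_le: ((Cf _ Oz).2 (delta_mx 0 j)); apply.
move=> /nbhs_ballP[r /= r0 Hr].
near=> v.
have vr : `|v| < r.
  near: v; apply/nbhs_ballP; exists r => //= y; rewrite -ball_normE /=.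
  by rewrite sub0r normrN.
have Hv (t : R) : 0 <= t <= 1 -> O (t *: v + z) /\ forall j : 'I_n,
   `|'D_(delta_mx 0 j) f z - 'D_(delta_mx 0 j) f (t *: v + z)| <= e%:num / n.+1%:R.
  move=> /andP[t0 t1]; apply: Hr; rewrite -ball_normE /= distrC addrK.
  rewrite normrZ ger0_norm //; apply: le_lt_trans vr.
  by rewrite ler_piMl.
have [t t01 E] : exists2 t : R, 0 <= t <= 1 & f (v + z) - f z = 'D_v f (t *: v + z).
  by apply: mvt_line => t /Hv[/Cf[+ _] _]; apply.
have [Ot Bt] := Hv _ t01.
rewrite /= !fctE /cst opprD addrA E (C1_deriveE _ oO Cf Ot) lE -sumrB.
apply: le_trans (ler_norm_sum _ _ _) _.
apply: (@le_trans _ _ (\sum_(j < n) (e%:num / n.+1%:R) * `|v|)).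
  apply: ler_sum => j _; rewrite -mulrBr normrM mulrC ler_pM //.
    by rewrite distrC Bt.
  rewrite [leRHS]/Num.Def.normr/= mx_normrE.
  exact: (le_bigmax _ (fun ij => `|v ij.1 ij.2|) (0, j)).
rewrite sumr_const card_ord -mulrnAl ler_wpM2r // -mulr_natr mulrAC.
by rewrite ler_pdivrMr // ler_wpM2l // ler_nat.
Unshelve. all: by end_near. Qed.

End C1Differentiable.

(** * Symmetry of second derivatives *)

Section Schwarz.
Context {R : realType} {V : normedModType R}.
Implicit Types (f : V -> R) (z v w : V).

Lemma derive_shiftE f a z v :
  'D_v (fun y => f (a + y)) z = 'D_v f (a + z).
Proof.
rewrite /derive; set g1 := fun h => _; set g2 := fun h => _.
by suff -> : g1 = g2 by []; apply/funext => h; rewrite /g1 /g2 /= addrCA.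
Qed.

Lemma derivable_shift f a z v :
  derivable f (a + z) v -> derivable (fun y => f (a + y)) z v.
Proof.
rewrite /derivable.
have -> // : (fun h : R => h^-1 *: (f (h *: v + (a + z)) - f (a + z))) =
  (fun h : R => h^-1 *: (f (a + (h *: v + z)) - f (a + z))).
by apply/funext => h; rewrite addrCA.
Qed.

(** Mean value theorem twice: for [y |-> f (h w + y) - f y] along [h v], then for ['D_v f] along
    [h w]. *)
Lemma second_difference f z v w (h : R) :
  (forall s t : R, 0 <= s <= 1 -> 0 <= t <= 1 ->
     let y := s *: (h *: w) + (t *: (h *: v) + z) in
     (forall u, derivable f y u) /\ forall u, derivable ('D_v f) y u) ->
  exists s t : R, [/\ 0 <= s <= 1, 0 <= t <= 1 &
    f (h *: w + (h *: v + z)) - f (h *: v + z) - (f (h *: w + z) - f z) =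
    h * (h * 'D_w ('D_v f) (s *: (h *: w) + (t *: (h *: v) + z)))].
Proof.
move=> Hd.
have l01 : 0 <= (0:R) <= 1 by rewrite lexx ler01.
have l11 : 0 <= (1:R) <= 1 by rewrite lexx ler01.
pose phi y := f (h *: w + y) - f y.
have d1 (t : R) u : 0 <= t <= 1 -> derivable f (h *: w + (t *: (h *: v) + z)) u.
  by move=> t01; have [+ _] := Hd 1 t l11 t01; rewrite scale1r; apply.
have d0 (t : R) u : 0 <= t <= 1 -> derivable f (t *: (h *: v) + z) u.
  by move=> t01; have [+ _] := Hd 0 t l01 t01; rewrite scale0r add0r; apply.
have [t t01 Et] : exists2 t : R, 0 <= t <= 1 &
    phi (h *: v + z) - phi z = 'D_(h *: v) phi (t *: (h *: v) + z).
  apply: mvt_line => t t01; apply: derivableB; last exact: d0.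
  exact/derivable_shift/d1.
have [s s01 Es] : exists2 s : R, 0 <= s <= 1 &
    'D_v f (h *: w + (t *: (h *: v) + z)) - 'D_v f (t *: (h *: v) + z)
    = 'D_(h *: w) ('D_v f) (s *: (h *: w) + (t *: (h *: v) + z)).
  by apply: mvt_line => s s01; have [_] := Hd s t s01 t01; apply.
exists s, t; split => //.
rewrite -[LHS]/(phi (h *: v + z) - phi z) Et.
have dphi : 'D_(h *: v) phi (t *: (h *: v) + z) =
  h * ('D_v f (h *: w + (t *: (h *: v) + z)) - 'D_v f (t *: (h *: v) + z)).
  rewrite /phi deriveB; [|exact/derivable_shift/d1|exact: d0].
  rewrite derive_shiftE (derive_scale _ (d1 _ _ t01)).2.
  by rewrite (derive_scale _ (d0 _ _ t01)).2 mulrBr.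
rewrite dphi Es; have [_ dd] := Hd s t s01 t01.
by rewrite (derive_scale _ (dd w)).2.
Qed.

(** The second difference of [f] over the parallelogram spanned by [h v] and [h w] is symmetric in
    [v] and [w]. Read in the two orders, it equates values of the two mixed derivatives at points
    arbitrarily close to [z]. *)
Lemma schwarz f z v w :
  (\forall y \near z, (forall u, derivable f y u) /\
     (forall u, derivable ('D_v f) y u) /\ (forall u, derivable ('D_w f) y u)) ->
  {for z, continuous ('D_w ('D_v f))} ->
  {for z, continuous ('D_v ('D_w f))} ->
  'D_w ('D_v f) z = 'D_v ('D_w f) z.
Proof.
move=> Hd c1 c2; apply/eqP; rewrite -subr_eq0 -normr_eq0; apply/eqP.
apply/le_anti; rewrite normr_ge0 andbT; apply/ler_addgt0Pr => e e0; rewrite add0r.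
have e20 : 0 < e / 2 by rewrite divr_gt0.
have N1 : \forall y \near z, `|'D_w ('D_v f) z - 'D_w ('D_v f) y| <= e / 2.
  by move/cvgrPdist_le: c1; apply.
have N2 : \forall y \near z, `|'D_v ('D_w f) z - 'D_v ('D_w f) y| <= e / 2.
  by move/cvgrPdist_le: c2; apply.
have N := filterI Hd (filterI N1 N2).
have [r /= r0 Hr] := (nbhs_ballP _ _).1 (N _ _).
pose M := `|v| + `|w| + 1.
have M0 : 0 < M by rewrite ltr_wpDl ?addr_ge0.
(* As [M] exceeds [|v| + |w|], this size of [h] keeps the whole parallelogram in the ball of radius
   [r]. *)
have [h [h0 hM]] : exists h, 0 < h /\ h * M = r / 2.
  by exists (r / 2 / M); rewrite !divr_gt0 // divfK // gt_eqF.
have bnd (s t : R) : 0 <= s <= 1 -> 0 <= t <= 1 ->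
    ball z r (s *: (h *: w) + (t *: (h *: v) + z)).
  move=> /andP[s0 s1] /andP[t0 t1].
  rewrite -ball_normE /= distrC addrA addrK.
  rewrite (le_lt_trans (ler_normD _ _)) // !normrZ (ger0_norm s0) (ger0_norm t0).
  rewrite (gtr0_norm h0).
  apply: (@le_lt_trans _ _ (h * `|w| + h * `|v|)).
    by apply: lerD; apply: ler_piMl => //; rewrite mulr_ge0 // ltW.
  by move: hM; rewrite /M !mulrDr; lra.
have [|s [t [s01 t01 E1]]] := @second_difference f z v w h.
  move=> s t s01 t01; have [A _] := Hr _ (bnd s t s01 t01); have [d1 [d2 _]] := A.
  exact: (conj d1 d2).
have bnd' (s' t' : R) : 0 <= s' <= 1 -> 0 <= t' <= 1 ->
    ball z r (s' *: (h *: v) + (t' *: (h *: w) + z)).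
  by move=> s0 t0; rewrite addrCA; apply: bnd.
have [|s' [t' [s01' t01' E2]]] := @second_difference f z w v h.
  move=> s' t' s0 t0; have [A _] := Hr _ (bnd' s' t' s0 t0); have [d1 [_ d2]] := A.
  exact: (conj d1 d2).
have [_ [B1 _]] := Hr _ (bnd s t s01 t01).
have [_ [_ B2]] := Hr _ (bnd' s' t' s01' t01').
have E : 'D_w ('D_v f) (s *: (h *: w) + (t *: (h *: v) + z)) =
   'D_v ('D_w f) (s' *: (h *: v) + (t' *: (h *: w) + z)).
  apply: (mulfI (lt0r_neq0 h0)); apply: (mulfI (lt0r_neq0 h0)).
  apply: eq_trans (esym E1) (eq_trans _ E2); rewrite (addrCA (h *: v)).
  by rewrite opprB opprB addrACA [RHS]addrACA (addrC (- _) (- f _)).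
rewrite -(subrKA ('D_w ('D_v f) (s *: (h *: w) + (t *: (h *: v) + z)))).
apply: le_trans (ler_normD _ _) _; rewrite [leRHS]splitr.
apply: lerD; first exact: B1.
rewrite E distrC; exact: B2.
Qed.

End Schwarz.

(** * Closure properties of smooth functions on an open set *)

Section SmoothOn.
Context {R : realType} {n : nat}.
Implicit Types (O : set 'rV[R]_n) (z v w : 'rV[R]_n).

Definition C1_at {W : normedModType R} O (f : 'rV[R]_n -> W) :=
  forall z, O z -> {for z, continuous f} /\ forall w, derivable f z w.

(** Recursion on the innermost derivative, whereas [foldr] in [iterD] exposes the outermost one: the
    sum and product rules apply to ['D_v f] first, and the induction then goes on with the new
    function. *)
Fixpoint Ck {W : normedModType R} k O (f : 'rV[R]_n -> W) : Prop :=
  C1_at O f /\ if k is k'.+1 then forall v, Ck k' O ('D_v f) else True.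

Lemma CkP {W : normedModType R} k O (f : 'rV[R]_n -> W) : Ck k O f <->
  forall vs, (size vs <= k)%N -> C1_at O (iterD vs f).
Proof.
elim: k f => [|k IH] f /=.
  split=> [[H _] [|//] _ //|H]; split=> //; exact: (H [::]).
split=> [[H0 H] vs|H].
  case/lastP: vs => [//|vs v]; rewrite size_rcons ltnS => sz.
  by rewrite /iterD foldr_rcons; move/IH: (H v); apply.
split; first exact: (H [::]).
move=> v; apply/IH => vs sz.
have := H (rcons vs v); rewrite size_rcons ltnS => /(_ sz).
by rewrite /iterD foldr_rcons.
Qed.

Lemma smooth_onP {W : normedModType R} O (f : 'rV[R]_n -> W) :
  smooth_on O f <-> forall k, Ck k O f.
Proof.
split=> [H k|H vs]; first by apply/CkP => vs _; exact: H.
by move/CkP: (H (size vs)) => /(_ vs (leqnn _)).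
Qed.

Lemma smooth_on_derive {W : normedModType R} O (f : 'rV[R]_n -> W) v :
  smooth_on O f -> smooth_on O ('D_v f).
Proof. by move=> Hf vs; have := Hf (rcons vs v); rewrite /iterD foldr_rcons. Qed.

Lemma smooth_on_sub {W : normedModType R} O O' (f : 'rV[R]_n -> W) :
  O' `<=` O -> smooth_on O f -> smooth_on O' f.
Proof. by move=> OO Hf vs z /OO; exact: Hf. Qed.

Lemma smooth_on_derivable {W : normedModType R} O (f : 'rV[R]_n -> W) z v :
  smooth_on O f -> O z -> derivable f z v.
Proof. by move=> /(_ [::]) /= H /H[]. Qed.

Lemma smooth_on_continuous {W : normedModType R} O (f : 'rV[R]_n -> W) z :
  smooth_on O f -> O z -> {for z, continuous f}.
Proof. by move=> /(_ [::]) /= H /H[]. Qed.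

Lemma open_near O z (P : 'rV[R]_n -> Prop) : open O -> O z ->
  (forall y, O y -> P y) -> \forall y \near z, P y.
Proof.
move=> oO Oz H; have : nbhs z O by exact: open_nbhs_nbhs.
exact: filterS.
Qed.

Lemma derive_on_eq {W : normedModType R} O (f g : 'rV[R]_n -> W) z v :
  open O -> O z -> (forall y, O y -> f y = g y) -> 'D_v f z = 'D_v g z.
Proof. by move=> oO Oz fg; apply: near_eq_derive; exact: open_near fg. Qed.

Lemma C1_at_eq {W : normedModType R} O (f g : 'rV[R]_n -> W) :
  open O -> (forall y, O y -> f y = g y) -> C1_at O f -> C1_at O g.
Proof.
move=> oO fg Hf z Oz; have [cf df] := Hf z Oz; split=> [|w].
  have /near_eq_cvg H : {near z, f =1 g} by exact: open_near fg.
  by rewrite /prop_for /continuous_at -(fg _ Oz); exact: cvg_trans H cf.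
by apply: near_eq_derivable (df w); exact: open_near fg.
Qed.

Lemma Ck_eq {W : normedModType R} k O (f g : 'rV[R]_n -> W) : open O ->
  (forall y, O y -> f y = g y) -> Ck k O f -> Ck k O g.
Proof.
elim: k f g => [|k IH] f g oO fg /= [H0 H]; split; try exact: C1_at_eq H0.
  by [].
move=> v; apply: IH (H v) => // y Oy; exact: derive_on_eq fg.
Qed.

Lemma smooth_on_eq {W : normedModType R} O (f g : 'rV[R]_n -> W) : open O ->
  (forall y, O y -> f y = g y) -> smooth_on O f -> smooth_on O g.
Proof.
move=> oO fg /smooth_onP Hf; apply/smooth_onP => k; exact: Ck_eq (Hf k).
Qed.

Lemma smooth_on_cst {W : normedModType R} O (c : W) :
  smooth_on O (fun=> c : W).
Proof.
apply/smooth_onP => k; elim: k c => [|k IH] c /=; split=> //.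
- by move=> z _; split; [exact: cst_continuous|exact: derivable_cst].
- by move=> z _; split; [exact: cst_continuous|exact: derivable_cst].
- move=> v; have -> : 'D_v (fun=> c) = (fun=> 0) :> ('rV[R]_n -> W) => //.
  by apply/funext => z; rewrite derive_cst.
Qed.

Lemma C1_atD {W : normedModType R} O (f g : 'rV[R]_n -> W) :
  C1_at O f -> C1_at O g -> C1_at O (fun z => f z + g z).
Proof.
move=> Hf Hg z Oz; have [cf df] := Hf z Oz; have [cg dg] := Hg z Oz.
split=> [|w]; first exact: continuousD.
by apply: derivableD; [exact: df|exact: dg].
Qed.

Lemma CkD {W : normedModType R} k O (f g : 'rV[R]_n -> W) : open O ->
  Ck k O f -> Ck k O g -> Ck k O (fun z => f z + g z).
Proof.
move=> oO; elim: k f g => [|k IH] f g /= [Hf Hf'] [Hg Hg'].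
  by split=> //; exact: C1_atD.
split=> [|v]; first exact: C1_atD.
apply: Ck_eq (IH _ _ (Hf' v) (Hg' v)) => // z Oz.
have [_ df] := Hf z Oz; have [_ dg] := Hg z Oz.
by rewrite -[RHS]/('D_v (f + g) z) deriveD; [|exact: df|exact: dg].
Qed.

Lemma smooth_onD {W : normedModType R} O (f g : 'rV[R]_n -> W) : open O ->
  smooth_on O f -> smooth_on O g -> smooth_on O (fun z => f z + g z).
Proof.
move=> oO /smooth_onP Hf /smooth_onP Hg; apply/smooth_onP => k; exact: CkD.
Qed.

(** In the Leibniz rule one factor stays undifferentiated. So only the product is measured by
    [Ck k], while both factors are kept smooth to all orders throughout the induction. *)
Lemma smooth_onM O (f g : 'rV[R]_n -> R) : open O ->
  smooth_on O f -> smooth_on O g -> smooth_on O (fun z => f z * g z).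
Proof.
move=> oO Hf Hg; apply/smooth_onP => k.
have C1fg (a b : 'rV[R]_n -> R) : smooth_on O a -> smooth_on O b ->
    C1_at O (fun z => a z * b z).
  move=> Ha Hb z Oz; split=> [|w].
    have ca := smooth_on_continuous Ha Oz; have cb := smooth_on_continuous Hb Oz.
    exact: (continuousM ca cb).
  have da := smooth_on_derivable (v := w) Ha Oz.
  have db := smooth_on_derivable (v := w) Hb Oz.
  exact: (derivableM da db).
elim: k f g Hf Hg => [|k IH] f g Hf Hg /=; first by split=> //; exact: C1fg.
split=> [|v]; first exact: C1fg.
have Hfg := IH _ _ Hf (smooth_on_derive v Hg).
have Hgf := IH _ _ Hg (smooth_on_derive v Hf).
apply: Ck_eq (CkD oO Hfg Hgf) => // z Oz.
have df := smooth_on_derivable (v := v) Hf Oz.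
have dg := smooth_on_derivable (v := v) Hg Oz.
by rewrite -[RHS]/('D_v (f * g) z) deriveM.
Qed.

Lemma derive_coord m (F : 'rV[R]_n -> 'rV[R]_m) j v z :
  derivable F z v -> 'D_v F z 0 j = 'D_v (fun y => F y 0 j) z.
Proof. by move=> dF; rewrite derive_mx // mxE. Qed.

Lemma iterD_coord m O (F : 'rV[R]_n -> 'rV[R]_m) j vs z : open O ->
  smooth_on O F -> O z -> iterD vs (fun y => F y 0 j) z = iterD vs F z 0 j.
Proof.
move=> oO HF; elim: vs z => [//|v vs IH] z Oz /=.
rewrite (derive_on_eq _ oO Oz IH) derive_coord //.
by have [_] := HF vs z Oz; apply.
Qed.

Lemma smooth_on_coord m O (F : 'rV[R]_n -> 'rV[R]_m) j : open O ->
  smooth_on O F -> smooth_on O (fun y => F y 0 j).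
Proof.
move=> oO HF vs z Oz; have [c d] := HF vs z Oz.
have E y : O y -> iterD vs F y 0 j = iterD vs (fun y => F y 0 j) y.
  by move=> Oy; rewrite (iterD_coord j vs oO HF Oy).
have : C1_at O (fun y => iterD vs F y 0 j).
  move=> y Oy; have [cy dy] := HF vs y Oy; split=> [|w].
    apply: (@continuous_comp _ _ _ (iterD vs F) (fun M : 'rV[R]_m => M 0 j)) => //.
    exact: coord_continuous.
  by move/derivable_mxP: (dy w); apply.
by move=> /(C1_at_eq oO E) /(_ z Oz).
Qed.

(** Regularity of [iterD vs F] and its coordinate formula go through one induction: the formula for
    the next derivative needs derivability of the present one, which in turn is read off the
    coordinates. *)
Lemma smooth_on_mx m O (F : 'rV[R]_n -> 'rV[R]_m) : open O ->
  (forall j, smooth_on O (fun y => F y 0 j)) -> smooth_on O F.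
Proof.
move=> oO HF.
suff H vs : C1_at O (iterD vs F) /\ forall j z, O z ->
    iterD vs (fun y => F y 0 j) z = iterD vs F z 0 j.
  by move=> vs z Oz; exact: (H vs).1.
have C1F us : (forall j z, O z ->
    iterD us (fun y => F y 0 j) z = iterD us F z 0 j) -> C1_at O (iterD us F).
  move=> E z Oz.
  have C1 : forall j, C1_at O (fun y => iterD us F y 0 j).
    move=> j; apply: (C1_at_eq oO (E j)) => y Oy; exact: HF.
  split=> [|w]; last first.
    by apply/derivable_mxP => i j; rewrite ord1; have [_] := C1 j z Oz; apply.
  have : {for z, continuous
      (fun y => \sum_j iterD us F y 0 j *: delta_mx (0 : 'I_1) j)}.
    apply: (@cvg_big _ _ _ _ _ _ _ (nbhs z)); first exact: add_continuous.
    by move=> j _; exact: (continuousZr_tmp (C1 j z Oz).1).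
  rewrite (_ : (fun _ => _) = iterD us F) //.
  by apply/funext => y; rewrite [RHS]row_sum_delta.
elim: vs => [|v vs [C1 IH]] /=.
  by split=> //; exact: (C1F [::]).
have E j z : O z -> iterD (v :: vs) (fun y => F y 0 j) z = iterD (v :: vs) F z 0 j.
  move=> Oz /=; rewrite (derive_on_eq _ oO Oz (IH j)) derive_coord //.
  by have [_] := C1 z Oz; apply.
exact: (conj (C1F (v :: vs) E) E).
Qed.

Lemma smooth_onZ m O (f : 'rV[R]_n -> R) (F : 'rV[R]_n -> 'rV[R]_m) : open O ->
  smooth_on O f -> smooth_on O F -> smooth_on O (fun z => f z *: F z).
Proof.
move=> oO Hf HF; apply: (smooth_on_mx oO) => j.
rewrite (_ : (fun _ => _) = fun z => f z * F z 0 j).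
  exact: (smooth_onM oO Hf (smooth_on_coord j oO HF)).
by apply/funext => z; rewrite mxE.
Qed.

Lemma smooth_on_C1 O (f : 'rV[R]_n -> R) : smooth_on O f -> C1_on O f.
Proof.
move=> Hf z Oz; split=> v; first exact: smooth_on_derivable Hf Oz.
exact: smooth_on_continuous (smooth_on_derive v Hf) Oz.
Qed.

Lemma smooth_on_diffR O (f : 'rV[R]_n -> R) z : open O -> smooth_on O f ->
  O z -> differentiable f z.
Proof. by move=> oO /smooth_on_C1; exact: C1_differentiable. Qed.

Lemma smooth_on_diff m O (F : 'rV[R]_n -> 'rV[R]_m) z : open O -> smooth_on O F ->
  O z -> differentiable F z.
Proof.
move=> oO HF Oz.
have -> : F = (\sum_(j < m) (fun y => F y 0 j *: delta_mx 0 j)).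
  by apply/funext => y; rewrite fct_sumE -row_sum_delta.
apply: differentiable_sum => j; apply: differentiableZl.
exact: (smooth_on_diffR oO (smooth_on_coord j oO HF) Oz).
Qed.

Lemma derive_linear (W : normedModType R) (F : 'rV[R]_n -> W) z :
  differentiable F z -> linear (fun v => 'D_v F z).
Proof. by move=> dF k u v; rewrite !deriveE // linearP. Qed.

Lemma derive_sum_coord (W : normedModType R) (F : 'rV[R]_n -> W) z v :
  differentiable F z -> 'D_v F z = \sum_j v 0 j *: 'D_(delta_mx 0 j) F z.
Proof.
move=> dF; rewrite deriveE // {1}[v]row_sum_delta linear_sum.
by apply: eq_bigr => j _; rewrite linearZ deriveE.
Qed.

Lemma derive_comp m (W : normedModType R) (phi : 'rV[R]_n -> 'rV[R]_m)
    (F : 'rV[R]_m -> W) z v :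
  differentiable phi z -> differentiable F (phi z) ->
  'D_v (F \o phi) z = 'D_('D_v phi z) F (phi z).
Proof.
move=> dphi dF; rewrite deriveE; last exact: differentiable_comp.
by rewrite diff_comp //= -!deriveE.
Qed.

End SmoothOn.

(** * Commutators of directional derivatives along variable fields *)

Section Commutator.
Context {R : realType} {n : nat}.
Implicit Types (O : set 'rV[R]_n) (z v w : 'rV[R]_n).

(** Product rule in partial derivatives. The double sum is the Hessian on [v] and [Y z]; its
    symmetry makes it cancel in the commutator, leaving only the first-order term. *)
Lemma derive_directional O (Y : 'rV[R]_n -> 'rV[R]_n) (f : 'rV[R]_n -> R) z v :
  open O -> O z -> smooth_on O Y -> smooth_on O f ->
  derivable (fun y => 'D_(Y y) f y) z v /\
  'D_v (fun y => 'D_(Y y) f y) z = 'D_('D_v Y z) f z +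
    \sum_i \sum_j v 0 i * (Y z 0 j * 'D_(delta_mx 0 i) ('D_(delta_mx 0 j) f) z).
Proof.
move=> oO Oz HY Hf.
pose g y := \sum_j Y y 0 j * 'D_(delta_mx 0 j) f y.
have E y : O y -> g y = 'D_(Y y) f y.
  move=> Oy; rewrite (derive_sum_coord (F := f)) //.
  exact: smooth_on_diffR oO Hf Oy.
have gsum : g = \sum_j (fun y => Y y 0 j) * ('D_(delta_mx 0 j) f).
  by apply/funext => y; rewrite fct_sumE.
have dY j : derivable (fun y => Y y 0 j) z v.
  exact: smooth_on_derivable (smooth_on_coord j oO HY) Oz.
have ddf j u : derivable ('D_(delta_mx 0 j) f) z u.
  exact: smooth_on_derivable (smooth_on_derive _ Hf) Oz.
have dj j : derivable ((fun y => Y y 0 j) * 'D_(delta_mx 0 j) f) z v.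
  exact: derivableM.
split.
  apply: near_eq_derivable (open_near oO Oz E) _.
  by rewrite gsum; exact: derivable_sum.
rewrite -(derive_on_eq _ oO Oz E) gsum derive_sum //.
have dYz := smooth_on_derivable (v := v) HY Oz.
rewrite [in RHS](derive_sum_coord (F := f)); last exact: smooth_on_diffR oO Hf Oz.
rewrite exchange_big -big_split /=; apply: eq_bigr => j _.
rewrite deriveM // addrC derive_coord //; congr (_ + _).
  rewrite [in LHS](derive_sum_coord (F := 'D_(delta_mx 0 j) f)); last first.
    exact: smooth_on_diffR oO (smooth_on_derive _ Hf) Oz.
  by rewrite scaler_sumr; apply: eq_bigr => i _; exact: mulrCA.
by rewrite [LHS]mulrC.
Qed.

Lemma derive_commutator O (X Y : 'rV[R]_n -> 'rV[R]_n) (f : 'rV[R]_n -> R) z :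
  open O -> O z -> smooth_on O X -> smooth_on O Y -> smooth_on O f ->
  'D_(X z) (fun y => 'D_(Y y) f y) z - 'D_(Y z) (fun y => 'D_(X y) f y) z =
  'D_('D_(X z) Y z - 'D_(Y z) X z) f z.
Proof.
move=> oO Oz HX HY Hf.
have -> := (derive_directional (X z) oO Oz HY Hf).2.
have -> := (derive_directional (Y z) oO Oz HX Hf).2.
have lD := derive_linear (smooth_on_diffR oO Hf Oz).
have -> : 'D_('D_(X z) Y z - 'D_(Y z) X z) f z =
   'D_('D_(X z) Y z) f z - 'D_('D_(Y z) X z) f z.
  have := lD (-1) ('D_(Y z) X z) ('D_(X z) Y z).
  by rewrite !scaleN1r (addrC ('D_(X z) Y z)) => ->; rewrite addrC.
rewrite opprD addrACA [X in _ + X](_ : _ = 0) ?addr0 //.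
apply/eqP; rewrite subr_eq0; apply/eqP; rewrite exchange_big /=.
apply: eq_bigr => j _; apply: eq_bigr => i _.
have -> : 'D_(delta_mx 0 i) ('D_(delta_mx 0 j) f) z =
          'D_(delta_mx 0 j) ('D_(delta_mx 0 i) f) z.
  apply: schwarz.
  - apply: open_near oO Oz _ => y Oy; split; last split => u.
    + by move=> u; exact: smooth_on_derivable Hf Oy.
    + exact: smooth_on_derivable (smooth_on_derive _ Hf) Oy.
    + exact: smooth_on_derivable (smooth_on_derive _ Hf) Oy.
  - exact: smooth_on_continuous (smooth_on_derive _ (smooth_on_derive _ Hf)) Oz.
  - exact: smooth_on_continuous (smooth_on_derive _ (smooth_on_derive _ Hf)) Oz.
exact: mulrCA.
Qed.

Lemma derive_commutator_rV m O (X Y : 'rV[R]_n -> 'rV[R]_n)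
    (F : 'rV[R]_n -> 'rV[R]_m) z :
  open O -> O z -> smooth_on O X -> smooth_on O Y -> smooth_on O F ->
  [/\ derivable (fun y => 'D_(Y y) F y) z (X z),
      derivable (fun y => 'D_(X y) F y) z (Y z) &
  'D_(X z) (fun y => 'D_(Y y) F y) z - 'D_(Y z) (fun y => 'D_(X y) F y) z =
  'D_('D_(X z) Y z - 'D_(Y z) X z) F z].
Proof.
move=> oO Oz HX HY HF.
have HFj j := smooth_on_coord j oO HF.
have Ej (Z : 'rV[R]_n -> 'rV[R]_n) j y :
    O y -> 'D_(Z y) (fun y => F y 0 j) y = 'D_(Z y) F y 0 j.
  by move=> Oy; rewrite derive_coord //; exact: smooth_on_derivable HF Oy.
have dZ Z v : smooth_on O Z -> derivable (fun y => 'D_(Z y) F y) z v.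
  move=> HZ; apply/derivable_mxP => i j; rewrite ord1.
  apply: near_eq_derivable (open_near oO Oz (Ej Z j)) _.
  exact: (derive_directional _ oO Oz HZ (HFj j)).1.
have dX := dZ _ (Y z) HX; have dY := dZ _ (X z) HY.
split=> //; apply/rowP => j.
have dF := smooth_on_derivable (v := 'D_(X z) Y z - 'D_(Y z) X z) HF Oz.
rewrite mxE [X in _ + X = _]mxE.
have E1 := derive_coord j dY; have E2 := derive_coord j dX.
have E3 := derive_coord j dF.
have E4 := derive_on_eq (X z) oO Oz (Ej Y j).
have E5 := derive_on_eq (Y z) oO Oz (Ej X j).
transitivity ('D_(X z) (fun y => 'D_(Y y) (fun y => F y 0 j) y) z
    - 'D_(Y z) (fun y => 'D_(X y) (fun y => F y 0 j) y) z).
  by congr (_ - _); [exact: etrans E1 (esym E4)|exact: etrans E2 (esym E5)].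
exact: etrans (derive_commutator oO Oz HX HY (HFj j)) (esym E3).
Qed.

End Commutator.

(** * Vector fields in charts *)

#[local] Opaque smooth_on.

Section Charts.
Context {R : realType} {m : nat} {N : cmanifold R m}.
Implicit Types (x y a : N) (X Y Z : vfield N) (z w : 'rV[R]_(m + m)).

Definition trans x y : 'rV[R]_(m + m) -> 'rV[R]_(m + m) :=
  chart_at y \o cinv (chart_at x).

Definition trans_dom x y : set 'rV[R]_(m + m) :=
  chart_at x @` (cdom (chart_at x) `&` cdom (chart_at y)).

Lemma trans_dom_open x y : open (trans_dom x y).
Proof.
rewrite openE => _ [a [ax ay] <-]; rewrite /interior.
have ia : (chart_at x @` cdom (chart_at x)) (chart_at x a) by exists a.
have n1 : nbhs (chart_at x a) (chart_at x @` cdom (chart_at x)).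
  by apply: open_nbhs_nbhs; split=> //; exact: cimg_open.
have n2 : nbhs (chart_at x a) (cinv (chart_at x) @^-1` cdom (chart_at y)).
  apply: (cinv_cont ia); rewrite cmapK //.
  by apply: open_nbhs_nbhs; split=> //; exact: cdom_open.
apply: filterS (filterI n1 n2) => _ [[b bx <-]] /=; rewrite cmapK // => bY.
by exists b.
Qed.

Lemma trans_smooth x y : smooth_on (trans_dom x y) (trans x y).
Proof. exact: (transition_holo x y).1. Qed.

Lemma trans_domE x y a : cdom (chart_at x) a -> cdom (chart_at y) a ->
  trans_dom x y (chart_at x a).
Proof. by exists a. Qed.

Lemma cimg_open_at x : open (cimg (chart_at x)).
Proof. exact: cimg_open. Qed.

Lemma trans_dom_cimg x y : trans_dom x y `<=` cimg (chart_at x).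
Proof. by move=> _ [a [ax ay] <-]; exists a. Qed.

Lemma transE x y a : cdom (chart_at x) a -> trans x y (chart_at x a) = chart_at y a.
Proof. by move=> ax; rewrite /trans /= cmapK. Qed.

Lemma trans_diff x y a : cdom (chart_at x) a -> cdom (chart_at y) a ->
  differentiable (trans x y) (chart_at x a).
Proof.
move=> ax ay.
exact: (smooth_on_diff (@trans_dom_open x y) (@trans_smooth x y) (trans_domE ax ay)).
Qed.

Lemma tcoord_linear x a : cdom (chart_at x) a -> linear (tcoord (chart_at x) a).
Proof.
by move=> ax; apply/derive_linear/trans_diff => //; exact: chart_at_dom.
Qed.

Lemma trans_comp x y a z : trans_dom a x z -> trans_dom a y z ->
  trans a y z = (trans x y \o trans a x) z.
Proof.
move=> [b [ba bx] <-] [b' [ba' bY] /(congr1 (cinv (chart_at a)))].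
rewrite !cmapK // => b'b; rewrite b'b {b' b'b ba'} in bY.
by rewrite /= !transE.
Qed.

Lemma trans_comp_near x y a : cdom (chart_at x) a -> cdom (chart_at y) a ->
  \forall z \near chart_at a a, trans a y z = (trans x y \o trans a x) z.
Proof.
move=> ax ay.
have nx := open_nbhs_nbhs (conj (@trans_dom_open a x) (trans_domE (chart_at_dom a) ax)).
have ny := open_nbhs_nbhs (conj (@trans_dom_open a y) (trans_domE (chart_at_dom a) ay)).
by apply: filterS2 nx ny => z; exact: trans_comp.
Qed.

(** Chain rule for [trans a y = trans x y \o trans a x], which holds near [chart_at a a]. *)
Lemma tcoord_change x y a w : cdom (chart_at x) a -> cdom (chart_at y) a ->
  tcoord (chart_at y) a w =
  'D_(tcoord (chart_at x) a w) (trans x y) (chart_at x a).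
Proof.
move=> ax ay; rewrite /tcoord.
rewrite (near_eq_derive w (trans_comp_near ax ay)) derive_comp.
- by rewrite transE //; exact: chart_at_dom.
- exact: trans_diff (chart_at_dom a) ax.
- rewrite transE; [exact: trans_diff|exact: chart_at_dom].
Qed.

Lemma tcoord_self x w : tcoord (chart_at x) x w = w.
Proof.
rewrite /tcoord; have E : forall z, cimg (chart_at x) z ->
    idfun z = (chart_at x \o cinv (chart_at x)) z.
  by move=> _ [b bx <-] /=; rewrite cmapK.
have ix : cimg (chart_at x) (chart_at x x) by exists x => //; exact: chart_at_dom.
by rewrite -(derive_on_eq w (@cimg_open_at x) ix E) derive_id.
Qed.

Lemma vrepE x a X : cdom (chart_at x) a ->
  vrep (chart_at x) X (chart_at x a) = tcoord (chart_at x) a (X a).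
Proof. by move=> ax; rewrite /vrep cmapK. Qed.

Lemma vrep_self x X : vrep (chart_at x) X (chart_at x x) = X x.
Proof. by rewrite vrepE ?tcoord_self //; exact: chart_at_dom. Qed.

Lemma vrep_change x y a X : cdom (chart_at x) a -> cdom (chart_at y) a ->
  vrep (chart_at y) X (trans x y (chart_at x a)) =
  'D_(vrep (chart_at x) X (chart_at x a)) (trans x y) (chart_at x a).
Proof. by move=> ax ay; rewrite transE // !vrepE // -tcoord_change. Qed.

Lemma smooth_vfD X Y : smooth_vf X -> smooth_vf Y -> smooth_vf (X + Y).
Proof.
move=> HX HY x.
apply: smooth_on_eq (smooth_onD (@cimg_open_at x) (HX x) (HY x)).
  exact: cimg_open_at.
move=> _ [a ax <-]; rewrite !vrepE //.
have := tcoord_linear ax 1 (X a) (Y a); rewrite !scale1r => <-.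
by [].
Qed.

Lemma smooth_vf_fmulv (f : N -> R) X :
  smooth_fun f -> smooth_vf X -> smooth_vf (fmulv f X).
Proof.
move=> Hf HX x.
apply: smooth_on_eq (smooth_onZ (@cimg_open_at x) (Hf x) (HX x)).
  exact: cimg_open_at.
move=> _ [a ax <-]; rewrite !vrepE // /= cmapK //.
have := tcoord_linear ax (f a) (X a) 0.
have -> : tcoord (chart_at x) a 0 = 0 by rewrite /tcoord derive0.
by rewrite !addr0 => <-.
Qed.

Lemma smooth_fun_cst (k : R) : smooth_fun (fun=> k : R) (N := N).
Proof. by move=> x; exact: smooth_on_cst. Qed.

Lemma smooth_funD (f g : N -> R) :
  smooth_fun f -> smooth_fun g -> smooth_fun (fun x => f x + g x).
Proof. by move=> Hf Hg x; exact: (smooth_onD (@cimg_open_at x) (Hf x) (Hg x)). Qed.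

Lemma smooth_funM (f g : N -> R) :
  smooth_fun f -> smooth_fun g -> smooth_fun (fun x => f x * g x).
Proof. by move=> Hf Hg x; exact: (smooth_onM (@cimg_open_at x) (Hf x) (Hg x)). Qed.

(** [vact] uses a different chart at every point; in the single chart at [x] it becomes an ordinary
    derivative along [vrep], ready to be differentiated once more. *)
Lemma vactE x a X (f : N -> R) : smooth_fun f -> cdom (chart_at x) a ->
  vact X f a = 'D_(vrep (chart_at x) X (chart_at x a))
                 (f \o cinv (chart_at x)) (chart_at x a).
Proof.
move=> Hf ax; rewrite vrepE // /vact /tcoord.
have E z : trans_dom a x z ->
    (f \o cinv (chart_at a)) z = ((f \o cinv (chart_at x)) \o trans a x) z.
  by move=> [b [ba bx] <-]; rewrite /= transE // !cmapK.
have da := trans_domE (chart_at_dom a) ax.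
rewrite (derive_on_eq _ (@trans_dom_open a x) da E) derive_comp.
- by rewrite transE //; exact: chart_at_dom.
- exact: trans_diff (chart_at_dom a) ax.
- rewrite transE; last exact: chart_at_dom.
  by apply: smooth_on_diffR (@cimg_open_at x) (Hf x) _; exists a.
Qed.

Lemma vact_lie X Y (f : N -> R) x :
  smooth_vf X -> smooth_vf Y -> smooth_fun f ->
  vact (lie X Y) f x = vact X (vact Y f) x - vact Y (vact X f) x.
Proof.
move=> HX HY Hf.
have ix : cimg (chart_at x) (chart_at x x) by exists x => //; exact: chart_at_dom.
have E Z z : cimg (chart_at x) z -> (vact Z f \o cinv (chart_at x)) z =
    'D_(vrep (chart_at x) Z z) (f \o cinv (chart_at x)) z.
  by move=> [a ax <-] /=; rewrite cmapK // (vactE _ Hf ax).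
have E1 := derive_on_eq (X x) (@cimg_open_at x) ix (E Y).
have E2 := derive_on_eq (Y x) (@cimg_open_at x) ix (E X).
have := derive_commutator (@cimg_open_at x) ix (HX x) (HY x) (Hf x).
by rewrite !vrep_self /vact E1 E2 => ->.
Qed.

(** Naturality of the bracket. In the chart at [a], deriving [trans a x] along a field gives that
    field read in the chart at [x]; so [derive_commutator_rV] applied to [trans a x] computes the
    image of the bracket. *)
Lemma vrep_lie X Y x a : smooth_vf X -> smooth_vf Y -> cdom (chart_at x) a ->
  let z := chart_at x a in
  vrep (chart_at x) (lie X Y) z =
  'D_(vrep (chart_at x) X z) (vrep (chart_at x) Y) z
  - 'D_(vrep (chart_at x) Y z) (vrep (chart_at x) X) z.
Proof.
move=> HX HY ax z; rewrite vrepE // /tcoord.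
have da := trans_domE (chart_at_dom a) ax.
have dt : differentiable (trans a x) (chart_at a a) by exact: trans_diff (chart_at_dom a) ax.
have sub W : smooth_vf W -> smooth_on (trans_dom a x) (vrep (chart_at a) W).
  by move=> HW; exact: smooth_on_sub (@trans_dom_cimg a x) (HW a).
have [_ _] := derive_commutator_rV (@trans_dom_open a x) da (sub _ HX) (sub _ HY) (@trans_smooth a x).
rewrite !vrep_self => Ecomm.
have E W : forall v, trans_dom a x v ->
    (vrep (chart_at x) W \o trans a x) v = 'D_(vrep (chart_at a) W v) (trans a x) v.
  by move=> _ [b [ba bx] <-]; rewrite -vrep_change.
have ix : cimg (chart_at x) (chart_at x a) by exists a.
have dv W : smooth_vf W -> differentiable (vrep (chart_at x) W) (trans a x (chart_at a a)).
  move=> HW; rewrite transE; last exact: chart_at_dom.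
  exact: smooth_on_diff (@cimg_open_at x) (HW x) ix.
have tv W : 'D_(W a) (trans a x) (chart_at a a) = vrep (chart_at x) W z.
  by rewrite vrepE.
have P V W : smooth_vf W ->
    'D_(V a) (fun v => 'D_(vrep (chart_at a) W v) (trans a x) v) (chart_at a a) =
    'D_(vrep (chart_at x) V z) (vrep (chart_at x) W) z.
  move=> HW; apply: etrans (esym (derive_on_eq (V a) (@trans_dom_open a x) da (E W))) _.
  rewrite (derive_comp _ dt (dv _ HW)) tv transE //; exact: chart_at_dom.
have Elie : 'D_(lie X Y a) (trans a x) (chart_at a a) = _ := esym Ecomm.
apply: etrans Elie _.
exact: (f_equal2 (fun u v => u - v) (P X Y HY) (P Y X HX)).
Qed.

(** [DD A B C] stands for D_A (D_B C) and [D1 A B] for D_A B, in the chart at [x]. Hidden behind the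
    quantifier they are mere atoms, and the Jacobi identity becomes linear algebra; the second
    clause carries the symmetry of second derivatives. *)
Lemma lie_lie_expand x : exists (DD : vfield N -> vfield N -> vfield N -> 'rV[R]_(m + m))
    (D1 : vfield N -> vfield N -> 'rV[R]_(m + m)),
  (forall A B C, smooth_vf A -> smooth_vf B -> smooth_vf C ->
     lie A (lie B C) x = DD A B C - DD A C B - D1 (lie B C) A) /\
  (forall A B C, smooth_vf A -> smooth_vf B -> smooth_vf C ->
     DD A B C = DD B A C + D1 (lie A B) C).
Proof.
pose c := chart_at x.
have ix : cimg c (c x) by exists x => //; exact: chart_at_dom.
have oc := @cimg_open_at x.
have E A B z : smooth_vf A -> smooth_vf B -> cimg c z -> vrep c (lie A B) z =
   ((fun z => 'D_(vrep c A z) (vrep c B) z) - (fun z => 'D_(vrep c B z) (vrep c A) z)) z.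
  by move=> HA HB [a ax <-]; rewrite vrep_lie.
have dd A B C : smooth_vf A -> smooth_vf B -> smooth_vf C ->
    derivable (fun z => 'D_(vrep c B z) (vrep c C) z) (c x) (A x).
  move=> HA HB HC.
  have [+ _ _] := derive_commutator_rV oc ix (HA x) (HB x) (HC x).
  by rewrite vrep_self.
have EL A B C : smooth_vf A -> smooth_vf B -> smooth_vf C -> lie A (lie B C) x =
    'D_(A x) (fun z => 'D_(vrep c B z) (vrep c C) z) (c x)
    - 'D_(A x) (fun z => 'D_(vrep c C z) (vrep c B) z) (c x)
    - 'D_(lie B C x) (vrep c A) (c x).
  move=> HA HB HC; congr (_ - _).
  rewrite (derive_on_eq (A x) oc ix (fun z => E B C z HB HC)).
  have d1 := dd A B C HA HB HC; have d2 := dd A C B HA HC HB.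
  by rewrite (deriveB d1 d2).
have EC A B C : smooth_vf A -> smooth_vf B -> smooth_vf C ->
    'D_(A x) (fun z => 'D_(vrep c B z) (vrep c C) z) (c x) =
    'D_(B x) (fun z => 'D_(vrep c A z) (vrep c C) z) (c x)
    + 'D_(lie A B x) (vrep c C) (c x).
  move=> HA HB HC.
  have [_ _ EE] := derive_commutator_rV oc ix (HA x) (HB x) (HC x).
  rewrite !vrep_self in EE.
  have aux (r s t : 'rV[R]_(m + m)) : r - s = t -> r = s + t.
    by move=> <-; rewrite addrC subrK.
  exact: aux _ _ _ EE.
exists (fun A B C => 'D_(A x) (fun z => 'D_(vrep c B z) (vrep c C) z) (c x)).
exists (fun A B => 'D_(A x) (vrep c B) (c x)).
exact: (conj EL EC).
Qed.

Lemma lie_jacobi X Y Z x : smooth_vf X -> smooth_vf Y -> smooth_vf Z ->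
  lie X (lie Y Z) x + lie Y (lie Z X) x + lie Z (lie X Y) x = 0.
Proof.
move=> HX HY HZ; have [DD [D1 [EL EC]]] := lie_lie_expand x.
rewrite (EL X Y Z) // (EL Y Z X) // (EL Z X Y) //.
rewrite (EC X Y Z) // (EC Y Z X) // (EC Z X Y) //.
by apply/rowP => i; rewrite !mxE; ring.
Qed.
End Charts.

(** * The contact form on a complex frame, in terms of a determinant *)

Lemma big_prod_odd (K : comNzRingType) (A : nat -> K) (p : nat) :
  \prod_(j < p.*2.+1) A j = A 0%N * \prod_(k < p) (A k.*2.+1 * A k.*2.+2).
Proof.
elim: p => [|p IH]; first by rewrite big_ord1 big_ord0 mulr1.
by rewrite doubleS 2!big_ord_recr /= IH [in RHS]big_ord_recr /= -!mulrA.
Qed.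

(* Expanding every factor along the rows of [C] turns the alternating sum into a
   combination of the determinants of the matrices [C i (t j)], all of which are
   multiples of [\det C]. *)
Lemma alternating_sum_det0 (K : comNzRingType) (p : nat) (C : 'M[K]_(p.*2.+1))
    (h : 'I_(p.*2.+1) -> K) (o : 'I_(p.*2.+1) -> 'I_(p.*2.+1) -> K) :
  \det C = 0 ->
  \sum_(s : 'S_(p.*2.+1)) (-1) ^+ odd_perm s * (\sum_a C (s ord0) a * h a) *
    \prod_(k < p) (\sum_a \sum_b C (s (inord k.*2.+1)) a *
                                 C (s (inord k.*2.+2)) b * o a b) = 0.
Proof.
move=> detC.
pose I := 'I_(p.*2.+1).
pose F (s : 'S_(p.*2.+1)) (k : 'I_p) (ab : I * I) :=
  C (s (inord k.*2.+1)) ab.1 * C (s (inord k.*2.+2)) ab.2 * o ab.1 ab.2.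
transitivity (\sum_(s : 'S_(p.*2.+1)) \sum_a \sum_(f : {ffun 'I_p -> I * I})
   (-1) ^+ odd_perm s * (C (s ord0) a * h a) * \prod_k F s k (f k)).
  apply: eq_bigr => s _.
  rewrite (eq_bigr (fun k => \sum_ab F s k ab)); last first.
    by move=> k _; rewrite pair_big.
  rewrite bigA_distr_bigA /= [X in X * _]mulr_sumr mulr_suml; apply: eq_bigr => a _.
  by rewrite mulr_sumr.
rewrite exchange_big big1 // => a _; rewrite exchange_big big1 // => f _.
(* [tn] lists the chosen columns: [a] at 0, then the two entries of [f k] at [2k + 1] and [2k + 2].
   The default [(a, a)] only makes [fn] total; it is not reached for [k < p]. *)
pose fn k : I * I := if insub k is Some k' then f k' else (a, a).
pose tn j := if j is j'.+1 then (if odd j' then (fn j'./2).2 else (fn j'./2).1) else a.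
transitivity (h a * (\prod_k o (f k).1 (f k).2) *
    \det (\matrix_(j, i) C i (tn j))).
  rewrite /determinant !mulr_sumr; apply: eq_bigr => s _.
  under [\prod_(i < p.*2.+1) _]eq_bigr => i _ do
    rewrite mxE -[X in C (s X) _](inord_val i).
  rewrite (big_prod_odd (fun j => C (s (inord j)) (tn j))).
  rewrite /F !big_split /=.
  have -> : inord 0 = ord0 :> I by apply/val_inj; rewrite /= inordK.
  under [\prod_(i < p) C _ (tn _.*2.+2)]eq_bigr => k _ do
    rewrite /tn /= odd_double /= uphalf_double /fn valK.
  under [\prod_(i < p) C _ (tn _.*2.+1)]eq_bigr => k _ do
    rewrite /tn odd_double doubleK /fn valK.
  have aux (x1 x2 x3 x4 x5 x6 : K) :
    x1 * (x2 * x3) * (x4 * x5 * x6) = x3 * x6 * (x1 * (x2 * (x4 * x5))) by ring.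
  exact: aux.
(* Choosing columns, possibly with repetitions, is multiplication by a 0-1 matrix. *)
suff -> : (\matrix_(j < p.*2.+1, i < p.*2.+1) C i (tn j)) =
    (\matrix_(j < p.*2.+1, b < p.*2.+1) (b == tn j)%:R) *m C^T.
  by rewrite det_mulmx det_tr detC !mulr0.
apply/matrixP => j i; rewrite !mxE (bigD1 (tn j)) //= !mxE eqxx mul1r big1 ?addr0 //.
by move=> b /negPf bt; rewrite !mxE bt mul0r.
Qed.

#[local] Opaque smooth_vf smooth_fun.

Section LinearFun.
Context {R : realType} {V W : lmodType R} {f : V -> W}.
Hypothesis lf : linear f.

Lemma linfunD a b : f (a + b) = f a + f b.
Proof. by have := lf 1 a b; rewrite !scale1r. Qed.

Lemma linfun0 : f 0 = 0.
Proof. by apply: (@addrI _ (f 0)); rewrite -linfunD !addr0. Qed.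

Lemma linfunZ (k : R) a : f (k *: a) = k *: f a.
Proof. by have := lf k a 0; rewrite linfun0 !addr0. Qed.

Lemma linfunN a : f (- a) = - f a.
Proof. by rewrite -scaleN1r linfunZ scaleN1r. Qed.

Lemma linfunB a b : f (a - b) = f a - f b.
Proof. by rewrite linfunD linfunN. Qed.

Lemma linfun_sum (I : finType) (F : I -> V) : f (\sum_i F i) = \sum_i f (F i).
Proof.
by elim/big_rec2: _ => [|i y1 y2 _ <-]; [exact: linfun0|exact: linfunD].
Qed.

End LinearFun.

(** * Algebra of smooth functions and smooth fields *)

Section SmoothAlgebra.
Context {R : realType} {m : nat} {N : cmanifold R m}.
Implicit Types (X Y Z : vfield N) (f h : N -> R).

Lemma smooth_fun_sum (I : Type) (r : seq I) (F : I -> N -> R) :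
  (forall i, smooth_fun (F i)) -> smooth_fun (fun x => \sum_(i <- r) F i x).
Proof.
move=> HF; elim: r => [|i r IH].
  rewrite (_ : (fun _ => _) = fun=> 0); first exact: smooth_fun_cst.
  by apply/funext => x; rewrite big_nil.
rewrite (_ : (fun _ => _) = fun x => F i x + \sum_(j <- r) F j x).
  exact: (smooth_funD (HF i) IH).
by apply/funext => x; rewrite big_cons.
Qed.

Lemma smooth_fun_prod (I : Type) (r : seq I) (F : I -> N -> R) :
  (forall i, smooth_fun (F i)) -> smooth_fun (fun x => \prod_(i <- r) F i x).
Proof.
move=> HF; elim: r => [|i r IH].
  rewrite (_ : (fun _ => _) = fun=> 1); first exact: smooth_fun_cst.
  by apply/funext => x; rewrite big_nil.
rewrite (_ : (fun _ => _) = fun x => F i x * \prod_(j <- r) F j x).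
  exact: (smooth_funM (HF i) IH).
by apply/funext => x; rewrite big_cons.
Qed.

Lemma smooth_fun_det k (M : N -> 'M[R]_k) :
  (forall i j, smooth_fun (fun x => M x i j)) -> smooth_fun (fun x => \det (M x)).
Proof.
move=> HM; apply: smooth_fun_sum => s.
have Hp : smooth_fun (fun x => \prod_(i < k) M x i (s i)).
  by apply: smooth_fun_prod => i; exact: HM.
exact: (smooth_funM (@smooth_fun_cst _ _ N ((-1) ^+ s)) Hp).
Qed.

Lemma smooth_vf0 : smooth_vf (0 : vfield N).
Proof.
have -> : (0 : vfield N) = fun=> 0 by [].
move=> x; rewrite (_ : vrep _ _ = fun=> 0); first exact: smooth_on_cst.
by apply/funext => z; rewrite /vrep /tcoord derive0.
Qed.

Lemma smooth_vfZ (k : R) X : smooth_vf X -> smooth_vf (fmulv (fun=> k) X).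
Proof. by apply: smooth_vf_fmulv; exact: smooth_fun_cst. Qed.

Lemma fmulvN1 X : fmulv (fun=> -1) X = - X.
Proof. by apply/funext => x; rewrite /fmulv scaleN1r. Qed.

Lemma fmulv1 X : fmulv (fun=> 1) X = X.
Proof. by apply/funext => x; rewrite /fmulv scale1r. Qed.

Lemma smooth_vfN X : smooth_vf X -> smooth_vf (- X).
Proof. by move=> HX; rewrite -fmulvN1; exact: smooth_vfZ. Qed.

Lemma smooth_vfB X Y : smooth_vf X -> smooth_vf Y -> smooth_vf (X - Y).
Proof. by move=> HX HY; exact: (smooth_vfD HX (smooth_vfN HY)). Qed.

Lemma smooth_vf_sum (I : Type) (r : seq I) (F : I -> vfield N) :
  (forall i, smooth_vf (F i)) -> smooth_vf (\sum_(i <- r) F i).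
Proof.
move=> HF; elim: r => [|i r IH]; first by rewrite big_nil; exact: smooth_vf0.
by rewrite big_cons; exact: (smooth_vfD (HF i) IH).
Qed.

Lemma smooth_fun_diff f x : smooth_fun f ->
  differentiable (f \o cinv (chart_at x)) (chart_at x x).
Proof.
move=> Hf; apply: smooth_on_diffR (@cimg_open_at _ _ _ x) (Hf x) _.
by exists x => //; exact: chart_at_dom.
Qed.

Lemma vactM X f h x : smooth_fun f -> smooth_fun h ->
  vact X (fun y => f y * h y) x = f x * vact X h x + h x * vact X f x.
Proof.
move=> Hf Hh; have df := diff_derivable (v := X x) (smooth_fun_diff x Hf).
have dh := diff_derivable (v := X x) (smooth_fun_diff x Hh).
have := deriveM df dh; rewrite /= cmapK //; exact: chart_at_dom.
Qed.

Lemma vactD X f h x : smooth_fun f -> smooth_fun h ->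
  vact X (fun y => f y + h y) x = vact X f x + vact X h x.
Proof.
move=> Hf Hh; have df := diff_derivable (v := X x) (smooth_fun_diff x Hf).
have dh := diff_derivable (v := X x) (smooth_fun_diff x Hh).
exact: deriveD df dh.
Qed.

Lemma vact_cst X (k : R) x : vact X (fun=> k) x = 0.
Proof. exact: derive_cst. Qed.

Lemma smooth_vact X f : smooth_vf X -> smooth_fun f -> smooth_fun (vact X f).
Proof.
move=> HX Hf x; pose c := chart_at x.
have oc := @cimg_open_at _ _ _ x.
have H : smooth_on (cimg c) (fun z =>
    \sum_j vrep c X z 0 j * 'D_(delta_mx 0 j) (f \o cinv c) z).
  have Hj j : smooth_on (cimg c)
      (fun z => vrep c X z 0 j * 'D_(delta_mx 0 j) (f \o cinv c) z).
    exact: (smooth_onM oc (smooth_on_coord j oc (HX x)) (smooth_on_derive _ (Hf x))).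
  elim: (index_enum _) => [|i r IH].
    rewrite (_ : (fun _ => _) = fun=> 0); first exact: smooth_on_cst.
    by apply/funext => z; rewrite big_nil.
  rewrite (_ : (fun _ => _) = fun z => vrep c X z 0 i *
      'D_(delta_mx 0 i) (f \o cinv c) z + \sum_(j <- r) vrep c X z 0 j *
      'D_(delta_mx 0 j) (f \o cinv c) z).
    exact: (smooth_onD oc (Hj i) IH).
  by apply/funext => z; rewrite big_cons.
apply: (smooth_on_eq oc _ H) => _ [a ax <-].
rewrite /= (cmapK ax) (vactE _ Hf ax) [RHS]derive_sum_coord //.
by apply: (smooth_on_diffR oc (Hf x)); exists a.
Qed.

Lemma lieN X Y : lie X Y = - lie Y X.
Proof. by apply/funext => x; rewrite /lie /= opprB. Qed.

End SmoothAlgebra.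

(** * Extension of tangent vectors and tensoriality *)

Section Metric.
Context {R : realType} {m : nat} {N : cmanifold R m} (g : tensor02 N).
Hypothesis hg : is_riemannian g.

Lemma metC x a b : g x a b = g x b a.
Proof. by case: hg. Qed.

Lemma met_linl x b : linear (g x ^~ b : _ -> R).
Proof. by case: hg => _ /(_ x b). Qed.

Lemma metDl x a b c : g x (a + b) c = g x a c + g x b c.
Proof. exact: (linfunD (met_linl x c)). Qed.
Lemma metZl x k a c : g x (k *: a) c = k * g x a c.
Proof. exact: (linfunZ (met_linl x c)). Qed.
Lemma metNl x a c : g x (- a) c = - g x a c.
Proof. exact: (linfunN (met_linl x c)). Qed.
Lemma metBl x a b c : g x (a - b) c = g x a c - g x b c.
Proof. exact: (linfunB (met_linl x c)). Qed.
Lemma met0l x c : g x 0 c = 0.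
Proof. exact: (linfun0 (met_linl x c)). Qed.
Lemma metDr x a b c : g x c (a + b) = g x c a + g x c b.
Proof. by rewrite ![g x c _]metC metDl. Qed.
Lemma metZr x k a c : g x c (k *: a) = k * g x c a.
Proof. by rewrite ![g x c _]metC metZl. Qed.
Lemma metNr x a c : g x c (- a) = - g x c a.
Proof. by rewrite ![g x c _]metC metNl. Qed.
Lemma metBr x a b c : g x c (a - b) = g x c a - g x c b.
Proof. by rewrite ![g x c _]metC metBl. Qed.
Lemma met0r x c : g x c 0 = 0.
Proof. by rewrite metC met0l. Qed.
Lemma met_suml x (I : finType) (F : I -> 'rV[R]_(m + m)) c :
  g x (\sum_i F i) c = \sum_i g x (F i) c.
Proof. exact: (linfun_sum (met_linl x c)). Qed.

Lemma met_eq0 x a : g x a a = 0 -> a = 0.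
Proof.
move=> E; apply/eqP; apply: contra_eqT E => a0.
by have [_ _ /(_ x a a0) /lt0r_neq0] := hg.
Qed.

Lemma met_inj x a b : (forall c, g x a c = g x b c) -> a = b.
Proof.
by move=> E; apply/eqP; rewrite -subr_eq0; apply/eqP/(@met_eq0 x); rewrite metBl E subrr.
Qed.

Lemma smooth_ev2 X Y : smooth_vf X -> smooth_vf Y -> smooth_fun (ev2 g X Y).
Proof. by case: hg => _ _ _; apply. Qed.

Hypothesis hext : forall x w, exists2 X : vfield N, smooth_vf X & X x = w.

(* The Gram determinant [D] of global fields [E] that form a basis at [x] makes
   [D X = \sum_i f i E i] hold on the whole of [N]: where [E] degenerates both
   sides vanish. This replaces cut-off functions. *)
Lemma global_frame x : exists (E : 'I_(m + m) -> vfield N) (D : N -> R),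
  [/\ forall i, smooth_vf (E i), smooth_fun D, D x != 0 &
   forall X, smooth_vf X -> exists f : 'I_(m + m) -> N -> R,
     [/\ forall i, smooth_fun (f i), X x = 0 -> forall i, f i x = 0 &
         fmulv D X = \sum_i fmulv (f i) (E i)]].
Proof.
pose E i : vfield N := sval (cid2 (hext x (delta_mx 0 i))).
have HE i : smooth_vf (E i) by rewrite /E; case: cid2.
have Ex i : E i x = delta_mx 0 i by rewrite /E; case: cid2.
clearbody E.
pose Gm y : 'M[R]_(m + m) := \matrix_(i, j) g y (E i y) (E j y).
have HG i j : smooth_fun (fun y => Gm y i j).
  rewrite (_ : (fun _ => _) = ev2 g (E i) (E j)); first exact: smooth_ev2.
  by apply/funext => y; rewrite mxE.
(* The squared length of [\sum_i v_i E_i] is the Gram form at [v], so the kernel of the Gram matrix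
   consists of linear relations between the [E i y]. *)
have kerG y (v : 'rV[R]_(m + m)) : v *m Gm y = 0 -> \sum_i v 0 i *: E i y = 0.
  move=> v0; apply: (@met_eq0 y); rewrite met_suml big1 // => i _.
  rewrite metZl metC met_suml.
  have := congr1 (fun M : 'rV[R]_(m + m) => M 0 i) v0; rewrite !mxE => E0.
  rewrite (eq_bigr (fun j => v 0 j * Gm y j i)) ?E0 ?mulr0 //.
  by move=> j _; rewrite metZl mxE.
exists E, (fun y => \det (Gm y)); split => //.
- exact: smooth_fun_det.
- apply/det0P => -[v v0 vG]; move/negP: v0; apply; apply/eqP.
  rewrite [v]row_sum_delta -[RHS](kerG x v vG).
  by apply: eq_bigr => i _; rewrite Ex.
move=> X HX.
pose b y : 'rV[R]_(m + m) := \row_j g y (X y) (E j y).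
(* Cramer's rule with the adjugate: polynomial in the Gram entries, hence smooth even where the
   determinant vanishes. *)
exists (fun i y => (b y *m \adj (Gm y)) 0 i); split.
- move=> i; rewrite (_ : (fun _ => _) =
      fun y => \sum_j g y (X y) (E j y) * \adj (Gm y) j i); last first.
    by apply/funext => y; rewrite mxE; apply: eq_bigr => j _; rewrite mxE.
  apply: smooth_fun_sum => j.
  have Ha : smooth_fun (fun y => \adj (Gm y) j i).
    rewrite (_ : (fun _ => _) = fun y => (-1) ^+ (i + j) *
        \det (row' i (col' j (Gm y)))); last by apply/funext => y; rewrite mxE.
    have Hd : smooth_fun (fun y => \det (row' i (col' j (Gm y)))).
      apply: smooth_fun_det => k l.
      rewrite (_ : (fun _ => _) = fun y => Gm y (lift i k) (lift j l)) //.
      by apply/funext => y; rewrite !mxE.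
    exact: (smooth_funM (@smooth_fun_cst _ _ N _) Hd).
  exact: (smooth_funM (smooth_ev2 HX (HE j)) Ha).
- move=> X0 i; have -> : b x = 0 by apply/rowP => j; rewrite !mxE X0 met0l.
  by rewrite mul0mx mxE.
apply/funext => y; rewrite fct_sumE.
set Z := \sum_i _.
have ZE k : g y (\det (Gm y) *: X y - Z) (E k y) = 0.
  have adjG : b y *m \adj (Gm y) *m Gm y = \det (Gm y) *: b y.
    by rewrite -mulmxA mul_adj_mx mul_mx_scalar.
  have := congr1 (fun M : 'rV[R]_(m + m) => M 0 k) adjG.
  rewrite metBl metZl mxE [in RHS]mxE mxE => <-; apply/eqP; rewrite subr_eq0; apply/eqP.
  rewrite /Z met_suml; apply: eq_bigr => j _; rewrite metZl; congr (_ * _).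
  by rewrite mxE.
(* By [ZE] the difference is orthogonal to every [E k y]; once it lies in their span, it
   vanishes. *)
have span c : \det (Gm y) *: X y - Z = \sum_i c i *: E i y ->
    \det (Gm y) *: X y = Z.
  move=> Ec; apply/eqP; rewrite -subr_eq0; apply/eqP/(@met_eq0 y).
  by rewrite {2}Ec metC met_suml big1 // => i _; rewrite metZl metC ZE mulr0.
(* Where the determinant vanishes the difference is [- Z], a combination of the [E i y] by
   construction; elsewhere the [E i y] form a basis. *)
have [D0|D0] := eqVneq (\det (Gm y)) 0.
  apply: (span (fun i => - (b y *m \adj (Gm y)) 0 i)).
  rewrite D0 scale0r add0r /Z -sumrN; apply: eq_bigr => i _.
  by rewrite scaleNr.
pose M : 'M[R]_(m + m) := \matrix_(i, j) E i y 0 j.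
have uM : M \in unitmx.
  rewrite unitmxE unitfE; apply/det0P => -[v v0 vM].
  case/det0P: D0; exists v => //; apply/rowP => j; rewrite !mxE.
  rewrite (eq_bigr (fun i => g y (v 0 i *: E i y) (E j y))); last first.
    by move=> i _; rewrite mxE metZl.
  rewrite -met_suml (_ : \sum_i _ = 0) ?met0l //.
  apply: etrans _ vM; apply/rowP => k; rewrite summxE mxE.
  by apply: eq_bigr => i _; rewrite !mxE.
pose W := \det (Gm y) *: X y - Z.
apply: (span (fun i => (W *m invmx M) 0 i)).
rewrite -[LHS](mulmxKV uM); apply/rowP => k; rewrite summxE mxE.
by apply: eq_bigr => i _; rewrite !mxE.
Qed.

Section Tensoriality.
Context {W : lmodType R} (T : vfield N -> W) (x : N).
Hypothesis TD : forall X Y, smooth_vf X -> smooth_vf Y -> T (X + Y) = T X + T Y.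
Hypothesis TZ : forall f X, smooth_fun f -> smooth_vf X ->
  T (fmulv f X) = f x *: T X.

Lemma tensorial_sum (I : Type) (r : seq I) (F : I -> vfield N) :
  (forall i, smooth_vf (F i)) -> T (\sum_(i <- r) F i) = \sum_(i <- r) T (F i).
Proof.
move=> HF; elim: r => [|i r IH]; last first.
  by rewrite !big_cons (TD (HF i) (smooth_vf_sum r HF)) IH.
rewrite !big_nil; apply: (@addrI _ (T 0)).
by rewrite -(TD (@smooth_vf0 _ _ N) (@smooth_vf0 _ _ N)) !addr0.
Qed.

(** Apply [T] to [D X = \sum_i f i E i]: this gives [D x *: T X = \sum_i f i x *: T (E i) = 0], and
    [D x] is nonzero. *)
Lemma tensorial_eq0 X : smooth_vf X -> X x = 0 -> T X = 0.
Proof.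
move=> HX X0; have [E [D [HE HD D0 /(_ X HX) [f [Hf /(_ X0) f0 DX]]]]] := global_frame x.
apply/eqP; have := TZ HD HX; rewrite DX tensorial_sum; last first.
  by move=> i; exact: (smooth_vf_fmulv (Hf i) (HE i)).
rewrite big1 => [/esym/eqP|i _]; last by rewrite (TZ (Hf i) (HE i)) f0 scale0r.
by rewrite scaler_eq0 (negPf D0).
Qed.

Lemma tensorial_eq X Y : smooth_vf X -> smooth_vf Y -> X x = Y x -> T X = T Y.
Proof.
move=> HX HY XY; have HN := smooth_vfN HY; have HD := smooth_vfB HX HY.
have E : (X - Y) + Y = X by rewrite subrK.
rewrite -E (TD HD HY) (tensorial_eq0 HD) ?add0r //.
by rewrite -[LHS]/(X x - Y x) XY subrr.
Qed.

End Tensoriality.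

Definition ext x w : vfield N := sval (cid2 (hext x w)).

Lemma ext_smooth x w : smooth_vf (ext x w).
Proof. by rewrite /ext; case: cid2. Qed.

Lemma extE x w : ext x w x = w.
Proof. by rewrite /ext; case: cid2. Qed.

Lemma tensorial_ext {W : lmodType R} (T : vfield N -> W) x X :
  (forall X Y, smooth_vf X -> smooth_vf Y -> T (X + Y) = T X + T Y) ->
  (forall f X, smooth_fun f -> smooth_vf X -> T (fmulv f X) = f x *: T X) ->
  smooth_vf X -> T X = T (ext x (X x)).
Proof.
move=> TD TZ HX; have E : X x = ext x (X x) x by rewrite extE.
exact: (tensorial_eq TD TZ HX (ext_smooth x (X x)) E).
Qed.

Lemma tensorial_linear {W : lmodType R} (T : vfield N -> W) x :
  (forall X Y, smooth_vf X -> smooth_vf Y -> T (X + Y) = T X + T Y) ->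
  (forall f X, smooth_fun f -> smooth_vf X -> T (fmulv f X) = f x *: T X) ->
  linear (fun w => T (ext x w)).
Proof.
move=> TD TZ k u v; have Hk := smooth_vfZ k (ext_smooth x u).
rewrite -(TZ _ _ (@smooth_fun_cst _ _ N k) (ext_smooth x u)).
rewrite -(TD _ _ Hk (ext_smooth x v)).
have HD := smooth_vfD Hk (ext_smooth x v).
apply: (tensorial_eq TD TZ (ext_smooth _ _) HD); rewrite extE.
by rewrite -[RHS]/(k *: ext x u x + ext x v x) !extE.
Qed.

End Metric.

(** * Levi-Civita connection and curvature *)

Lemma sub3D (V : zmodType) (a a' b b' c c' : V) :
  a + a' - (b + b') - (c + c') = (a - b - c) + (a' - b' - c').
Proof. by rewrite !opprD (addrACA a) (addrACA (a - b)). Qed.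

Section VectorIdentities.
Context {R : realType} {n : nat}.
Implicit Types (a b c d f : R) (p q r s t z : 'rV[R]_n).

Lemma curvZl_aux f d r q s t :
  f *: r - (d *: q + f *: s) - (f *: t - d *: q) = f *: (r - s - t).
Proof. by apply/rowP => i; rewrite !mxE; ring. Qed.

Lemma curvZr_aux a b c d f z p q r s t :
  (a *: z + c *: p + (d *: q + f *: r)) - (b *: z + d *: q + (c *: p + f *: s))
   - ((a - b) *: z + f *: t) = f *: (r - s - t).
Proof. by apply/rowP => i; rewrite !mxE; ring. Qed.

Lemma bianchi_aux (x1 x2 x3 y1 y2 y3 z1 z2 z3 : 'rV[R]_n) :
  (x1 - y1 - z1) + (x2 - y2 - z2) + (x3 - y3 - z3) =
  (x1 - y3 - z2) + (x2 - y1 - z3) + (x3 - y2 - z1).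
Proof. by apply/rowP => i; rewrite !mxE; ring. Qed.

End VectorIdentities.

Section PointwiseFields.
Context {R : realType} {m : nat} {N : cmanifold R m}.
Implicit Types X Y : vfield N.

Lemma vf0E x : (0 : vfield N) x = 0. Proof. by []. Qed.
Lemma vfDE X Y x : (X + Y) x = X x + Y x. Proof. by []. Qed.
Lemma vfNE X x : (- X) x = - X x. Proof. by []. Qed.
Lemma vfBE X Y x : (X - Y) x = X x - Y x. Proof. by []. Qed.
Lemma vfZE f X x : fmulv f X x = f x *: X x. Proof. by []. Qed.
Definition vfE := (vf0E, vfBE, vfDE, vfNE, vfZE).

Lemma fmulvDr (f : N -> R) X Y : fmulv f (X + Y) = fmulv f X + fmulv f Y.
Proof. by apply/funext => x; rewrite !vfE scalerDr. Qed.
Lemma fmulvN (f : N -> R) X : fmulv f (- X) = - fmulv f X.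
Proof. by apply/funext => x; rewrite !vfE scalerN. Qed.
End PointwiseFields.

Section LeviCivita.
Context {R : realType} {m : nat} {N : cmanifold R m} (g : tensor02 N).
Context (nabla : vfield N -> vfield N -> vfield N).
Hypothesis hg : is_riemannian g.
Hypothesis hn : is_levi_civita g nabla.
Implicit Types (X Y Z W : vfield N) (f : N -> R).

Lemma smooth_nabla X Y : smooth_vf X -> smooth_vf Y -> smooth_vf (nabla X Y).
Proof. exact: (lc_smooth hn). Qed.

Lemma nablaDl X Y Z : smooth_vf X -> smooth_vf Y -> smooth_vf Z ->
  nabla (X + Y) Z = nabla X Z + nabla Y Z.
Proof.
by move=> HX HY HZ; have := lc_lin hn (@smooth_fun_cst _ _ N 1) HX HY HZ; rewrite !fmulv1.
Qed.

Lemma nabla0l Z : smooth_vf Z -> nabla 0 Z = 0.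
Proof.
move=> HZ; apply: (@addrI _ (nabla 0 Z)).
by rewrite -(nablaDl (@smooth_vf0 _ _ N) (@smooth_vf0 _ _ N) HZ) !addr0.
Qed.

Lemma nablaZl f X Z : smooth_fun f -> smooth_vf X -> smooth_vf Z ->
  nabla (fmulv f X) Z = fmulv f (nabla X Z).
Proof.
move=> Hf HX HZ; have := lc_lin hn Hf HX (@smooth_vf0 _ _ N) HZ.
by rewrite (nabla0l HZ) !addr0.
Qed.

Lemma nablaNl X Z : smooth_vf X -> smooth_vf Z -> nabla (- X) Z = - nabla X Z.
Proof.
by move=> HX HZ; rewrite -!fmulvN1 (nablaZl (@smooth_fun_cst _ _ N (-1)) HX HZ).
Qed.

Lemma nablaBl X Y Z : smooth_vf X -> smooth_vf Y -> smooth_vf Z ->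
  nabla (X - Y) Z = nabla X Z - nabla Y Z.
Proof.
by move=> HX HY HZ; rewrite (nablaDl HX (smooth_vfN HY) HZ) (nablaNl HY HZ).
Qed.

Lemma nablaDr X Y Z : smooth_vf X -> smooth_vf Y -> smooth_vf Z ->
  nabla X (Y + Z) = nabla X Y + nabla X Z.
Proof. exact: (lc_add hn). Qed.

Lemma nabla0r X : smooth_vf X -> nabla X 0 = 0.
Proof.
move=> HX; apply: (@addrI _ (nabla X 0)).
by rewrite -(nablaDr HX (@smooth_vf0 _ _ N) (@smooth_vf0 _ _ N)) !addr0.
Qed.

Lemma nablaZr f X Y : smooth_fun f -> smooth_vf X -> smooth_vf Y ->
  nabla X (fmulv f Y) = fmulv (vact X f) Y + fmulv f (nabla X Y).
Proof. exact: (lc_leibniz hn). Qed.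

Lemma nablaNr X Y : smooth_vf X -> smooth_vf Y -> nabla X (- Y) = - nabla X Y.
Proof.
move=> HX HY; rewrite -!fmulvN1 (nablaZr (@smooth_fun_cst _ _ N (-1)) HX HY).
by apply/funext => x; rewrite !vfE vact_cst scale0r add0r.
Qed.

Lemma nablaBr X Y Z : smooth_vf X -> smooth_vf Y -> smooth_vf Z ->
  nabla X (Y - Z) = nabla X Y - nabla X Z.
Proof.
by move=> HX HY HZ; rewrite (nablaDr HX HY (smooth_vfN HZ)) (nablaNr HX HZ).
Qed.

Lemma lieE X Y : smooth_vf X -> smooth_vf Y -> lie X Y = nabla X Y - nabla Y X.
Proof. by move=> HX HY; rewrite (lc_torsion hn HX HY). Qed.

Lemma smooth_lie X Y : smooth_vf X -> smooth_vf Y -> smooth_vf (lie X Y).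
Proof.
move=> HX HY; rewrite (lieE HX HY).
exact: (smooth_vfB (smooth_nabla HX HY) (smooth_nabla HY HX)).
Qed.

Lemma lieDl X Y Z : smooth_vf X -> smooth_vf Y -> smooth_vf Z ->
  lie (X + Y) Z = lie X Z + lie Y Z.
Proof.
move=> HX HY HZ; rewrite (lieE (smooth_vfD HX HY) HZ) (lieE HX HZ) (lieE HY HZ).
by rewrite (nablaDl HX HY HZ) (nablaDr HZ HX HY) opprD addrACA.
Qed.

Lemma lieZl f X Y : smooth_fun f -> smooth_vf X -> smooth_vf Y ->
  lie (fmulv f X) Y = fmulv f (lie X Y) - fmulv (vact Y f) X.
Proof.
move=> Hf HX HY; rewrite (lieE (smooth_vf_fmulv Hf HX) HY) (lieE HX HY).
rewrite (nablaZl Hf HX HY) (nablaZr Hf HY HX) fmulvDr fmulvN.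
by rewrite opprD [- _ - _]addrC addrA.
Qed.

Lemma vact_met X Y Z x : smooth_vf X -> smooth_vf Y -> smooth_vf Z ->
  vact X (ev2 g Y Z) x = g x (nabla X Y x) (Z x) + g x (Y x) (nabla X Z x).
Proof. by move=> HX HY HZ; rewrite (lc_metric hn HX HY HZ). Qed.

Lemma curvN X Y Z : smooth_vf X -> smooth_vf Y -> smooth_vf Z ->
  curv nabla X Y Z = - curv nabla Y X Z.
Proof.
move=> HX HY HZ; rewrite /curv lieN (nablaNl (smooth_lie HY HX) HZ).
by rewrite opprK !opprB addrC.
Qed.

Lemma curvDl X X' Y Z : smooth_vf X -> smooth_vf X' -> smooth_vf Y -> smooth_vf Z ->
  curv nabla (X + X') Y Z = curv nabla X Y Z + curv nabla X' Y Z.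
Proof.
move=> HX HX' HY HZ; rewrite /curv (lieDl HX HX' HY) (nablaDl HX HX' HZ).
have HYZ := smooth_nabla HY HZ.
rewrite (nablaDl HX HX' HYZ) (nablaDr HY (smooth_nabla HX HZ) (smooth_nabla HX' HZ)).
rewrite (nablaDl (smooth_lie HX HY) (smooth_lie HX' HY) HZ).
exact: sub3D.
Qed.

Lemma curvZl f X Y Z : smooth_fun f -> smooth_vf X -> smooth_vf Y -> smooth_vf Z ->
  curv nabla (fmulv f X) Y Z = fmulv f (curv nabla X Y Z).
Proof.
move=> Hf HX HY HZ; rewrite /curv (lieZl Hf HX HY) (nablaZl Hf HX HZ).
have HXZ := smooth_nabla HX HZ.
rewrite (nablaZl Hf HX (smooth_nabla HY HZ)) (nablaZr Hf HY HXZ).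
have Hl := smooth_vf_fmulv Hf (smooth_lie HX HY).
have HYf := smooth_vact HY Hf.
rewrite (nablaBl Hl (smooth_vf_fmulv HYf HX) HZ) (nablaZl Hf (smooth_lie HX HY) HZ).
rewrite (nablaZl HYf HX HZ).
apply/funext => x; rewrite !vfE. exact: curvZl_aux.
Qed.

Lemma curvDm X Y Y' Z : smooth_vf X -> smooth_vf Y -> smooth_vf Y' -> smooth_vf Z ->
  curv nabla X (Y + Y') Z = curv nabla X Y Z + curv nabla X Y' Z.
Proof.
move=> HX HY HY' HZ; rewrite (curvN HX (smooth_vfD HY HY') HZ) (curvDl HY HY' HX HZ).
by rewrite opprD (curvN HX HY HZ) (curvN HX HY' HZ).
Qed.

Lemma curvZm f X Y Z : smooth_fun f -> smooth_vf X -> smooth_vf Y -> smooth_vf Z ->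
  curv nabla X (fmulv f Y) Z = fmulv f (curv nabla X Y Z).
Proof.
move=> Hf HX HY HZ; rewrite (curvN HX (smooth_vf_fmulv Hf HY) HZ) (curvZl Hf HY HX HZ).
by rewrite (curvN HX HY HZ) fmulvN.
Qed.

Lemma curvDr X Y Z Z' : smooth_vf X -> smooth_vf Y -> smooth_vf Z -> smooth_vf Z' ->
  curv nabla X Y (Z + Z') = curv nabla X Y Z + curv nabla X Y Z'.
Proof.
move=> HX HY HZ HZ'; rewrite /curv (nablaDr HY HZ HZ') (nablaDr HX HZ HZ').
rewrite (nablaDr HX (smooth_nabla HY HZ) (smooth_nabla HY HZ')).
rewrite (nablaDr HY (smooth_nabla HX HZ) (smooth_nabla HX HZ')).
rewrite (nablaDr (smooth_lie HX HY) HZ HZ').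
exact: sub3D.
Qed.

(** The second derivatives of [f] combine to [[X, Y] f], which the bracket term of the curvature
    cancels. *)
Lemma curvZr f X Y Z : smooth_fun f -> smooth_vf X -> smooth_vf Y -> smooth_vf Z ->
  curv nabla X Y (fmulv f Z) = fmulv f (curv nabla X Y Z).
Proof.
move=> Hf HX HY HZ; rewrite /curv (nablaZr Hf HY HZ) (nablaZr Hf HX HZ).
have HXf := smooth_vact HX Hf; have HYf := smooth_vact HY Hf.
have HXZ := smooth_nabla HX HZ; have HYZ := smooth_nabla HY HZ.
rewrite (nablaDr HX (smooth_vf_fmulv HYf HZ) (smooth_vf_fmulv Hf HYZ)).
rewrite (nablaDr HY (smooth_vf_fmulv HXf HZ) (smooth_vf_fmulv Hf HXZ)).
rewrite (nablaZr HYf HX HZ) (nablaZr Hf HX HYZ) (nablaZr HXf HY HZ) (nablaZr Hf HY HXZ).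
rewrite (nablaZr Hf (smooth_lie HX HY) HZ).
apply/funext => x; rewrite !vfE (vact_lie x HX HY Hf); exact: curvZr_aux.
Qed.

(** [vact_lie] applied to the function [g(Z, W)], every derivative being expanded by metric
    compatibility; the mixed terms cancel. *)
Lemma curv_skew X Y Z W x : smooth_vf X -> smooth_vf Y -> smooth_vf Z -> smooth_vf W ->
  g x (curv nabla X Y Z x) (W x) = - g x (Z x) (curv nabla X Y W x).
Proof.
move=> HX HY HZ HW; have Hf := smooth_ev2 hg HZ HW.
have HXZ := smooth_nabla HX HZ; have HYZ := smooth_nabla HY HZ.
have HXW := smooth_nabla HX HW; have HYW := smooth_nabla HY HW.
have E A : smooth_vf A -> vact A (ev2 g Z W) =
    fun y => ev2 g (nabla A Z) W y + ev2 g Z (nabla A W) y.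
  by move=> HA; apply/funext => y; rewrite (vact_met y HA HZ HW).
have := vact_lie x HX HY Hf; rewrite (E Y HY) (E X HX).
rewrite (vactD X x (smooth_ev2 hg HYZ HW) (smooth_ev2 hg HZ HYW)).
rewrite (vactD Y x (smooth_ev2 hg HXZ HW) (smooth_ev2 hg HZ HXW)).
rewrite (vact_met x HX HYZ HW) (vact_met x HX HZ HYW).
rewrite (vact_met x HY HXZ HW) (vact_met x HY HZ HXW).
rewrite (vact_met x (smooth_lie HX HY) HZ HW).
by rewrite /curv !vfE !(metBl hg) !(metBr hg); lra.
Qed.

Lemma curv_bianchi X Y Z x : smooth_vf X -> smooth_vf Y -> smooth_vf Z ->
  curv nabla X Y Z x + curv nabla Y Z X x + curv nabla Z X Y x = 0.
Proof.
move=> HX HY HZ; rewrite -(lie_jacobi x HX HY HZ) /curv.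
have HXY := smooth_lie HX HY; have HYZ := smooth_lie HY HZ; have HZX := smooth_lie HZ HX.
rewrite (lieE HX HYZ) (lieE HY HZX) (lieE HZ HXY).
have E A B C : smooth_vf A -> smooth_vf B -> smooth_vf C ->
    nabla A (lie B C) = nabla A (nabla B C) - nabla A (nabla C B).
  move=> HA HB HC; rewrite (lieE HB HC).
  exact: (nablaBr HA (smooth_nabla HB HC) (smooth_nabla HC HB)).
rewrite (E X Y Z HX HY HZ) (E Y Z X HY HZ HX) (E Z X Y HZ HX HY) !vfE.
exact: bianchi_aux.
Qed.

Hypothesis hext : forall x w, exists2 X : vfield N, smooth_vf X & X x = w.

(** Curvature of tangent vectors through arbitrarily chosen global extensions; [curvE] shows, one
    slot at a time, that the choice is immaterial. *)
Definition Rm x (a b c : 'rV[R]_(m + m)) : 'rV[R]_(m + m) :=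
  curv nabla (ext hext x a) (ext hext x b) (ext hext x c) x.

Lemma curvE X Y Z x : smooth_vf X -> smooth_vf Y -> smooth_vf Z ->
  curv nabla X Y Z x = Rm x (X x) (Y x) (Z x).
Proof.
move=> HX HY HZ; rewrite /Rm.
have Hx := ext_smooth hext x (X x); have Hy := ext_smooth hext x (Y x).
have Hz := ext_smooth hext x (Z x).
transitivity (curv nabla (ext hext x (X x)) Y Z x).
  apply: (@tensorial_ext _ _ _ _ hg hext _ (fun A => curv nabla A Y Z x)) => //.
    by move=> A B HA HB; rewrite (curvDl HA HB HY HZ).
  by move=> f A Hf HA; rewrite (curvZl Hf HA HY HZ).
transitivity (curv nabla (ext hext x (X x)) (ext hext x (Y x)) Z x).
  apply: (@tensorial_ext _ _ _ _ hg hext _ (fun A => curv nabla _ A Z x)) => //.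
    by move=> A B HA HB; rewrite (curvDm Hx HA HB HZ).
  by move=> f A Hf HA; rewrite (curvZm Hf Hx HA HZ).
apply: (@tensorial_ext _ _ _ _ hg hext _ (fun A => curv nabla _ _ A x)) => //.
  by move=> A B HA HB; rewrite (curvDr Hx Hy HA HB).
by move=> f A Hf HA; rewrite (curvZr Hf Hx Hy HA).
Qed.

Lemma Rm_lin1 x b c : linear (fun a => Rm x a b c).
Proof.
have Hb := ext_smooth hext x b; have Hc := ext_smooth hext x c.
apply: (@tensorial_linear _ _ _ _ hg hext _ (fun A => curv nabla A _ _ x)).
  by move=> A B HA HB; rewrite (curvDl HA HB Hb Hc).
by move=> f A Hf HA; rewrite (curvZl Hf HA Hb Hc).
Qed.

Lemma Rm_lin3 x a b : linear (fun c => Rm x a b c).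
Proof.
have Ha := ext_smooth hext x a; have Hb := ext_smooth hext x b.
apply: (@tensorial_linear _ _ _ _ hg hext _ (fun A => curv nabla _ _ A x)).
  by move=> A B HA HB; rewrite (curvDr Ha Hb HA HB).
by move=> f A Hf HA; rewrite (curvZr Hf Ha Hb HA).
Qed.

Lemma RmN x a b c : Rm x a b c = - Rm x b a c.
Proof. by rewrite /Rm curvN //; exact: ext_smooth. Qed.

Lemma Rm_skew x a b c d : g x (Rm x a b c) d = - g x c (Rm x a b d).
Proof.
have := curv_skew x (ext_smooth hext x a) (ext_smooth hext x b)
  (ext_smooth hext x c) (ext_smooth hext x d).
by rewrite !extE.
Qed.

Lemma Rm_bianchi x a b c : Rm x a b c + Rm x b c a + Rm x c a b = 0.
Proof. exact: curv_bianchi (ext_smooth _ _ _) (ext_smooth _ _ _) (ext_smooth _ _ _). Qed.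

End LeviCivita.

(** * Pointwise algebra of the structure *)

Section ContactPointwise.
Context {R : realType} {p : nat} {N : cmanifold R p.*2.+1} {S : ccstruct N}.
Hypothesis hC : is_contact_metric S.

Local Notation g := (cs_g S).
Local Notation G := (cs_G S).
Local Notation H := (cs_H S).
Local Notation U := (cs_U S).
Local Notation V := (cs_V S).
Local Notation u := (cs_u S).
Local Notation v := (cs_v S).
Local Notation J := (@Jt R p.*2.+1 N).
Implicit Types (x : N) (a b c w : 'rV[R]_(p.*2.+1 + p.*2.+1)).

Lemma cs_riem : is_riemannian g. Proof. by case: (cc_hermitian hC). Qed.

Lemma JtN x a : J x (- a) = - J x a.
Proof. exact: mulNmx. Qed.
Lemma JtJt x a : J x (J x a) = - a.
Proof.
rewrite /Jt -mulmxA /Jmx mulmx_block.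
rewrite !mul0mx !mulmx0 !mul1mx !mulmx1 addr0 !add0r addr0.
rewrite (_ : block_mx _ _ _ _ = - 1%:M) ?mulmxN ?mulmx1 //.
by rewrite scalar_mx_block opp_block_mx !oppr0.
Qed.

Lemma gJJ x a b : g x (J x a) (J x b) = g x a b.
Proof. by case: (cc_hermitian hC) => _; apply. Qed.
Lemma gJ x a b : g x (J x a) b = - g x a (J x b).
Proof. by rewrite -(gJJ x a) JtJt (metNr cs_riem) opprK. Qed.

Lemma G_lin x : linear (G x). Proof. exact: (cc_G_tensor hC).1. Qed.
Lemma H_lin x : linear (H x). Proof. exact: (cc_H_tensor hC).1. Qed.
Lemma u_lin x : linear (u x : _ -> R). Proof. exact: (cc_u_form hC).1. Qed.
Lemma v_lin x : linear (v x : _ -> R). Proof. exact: (cc_v_form hC).1. Qed.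

Lemma uD x a b : u x (a + b) = u x a + u x b.
Proof. exact: (linfunD (u_lin x)). Qed.
Lemma vD x a b : v x (a + b) = v x a + v x b.
Proof. exact: (linfunD (v_lin x)). Qed.
Lemma uZ x k a : u x (k *: a) = k * u x a.
Proof. exact: (linfunZ (u_lin x)). Qed.
Lemma vZ x k a : v x (k *: a) = k * v x a.
Proof. exact: (linfunZ (v_lin x)). Qed.

Lemma JU x : J x (U x) = - V x.
Proof. by rewrite (cc_V hC) opprK. Qed.
Lemma JV x : J x (V x) = U x.
Proof. by rewrite (cc_V hC) JtN JtJt opprK. Qed.
Lemma uJ x w : u x (J x w) = v x w.
Proof. by rewrite (cc_v hC). Qed.
Lemma vJ x w : v x (J x w) = - u x w.
Proof. by rewrite (cc_v hC) JtJt (linfunN (u_lin x)). Qed.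
Lemma GU x : G x (U x) = 0. Proof. exact: (cc_GU hC). Qed.
Lemma GV x : G x (V x) = 0.
Proof.
by rewrite (cc_V hC) (linfunN (G_lin x)) (cc_GJ hC) GU opprK /Jt mul0mx.
Qed.
Lemma HU x : H x (U x) = 0.
Proof. by rewrite (cc_H hC) JU (linfunN (G_lin x)) GV oppr0. Qed.
Lemma HV x : H x (V x) = 0.
Proof. by rewrite (cc_H hC) JV GU. Qed.
Lemma gG x a b : g x (G x a) b = - g x a (G x b).
Proof. by rewrite (cc_G_skew hC) opprK. Qed.
Lemma gH x a b : g x (H x a) b = - g x a (H x b).
Proof.
by rewrite !(cc_H hC) gG gJ !(cc_GJ hC) (metNr cs_riem) opprK.
Qed.
Lemma GH x w : G x (H x w) = - J x w + v x w *: U x - u x w *: V x.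
Proof. by rewrite (cc_H hC) (cc_GG hC) uJ vJ scaleNr. Qed.
Lemma HG x w : H x (G x w) = - G x (H x w).
Proof.
rewrite GH (cc_H hC) -[J x (G x w)]opprK -(cc_GJ hC) (linfunN (G_lin x)).
by rewrite -(cc_H hC) GH.
Qed.
Lemma JE x w : J x w = H x (G x w) + v x w *: U x - u x w *: V x.
Proof. by rewrite HG GH; apply/rowP => i; rewrite !mxE; ring. Qed.
Lemma gUU x : g x (U x) (U x) = 1. Proof. by rewrite -(cc_U_dual hC) (cc_uU hC). Qed.
Lemma gVV x : g x (V x) (V x) = 1. Proof. by rewrite -(cc_V_dual hC) (cc_vV hC). Qed.
Lemma gUV x : g x (U x) (V x) = 0. Proof. by rewrite -(cc_U_dual hC) (cc_uV hC). Qed.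
Lemma gVU x : g x (V x) (U x) = 0. Proof. by rewrite -(cc_V_dual hC) (cc_vU hC). Qed.

Lemma smooth_G X : smooth_vf X -> smooth_vf (ap G X).
Proof. exact: (cc_G_tensor hC).2. Qed.
Lemma smooth_H X : smooth_vf X -> smooth_vf (ap H X).
Proof. exact: (cc_H_tensor hC).2. Qed.
Lemma smooth_u X : smooth_vf X -> smooth_fun (ev1 u X).
Proof. exact: (cc_u_form hC).2. Qed.
Lemma smooth_v X : smooth_vf X -> smooth_fun (ev1 v X).
Proof. exact: (cc_v_form hC).2. Qed.

Lemma apJE X : ap J X =
  ap H (ap G X) + fmulv (ev1 v X) U - fmulv (ev1 u X) V.
Proof. by apply/funext => x; rewrite !vfE /ap JE. Qed.

(** [Jt] is a constant matrix, but in charts that jump from point to point. Smoothness is therefore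
    read off [J = HG + v U - u V], whose ingredients are smooth tensors. *)
Lemma smooth_J X : smooth_vf X -> smooth_vf (ap J X).
Proof.
move=> HX; rewrite apJE.
have H1 := smooth_H (smooth_G HX).
have H2 := smooth_vf_fmulv (smooth_v HX) (cc_U_smooth hC).
have H3 := smooth_vf_fmulv (smooth_u HX) (cc_V_smooth hC).
exact: (smooth_vfB (smooth_vfD H1 H2) H3).
Qed.

Hypothesis hdu : forall X Y, smooth_vf X -> smooth_vf Y ->
  forall x, ev2 g X (ap G Y) x = dform u X Y x.
Hypothesis hdv : forall X Y, smooth_vf X -> smooth_vf Y ->
  forall x, ev2 g X (ap H Y) x = dform v X Y x.

(** Makes [J] multiplication by i, so that a complex frame has a complex determinant. *)
Definition cplx w : 'rV[R[i]]_(p.*2.+1) :=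
  \row_k (w 0 (lshift _ k) +i* w 0 (rshift _ k))%C.

Lemma cplx_inj w w' : cplx w = cplx w' -> w = w'.
Proof.
move=> E; apply/rowP => j; rewrite -[j]splitK.
have Ek k : (w 0 (lshift _ k) +i* w 0 (rshift _ k) =
  w' 0 (lshift _ k) +i* w' 0 (rshift _ k))%C.
  by have := congr1 (fun M : 'rV[R[i]]_(p.*2.+1) => M 0 k) E; rewrite !mxE.
by case: (fintype.split j) => k /=; have [] := Ek k.
Qed.

Lemma cplxD w w' : cplx (w + w') = cplx w + cplx w'.
Proof. by apply/rowP => k; rewrite !mxE. Qed.

Lemma cplx0 : cplx 0 = 0.
Proof. by apply/rowP => k; rewrite !mxE. Qed.

Lemma cplx_sum (I : finType) (F : I -> 'rV[R]_(p.*2.+1 + p.*2.+1)) :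
  cplx (\sum_i F i) = \sum_i cplx (F i).
Proof.
by elim/big_rec2: _ => [|i y1 y2 _ <-]; [exact: cplx0|exact: cplxD].
Qed.

Lemma cplxZ (k : R) w : cplx (k *: w) = (k +i* 0)%C *: cplx w.
Proof.
by apply/rowP => j; rewrite !mxE; simpc.
Qed.

Lemma Jmx_l w k : (w *m Jmx R p.*2.+1) 0 (lshift _ k) = - w 0 (rshift _ k).
Proof.
rewrite -[w in LHS]hsubmxK /Jmx mul_row_block row_mxEl.
by rewrite mulmx0 add0r mulmxN mulmx1 !mxE.
Qed.

Lemma Jmx_r w k : (w *m Jmx R p.*2.+1) 0 (rshift _ k) = w 0 (lshift _ k).
Proof.
rewrite -[w in LHS]hsubmxK /Jmx mul_row_block row_mxEr.
by rewrite mulmx0 addr0 mulmx1 !mxE.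
Qed.

Lemma cplxJ x w : cplx (J x w) = (0 +i* 1)%C *: cplx w.
Proof.
by apply/rowP => j; rewrite [LHS]mxE /Jt Jmx_l Jmx_r !mxE; simpc.
Qed.

Definition breal (k : 'I_p.*2.+1) : 'rV[R]_(p.*2.+1 + p.*2.+1) :=
  delta_mx 0 (lshift _ k).

Lemma cplx_breal k : cplx (breal k) = delta_mx 0 k.
Proof.
apply/rowP => j; rewrite !mxE eqxx /= (inj_eq (@lshift_inj _ _)).
by rewrite eq_rlshift; case: (j == k).
Qed.

Lemma real_expand x w :
  w = \sum_k (w 0 (lshift _ k) *: breal k + w 0 (rshift _ k) *: J x (breal k)).
Proof.
apply: cplx_inj; rewrite cplx_sum.
rewrite [LHS]row_sum_delta; apply: eq_bigr => k _.
rewrite cplxD !cplxZ cplxJ cplx_breal scalerA -scalerDl mxE; congr (_ *: _).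
by simpc.
Qed.

Lemma complex_linear_expand x (f : 'rV[R]_(p.*2.+1 + p.*2.+1) -> R[i]) w :
  (forall a b, f (a + b) = f a + f b) ->
  (forall (k : R) a, f (k *: a) = (k +i* 0)%C * f a) ->
  (forall a, f (J x a) = (0 +i* 1)%C * f a) ->
  f w = \sum_k cplx w 0 k * f (breal k).
Proof.
move=> fD fZ fJ; have f0 : f 0 = 0 by have := fZ 0 0; rewrite scaler0 mul0r.
rewrite [in LHS](real_expand x w).
have -> : forall F : 'I_p.*2.+1 -> 'rV[R]_(p.*2.+1 + p.*2.+1),
    f (\sum_k F k) = \sum_k f (F k).
  by move=> F; elim/big_rec2: _ => // i y1 y2 _ <-; rewrite fD.
apply: eq_bigr => k _; rewrite fD !fZ fJ mulrA -mulrDl mxE; congr (_ * _).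
by simpc.
Qed.

Ltac complex_eq := apply/eqP; rewrite eq_complex /=; apply/andP; split; apply/eqP; ring.

Lemma extend_tangent x w : exists2 X : vfield N, smooth_vf X & X x = w.
Proof.
have [X HX Xn0] := cc_contact hC x.
pose C : 'M[R[i]]_(p.*2.+1) := \matrix_(i, k) cplx (X i x) 0 k.
pose om a b : R[i] := (g x a (G x b) -i* g x a (H x b))%C.
have etaE a : eta S x a = \sum_k cplx a 0 k * eta S x (breal k).
  apply: (complex_linear_expand (x := x)).
  - by move=> b c; rewrite /eta uD vD; complex_eq.
  - by move=> k b; rewrite /eta uZ vZ; complex_eq.
  - exact: (cc_eta_holo hC).1.
have omE a b : om a b = \sum_j \sum_k cplx a 0 j * cplx b 0 k * om (breal j) (breal k).
  have om1 c : om a c = \sum_j cplx a 0 j * om (breal j) c.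
    apply: (complex_linear_expand (x := x) (f := fun e => om e c)).
    - by move=> d e; rewrite /om !(metDl cs_riem); complex_eq.
    - by move=> k d; rewrite /om !(metZl cs_riem); complex_eq.
    - move=> d; have E1 : J x (G x c) = - H x c by rewrite (cc_H hC) (cc_GJ hC) opprK.
      have E2 : J x (H x c) = G x c.
        by rewrite (cc_H hC) (cc_GJ hC) JtN JtJt opprK.
      by rewrite /om !gJ E1 E2 (metNr cs_riem); complex_eq.
  have om2 d : om d b = \sum_k cplx b 0 k * om d (breal k).
    apply: (complex_linear_expand (x := x) (f := fun e => om d e)).
    - move=> e c; rewrite /om (linfunD (G_lin x)) (linfunD (H_lin x)).
      by rewrite !(metDr cs_riem); complex_eq.
    - move=> k c; rewrite /om (linfunZ (G_lin x)) (linfunZ (H_lin x)).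
      by rewrite !(metZr cs_riem); complex_eq.
    - move=> c; have E1 : G x (J x c) = H x c by rewrite (cc_H hC).
      have E2 : H x (J x c) = - G x c.
        by rewrite (cc_H hC) JtJt (linfunN (G_lin x)).
      by rewrite /om E1 E2 (metNr cs_riem); complex_eq.
  rewrite om1; apply: eq_bigr => j _; rewrite om2 mulr_sumr.
  by apply: eq_bigr => k _; rewrite mulrA.
have detC : \det C != 0.
  apply: contra_neq Xn0 => detC0.
  rewrite -[RHS](alternating_sum_det0 (fun k => eta S x (breal k))
    (fun j k => om (breal j) (breal k)) detC0).
  rewrite /eta_wedge_deta; apply: eq_bigr => s _; congr (_ * _ * _).
    by rewrite etaE; apply: eq_bigr => k _; rewrite !mxE.
  apply: eq_bigr => k _.
  (* Here du and dv, which involve derivatives of fields, turn into the form [om], which only sees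
     values at [x]. *)
  rewrite /deta -(hdu (HX _) (HX _)) -(hdv (HX _) (HX _)).
  rewrite -[LHS]/(om (X (s (inord k.*2.+1)) x) (X (s (inord k.*2.+2)) x)) omE.
  by apply: eq_bigr => j _; apply: eq_bigr => l _; rewrite !mxE.
have uC : C \in unitmx by rewrite unitmxE unitfE.
pose c := cplx w *m invmx C.
(* The complex coefficients of [w] on the frame at [x], frozen to constants; [J] carries the
   imaginary parts. *)
pose Y : vfield N := \sum_i (fmulv (fun=> complex.Re (c 0 i)) (X i)
                   + fmulv (fun=> complex.Im (c 0 i)) (ap J (X i))).
exists Y.
  apply: smooth_vf_sum => i.
  exact: (smooth_vfD (smooth_vfZ _ (HX i)) (smooth_vfZ _ (smooth_J (HX i)))).
apply: cplx_inj; rewrite -[RHS](mulmxKV uC) -/c /Y fct_sumE cplx_sum.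
rewrite mulmx_sum_row; apply: eq_bigr => i _.
rewrite vfDE cplxD !vfZE !cplxZ cplxJ scalerA -scalerDl.
have -> : row i C = cplx (X i x) by apply/rowP => k; rewrite !mxE.
by congr (_ *: _); case: (c 0 i) => r t; simpc.
Qed.

End ContactPointwise.

(** * Normality and the curvature identities *)

#[local] Opaque vact lie.

(* [lra] compares atoms up to conversion, which is slow on these terms. *)
Ltac gen_atoms := repeat match goal with
  | |- context [vact ?X ?f ?x] => let t := fresh "t" in generalize (vact X f x) => t
  | |- context [cs_g ?S ?x ?a ?b] => let t := fresh "t" in generalize (cs_g S x a b) => t
  end.

(** * Skew tensors whose fundamental form is exact *)

Section SkewTensor.
Context {R : realType} {p : nat} {N : cmanifold R p.*2.+1} {S : ccstruct N}.
Local Notation g := (cs_g S).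
Local Notation nabla := (cs_nabla S).
Hypothesis hg : is_riemannian g.
Hypothesis hn : is_levi_civita g nabla.
Hypothesis hext : forall x w, exists2 X : vfield N, smooth_vf X & X x = w.
Implicit Types (X Y Z W : vfield N) (x : N).

Lemma met_inj_vf x a b : (forall Y, smooth_vf Y -> g x a (Y x) = g x b (Y x)) -> a = b.
Proof.
move=> E; apply: (met_inj (x := x) hg) => c; have [Y HY <-] := hext x c; exact: E.
Qed.

Lemma nabla_const X Y Z (k : R) x : smooth_vf X -> smooth_vf Y -> smooth_vf Z ->
  (forall y, g y (Y y) (Z y) = k) ->
  g x (nabla X Y x) (Z x) = - g x (Y x) (nabla X Z x).
Proof.
move=> HX HY HZ E; apply/eqP; rewrite -subr_eq0 opprK; apply/eqP.
rewrite -(vact_met hn x HX HY HZ) (_ : ev2 g Y Z = fun=> k) ?vact_cst //.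
by apply/funext => y; exact: E.
Qed.

Variable F : tensor11 N.
Hypothesis hF : is_tensor11 F.
Hypothesis Fskew : forall x a b, g x (F x a) b = - g x a (F x b).

Lemma F_lin x : linear (F x). Proof. exact: hF.1. Qed.
Lemma smooth_F X : smooth_vf X -> smooth_vf (ap F X). Proof. exact: hF.2. Qed.
Lemma apE X x : ap F X x = F x (X x). Proof. by []. Qed.
Lemma FN x a : F x (- a) = - F x a. Proof. exact: (linfunN (F_lin x)). Qed.
Lemma FB x a b : F x (a - b) = F x a - F x b. Proof. exact: (linfunB (F_lin x)). Qed.
Lemma FD x a b : F x (a + b) = F x a + F x b. Proof. exact: (linfunD (F_lin x)). Qed.
Lemma FZ x k a : F x (k *: a) = k *: F x a. Proof. exact: (linfunZ (F_lin x)). Qed.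
Lemma F0 x : F x 0 = 0. Proof. exact: (linfun0 (F_lin x)). Qed.

Lemma nablaTE X Y x : nablaT S X F Y x = nabla X (ap F Y) x - F x (nabla X Y x).
Proof. by []. Qed.

(** The identity [g(F Y, Z) = g(- Y, F Z)] is differentiated along [X]. *)
Lemma nablaTskew X Y Z x : smooth_vf X -> smooth_vf Y -> smooth_vf Z ->
  g x (nablaT S X F Y x) (Z x) = - g x (Y x) (nablaT S X F Z x).
Proof.
move=> HX HY HZ; rewrite !nablaTE (metBl hg) (metBr hg) Fskew.
have E : ev2 g (ap F Y) Z = ev2 g (- Y) (ap F Z).
  by apply/funext => y; rewrite /ev2 vfNE !apE Fskew (metNl hg).
have := vact_met hn x HX (smooth_F HY) HZ.
rewrite E (vact_met hn x HX (smooth_vfN HY) (smooth_F HZ)) (nablaNr hn HX HY).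
by rewrite !vfNE !(metNl hg) apE Fskew; lra.
Qed.

Lemma nablaTDl X X' Y x : smooth_vf X -> smooth_vf X' -> smooth_vf Y ->
  nablaT S (X + X') F Y x = nablaT S X F Y x + nablaT S X' F Y x.
Proof.
move=> HX HX' HY; rewrite !nablaTE (nablaDl hn HX HX' (smooth_F HY)).
by rewrite (nablaDl hn HX HX' HY) !vfDE FD opprD addrACA.
Qed.

Lemma nablaTZl f X Y x : smooth_fun f -> smooth_vf X -> smooth_vf Y ->
  nablaT S (fmulv f X) F Y x = f x *: nablaT S X F Y x.
Proof.
move=> Hf HX HY; rewrite !nablaTE (nablaZl hn Hf HX (smooth_F HY)).
by rewrite (nablaZl hn Hf HX HY) !vfZE FZ scalerBr.
Qed.

Lemma nablaTNl X Y x : smooth_vf X -> smooth_vf Y ->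
  nablaT S (- X) F Y x = - nablaT S X F Y x.
Proof.
move=> HX HY; rewrite -fmulvN1 (nablaTZl x (@smooth_fun_cst _ _ N (-1)) HX HY).
by rewrite scaleN1r.
Qed.

Lemma nablaT0l Y x : smooth_vf Y -> nablaT S 0 F Y x = 0.
Proof.
by move=> HY; rewrite nablaTE (nabla0l hn (smooth_F HY)) (nabla0l hn HY) !vf0E F0 subrr.
Qed.

Lemma nablaT_kernel X Y x : smooth_vf X -> ap F Y = 0 ->
  nablaT S X F Y x = - F x (nabla X Y x).
Proof. by move=> HX E; rewrite nablaTE E (nabla0r hn HX) vf0E add0r. Qed.

Lemma nijE X Y x : nijenhuis S F X Y x =
  nablaT S (ap F X) F Y x - nablaT S (ap F Y) F X x
  - F x (nablaT S X F Y x) + F x (nablaT S Y F X x).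
Proof. by []. Qed.

Variables (w : form1 N) (xi : vfield N).
Hypothesis sxi : smooth_vf xi.
Hypothesis wE : forall x a, w x a = g x (xi x) a.
Hypothesis hdw : forall X Y, smooth_vf X -> smooth_vf Y ->
  forall x, ev2 g X (ap F Y) x = dform w X Y x.

Lemma ev1w X : ev1 w X = ev2 g xi X.
Proof. by apply/funext => x; exact: wE. Qed.

(** Torsion-freeness turns [2 dw(X, Y)] into the left-hand side. The factor - 2 combines the
    normalization of [dform] with the skewness of [F]. *)
Lemma d_nabla X Y x : smooth_vf X -> smooth_vf Y ->
  g x (nabla X xi x) (Y x) - g x (nabla Y xi x) (X x) = - 2 * g x (F x (X x)) (Y x).
Proof.
move=> HX HY; have := hdw HX HY x; rewrite /dform !ev1w.
rewrite (vact_met hn x HX sxi HY) (vact_met hn x HY sxi HX) (lieE hn HX HY).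
by rewrite /ev2 vfBE (metBr hg) apE Fskew; lra.
Qed.

(** d(dw) = 0 in covariant form: a closed 2-form has vanishing cyclic sum of covariant
    derivatives. *)
Lemma d_closed X Y Z x : smooth_vf X -> smooth_vf Y -> smooth_vf Z ->
  g x (Y x) (nablaT S X F Z x) + g x (Z x) (nablaT S Y F X x)
    + g x (X x) (nablaT S Z F Y x) = 0.
Proof.
move=> HX HY HZ.
have [al alE] : exists al : vfield N -> N -> R, forall A, al A = ev2 g xi A by exists (ev2 g xi).
have Hal A : smooth_vf A -> smooth_fun (al A).
  by move=> HA; rewrite alE; exact: (smooth_ev2 hg sxi HA).
have E A B : smooth_vf A -> smooth_vf B -> ev2 g A (ap F B) =
    fun y => (vact A (al B) y + (-1) * vact B (al A) y + (-1) * al (lie A B) y) * 2^-1.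
  by move=> HA HB; apply/funext => y; rewrite (hdw HA HB) /dform !ev1w !alE; gen_atoms; lra.
have c1 (k : R) : smooth_fun (fun=> k) (N := N) by exact: smooth_fun_cst.
(* [DD], [DL] and [LL] name the terms A(B(w(C))), A(w([B, C])) and w([[A, B], C]) at [x]; only
   linear relations between these atoms remain, with the Jacobi identity for [LL]. *)
have [DD HDD] : exists DD : vfield N -> vfield N -> vfield N -> R,
    forall A B C, DD A B C = vact A (vact B (al C)) x by eexists.
have [DL HDL] : exists DL : vfield N -> vfield N -> vfield N -> R,
    forall A B C, DL A B C = vact A (al (lie B C)) x by eexists.
have [LL HLL] : exists LL : vfield N -> vfield N -> vfield N -> R,
    forall A B C, LL A B C = al (lie (lie A B) C) x by eexists.
have HLL' A B C : LL A B C = g x (xi x) (lie (lie A B) C x) by rewrite HLL alE.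
have Ev A B C : smooth_vf A -> smooth_vf B -> smooth_vf C ->
    vact A (ev2 g B (ap F C)) x = (DD A B C - DD A C B - DL A B C) / 2.
  move=> HA HB HC; rewrite (E B C HB HC) (HDD A B C) (HDD A C B) HDL.
  have h1 := smooth_vact HB (Hal C HC); have h2 := smooth_vact HC (Hal B HB).
  have h3 := Hal _ (smooth_lie hn HB HC).
  have h2' := smooth_funM (c1 (-1)) h2; have h3' := smooth_funM (c1 (-1)) h3.
  have h12 := smooth_funD h1 h2'; have h123 := smooth_funD h12 h3'.
  rewrite (vactM A x h123 (c1 2^-1)) vact_cst (vactD A x h12 h3') (vactD A x h1 h2').
  rewrite (vactM A x (c1 (-1)) h2) (vactM A x (c1 (-1)) h3).
  by rewrite !vact_cst; gen_atoms; lra.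
have El A B C : smooth_vf A -> smooth_vf B -> smooth_vf C ->
    g x (lie A B x) (F x (C x)) = (DD A B C - DD B A C - DL C A B - LL A B C) / 2.
  move=> HA HB HC; have HL := smooth_lie hn HA HB.
  rewrite (HDD A B C) (HDD B A C) HDL HLL.
  rewrite -[LHS]/(ev2 g (lie A B) (ap F C) x) (E _ _ HL HC).
  rewrite (vact_lie x HA HB (Hal C HC)).
  by gen_atoms; lra.
have J : LL Y Z X + LL Z X Y + LL X Y Z = 0.
  have J0 := lie_jacobi x HX HY HZ.
  have Nx A B : lie A B x = - lie B A x by rewrite {1}(lieN A B).
  rewrite (Nx X (lie Y Z)) (Nx Y (lie Z X)) (Nx Z (lie X Y)) in J0.
  have sumN (a b c : 'rV[R]_(p.*2.+1 + p.*2.+1)) : - a - b - c = 0 ->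
      g x (xi x) a + g x (xi x) b + g x (xi x) c = 0.
    move=> E0; rewrite -!(metDr hg) (_ : a + b + c = 0) ?(met0r hg) //.
    by apply: oppr_inj; rewrite !opprD E0 oppr0.
  by rewrite (HLL' X Y Z) (HLL' Y Z X) (HLL' Z X Y); exact: (sumN _ _ _ J0).
have M A B C : smooth_vf A -> smooth_vf B -> smooth_vf C ->
    g x (B x) (nablaT S A F C x) = (DD A B C - DD A C B - DL A B C) / 2
      - g x (nabla A B x) (F x (C x)) + g x (F x (B x)) (nabla A C x).
  move=> HA HB HC; rewrite -(Ev A B C HA HB HC) (vact_met hn x HA HB (smooth_F HC)).
  by rewrite nablaTE (metBr hg) Fskew apE; gen_atoms; lra.
have L A B C : smooth_vf A -> smooth_vf B -> smooth_vf C ->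
    g x (nabla A B x) (F x (C x)) - g x (nabla B A x) (F x (C x)) =
    (DD A B C - DD B A C - DL C A B - LL A B C) / 2.
  move=> HA HB HC; apply: etrans (El A B C HA HB HC).
  by rewrite (lieE hn HA HB) vfBE (metBl hg).
move: (L X Y Z HX HY HZ) (L Y Z X HY HZ HX) (L Z X Y HZ HX HY) J.
move: (M X Y Z HX HY HZ) (M Y Z X HY HZ HX) (M Z X Y HZ HX HY).
by rewrite !(metC hg x (F x _)); gen_atoms; lra.
Qed.

End SkewTensor.

(** * Covariant derivatives of the two characteristic fields *)

Section Half.
Context {R : realType} {p : nat} {N : cmanifold R p.*2.+1} {S : ccstruct N}.
Local Notation g := (cs_g S).
Local Notation nabla := (cs_nabla S).
Hypothesis hg : is_riemannian g.
Hypothesis hn : is_levi_civita g nabla.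
Hypothesis hext : forall x w, exists2 X : vfield N, smooth_vf X & X x = w.
Implicit Types (X Y Z W : vfield N) (x : N).

(* [(F, F', xi, ze)] is either [(G, H, U, V)] or [(H, G, V, U)]. *)
Variables (F F' : tensor11 N) (xi ze : vfield N).
Hypothesis hF : is_tensor11 F.
Hypothesis hF' : is_tensor11 F'.
Hypothesis Fskew : forall x a b, g x (F x a) b = - g x a (F x b).
Hypothesis F'skew : forall x a b, g x (F' x a) b = - g x a (F' x b).
Hypothesis sxi : smooth_vf xi.
Hypothesis sze : smooth_vf ze.
Hypothesis xixi : forall x, g x (xi x) (xi x) = 1.
Hypothesis zeze : forall x, g x (ze x) (ze x) = 1.
Hypothesis xize : forall x, g x (xi x) (ze x) = 0.
Hypothesis Fxi : forall x, F x (xi x) = 0.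
Hypothesis Fze : forall x, F x (ze x) = 0.
Hypothesis F'xi : forall x, F' x (xi x) = 0.
Hypothesis F'ze : forall x, F' x (ze x) = 0.
Hypothesis FF : forall x w, F x (F x w) =
  - w + g x (xi x) w *: xi x + g x (ze x) w *: ze x.
Hypothesis dxi : forall X Y x, smooth_vf X -> smooth_vf Y ->
  g x (nabla X xi x) (Y x) - g x (nabla Y xi x) (X x) = - 2 * g x (F x (X x)) (Y x).
Hypothesis dze : forall X Y x, smooth_vf X -> smooth_vf Y ->
  g x (nabla X ze x) (Y x) - g x (nabla Y ze x) (X x) = - 2 * g x (F' x (X x)) (Y x).
Hypothesis cF : forall X Y Z x, smooth_vf X -> smooth_vf Y -> smooth_vf Z ->
  g x (Y x) (nablaT S X F Z x) + g x (Z x) (nablaT S Y F X x)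
    + g x (X x) (nablaT S Z F Y x) = 0.

Lemma apFxi : ap F xi = 0. Proof. by apply/funext => x; exact: Fxi. Qed.
Lemma apFze : ap F ze = 0. Proof. by apply/funext => x; exact: Fze. Qed.

Lemma nabla_unit X x : smooth_vf X -> g x (nabla X xi x) (xi x) = 0.
Proof.
move=> HX; have := nabla_const hn x HX sxi sxi xixi.
by rewrite (metC hg x (xi x)); lra.
Qed.

Lemma nabla_unit' X x : smooth_vf X -> g x (nabla X ze x) (ze x) = 0.
Proof.
move=> HX; have := nabla_const hn x HX sze sze zeze.
by rewrite (metC hg x (ze x)); lra.
Qed.

Lemma nabla_xi_xi x : nabla xi xi x = 0.
Proof.
apply: (met_inj_vf (x := x) hg hext) => Y HY; have := dxi x sxi HY.
by rewrite Fxi !(met0l hg) nabla_unit //; lra.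
Qed.

Lemma nabla_ze_ze x : nabla ze ze x = 0.
Proof.
apply: (met_inj_vf (x := x) hg hext) => Y HY; have := dze x sze HY.
by rewrite F'ze !(met0l hg) nabla_unit' //; lra.
Qed.

Lemma nabla_xi_ze_comp X x : smooth_vf X ->
  g x (nabla X xi x) (ze x) = g x (nabla ze xi x) (X x).
Proof. by move=> HX; have := dxi x sze HX; rewrite Fze (met0l hg); lra. Qed.

Lemma nabla_ze_xi_comp X x : smooth_vf X ->
  g x (nabla X ze x) (xi x) = g x (nabla xi ze x) (X x).
Proof. by move=> HX; have := dze x sxi HX; rewrite F'xi (met0l hg); lra. Qed.

(** [dxi] against [ze] and [dze] against [xi] have zero right-hand sides, so both fields encode
    [X |-> g(nabla_X xi, ze)]; orthogonality of [xi] and [ze] supplies the sign. *)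
Lemma nabla_xi_ze x : nabla xi ze x = - nabla ze xi x.
Proof.
apply: (met_inj_vf (x := x) hg hext) => X HX.
rewrite -(nabla_ze_xi_comp x HX) (metNl hg) -(nabla_xi_ze_comp x HX).
by rewrite (nabla_const hn x HX sxi sze xize) opprK (metC hg).
Qed.

(* Here [nijenhuis F ze xi = 2 F^2 (nabla_ze xi)]. *)
Lemma nabla_ze_xi0 x : nijenhuis S F ze xi x = 0 -> nabla ze xi x = 0.
Proof.
rewrite nijE apFxi apFze !(nablaT0l hn hF) //.
rewrite (nablaT_kernel hn x sze apFxi) (nablaT_kernel hn x sxi apFze).
rewrite nabla_xi_ze !(FN hF) !opprK subrr !FF.
have -> : g x (xi x) (nabla ze xi x) = 0 by rewrite (metC hg) nabla_unit.
have -> : g x (ze x) (nabla ze xi x) = 0.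
  rewrite (metC hg) (nabla_const hn x sze sxi sze xize) nabla_ze_ze.
  by rewrite (met0r hg) oppr0.
rewrite !scale0r !addr0 add0r -mulr2n -scaler_nat => /eqP.
by rewrite scaler_eq0 pnatr_eq0 oppr_eq0 => /eqP.
Qed.

Hypothesis nze : forall x, nabla ze xi x = 0.

Lemma sigma0 X x : smooth_vf X -> g x (nabla X xi x) (ze x) = 0.
Proof. by move=> HX; rewrite nabla_xi_ze_comp // nze (met0l hg). Qed.

Lemma FFsym x a b : g x (F x (F x a)) b = g x a (F x (F x b)).
Proof. by rewrite !Fskew opprK. Qed.

Lemma FskewK x a b : g x a (F x b) = - g x (F x a) b.
Proof. by rewrite Fskew opprK. Qed.

Lemma met_split x a b : g x a b = - g x a (F x (F x b))
  + g x (xi x) b * g x a (xi x) + g x (ze x) b * g x a (ze x).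
Proof. by rewrite FF !(metDr hg) (metNr hg) !(metZr hg); lra. Qed.

Lemma FFF x a : F x (F x (F x a)) = - F x a.
Proof.
rewrite FF (metC hg) Fskew Fxi (met0r hg) (metC hg) Fskew Fze (met0r hg).
by rewrite oppr0 !scale0r !addr0.
Qed.

Lemma field_split X : X = - ap F (ap F X) + fmulv (ev2 g xi X) xi + fmulv (ev2 g ze X) ze.
Proof.
apply/funext => x; rewrite !vfDE vfNE !vfZE !apE FF /ev2.
by apply/rowP => i; rewrite !mxE; ring.
Qed.

Lemma nabla_reduce X x : smooth_vf X ->
  nabla X xi x = - nabla (ap F (ap F X)) xi x.
Proof.
move=> HX; have HFX := smooth_F hF (smooth_F hF HX).
have H1 := smooth_vf_fmulv (smooth_ev2 hg sxi HX) sxi.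
have H2 := smooth_vf_fmulv (smooth_ev2 hg sze HX) sze.
rewrite {1}(field_split X).
rewrite (nablaDl hn (smooth_vfD (smooth_vfN HFX) H1) H2 sxi).
rewrite (nablaDl hn (smooth_vfN HFX) H1 sxi) (nablaNl hn HFX sxi).
rewrite (nablaZl hn (smooth_ev2 hg sxi HX) sxi sxi).
rewrite (nablaZl hn (smooth_ev2 hg sze HX) sze sxi).
by rewrite !vfDE vfNE !vfZE nabla_xi_xi nze !scaler0 !addr0.
Qed.

(* [L_xi F = 0] and [d(d xi) = 0] force [L_xi g = 0]: writing
   [nabla_X xi = - F X + h X] with [h] symmetric, they give [h F = 0]. *)
Lemma killing X x : smooth_vf X ->
  (forall Y, smooth_vf Y -> nijenhuis S F Y xi x = 0) ->
  nabla X xi x = - F x (X x).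
Proof.
move=> HX Nij.
have HF' Y : smooth_vf Y -> smooth_vf (ap F Y) by exact: smooth_F.
(* The vanishing of [[F, F](Y, xi)] is [F ((L_xi F) Y) = 0], with [L] the Lie derivative. *)
have E1 Y : smooth_vf Y -> F x (nablaT S xi F Y x) =
    F x (nabla (ap F Y) xi x) - F x (F x (nabla Y xi x)).
  move=> HY; have := Nij Y HY; rewrite nijE apFxi (nablaT0l hn hF x HY).
  rewrite (nablaT_kernel hn x (HF' Y HY) apFxi) (nablaT_kernel hn x HY apFxi).
  rewrite (FN hF) opprK subr0 => E0.
  by move/eqP: E0; rewrite addrC addr_eq0 => /eqP ->; rewrite opprD opprK.
have C Y Z : smooth_vf Y -> smooth_vf Z -> g x (Y x) (nablaT S xi F Z x)
    - g x (Z x) (F x (nabla Y xi x)) + g x (F x (nabla Z xi x)) (Y x) = 0.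
  move=> HY HZ; have := cF x sxi HY HZ.
  rewrite (nablaT_kernel hn x HY apFxi) (metNr hg) => C0.
  have := nablaTskew hg hn hF Fskew x HZ HY sxi.
  rewrite (nablaT_kernel hn x HZ apFxi) (metNr hg) opprK (metC hg x (Y x) (F x _)).
  by rewrite (metC hg x (nablaT _ _ _ _ _)) => C1; rewrite -C1 -C0; lra.
have K Y Z : smooth_vf Y -> smooth_vf Z -> g x (F x (Y x)) (nabla (ap F Z) xi x)
    + g x (F x (Z x)) (nabla (ap F Y) xi x) = 0.
  move=> HY HZ; have := C _ _ (HF' Y HY) HZ; rewrite apE Fskew E1 // (metBr hg).
  rewrite !(FskewK x (Y x)) (FskewK x (Z x)).
  by rewrite (metC hg x (F x (nabla Z xi x))); lra.
(* [K] makes [Y |-> nabla_Y xi] skew on the image of [F], and [dxi] prescribes its skew part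
   there. *)
have hFF Y Z : smooth_vf Y -> smooth_vf Z ->
    g x (nabla (ap F Y) xi x) (F x (Z x)) = - g x (F x (F x (Y x))) (F x (Z x)).
  move=> HY HZ; have := dxi x (HF' Y HY) (HF' Z HZ); have := K Y Z HY HZ.
  rewrite !apE !(metC hg x (F x (Y x)) (nabla _ _ _)).
  by rewrite !(metC hg x (F x (Z x)) (nabla _ _ _)); lra.
have AF Y : smooth_vf Y -> nabla (ap F Y) xi x = - F x (F x (Y x)).
  move=> HY; apply: (met_inj_vf (x := x) hg hext) => Z HZ.
  rewrite (met_split _ _ (Z x)) (nabla_unit x (HF' Y HY)) (sigma0 x (HF' Y HY)).
  have := hFF Y (ap F Z) HY (HF' Z HZ); rewrite apE => ->.
  by rewrite FFsym FFF !(metNr hg) (metNl hg) -FFsym; lra.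
by rewrite (nabla_reduce x HX) (AF _ (HF' X HX)) apE FFF opprK.
Qed.

End Half.

(** * Covariant derivative of a structure tensor and its commutator with the curvature *)

Section HalfCurvature.
Context {R : realType} {p : nat} {N : cmanifold R p.*2.+1} {S : ccstruct N}.
Local Notation g := (cs_g S).
Local Notation nabla := (cs_nabla S).
Hypothesis hg : is_riemannian g.
Hypothesis hn : is_levi_civita g nabla.
Hypothesis hext : forall x w, exists2 X : vfield N, smooth_vf X & X x = w.
Implicit Types (X Y Z W : vfield N) (x : N).

Variables (F F' : tensor11 N) (xi ze : vfield N).
Hypothesis hF : is_tensor11 F.
Hypothesis hF' : is_tensor11 F'.
Hypothesis Fskew : forall x a b, g x (F x a) b = - g x a (F x b).
Hypothesis F'skew : forall x a b, g x (F' x a) b = - g x a (F' x b).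
Hypothesis sxi : smooth_vf xi.
Hypothesis sze : smooth_vf ze.
Hypothesis Fxi : forall x, F x (xi x) = 0.
Hypothesis Fze : forall x, F x (ze x) = 0.
Hypothesis F'xi : forall x, F' x (xi x) = 0.
Hypothesis F'ze : forall x, F' x (ze x) = 0.
Hypothesis FF : forall x w, F x (F x w) =
  - w + g x (xi x) w *: xi x + g x (ze x) w *: ze x.
Hypothesis FF' : forall x w, F x (F' x w) = - F' x (F x w).
Hypothesis K1 : forall X x, smooth_vf X -> nabla X xi x = - F x (X x).
Hypothesis K2 : forall X x, smooth_vf X -> nabla X ze x = - F' x (X x).
Hypothesis cF : forall X Y Z x, smooth_vf X -> smooth_vf Y -> smooth_vf Z ->
  g x (Y x) (nablaT S X F Z x) + g x (Z x) (nablaT S Y F X x)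
    + g x (X x) (nablaT S Z F Y x) = 0.

(** Stated with [g] and not with [u], [v], so that the pair [(xi, ze)] can be exchanged. *)
Definition hor X := forall x, g x (xi x) (X x) = 0 /\ g x (ze x) (X x) = 0.

Hypothesis Nij : forall X Y Z x, smooth_vf X -> smooth_vf Y -> smooth_vf Z ->
  hor X -> hor Y -> hor Z -> g x (nijenhuis S F X Y x) (Z x) = 0.

Lemma hor_F X : hor (ap F X).
Proof.
by move=> x; rewrite apE !(metC hg x _ (F x _)) !Fskew Fxi Fze !(met0r hg) oppr0.
Qed.

Lemma hor_FF X : hor X -> ap F (ap F X) = - X.
Proof.
by move=> HX; apply/funext => x; have [E1 E2] := HX x; rewrite !apE FF E1 E2 !scale0r !addr0.
Qed.

Let sF X : smooth_vf X -> smooth_vf (ap F X). Proof. exact: smooth_F. Qed.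
Let sF' X : smooth_vf X -> smooth_vf (ap F' X). Proof. exact: smooth_F. Qed.

Lemma nablaT_hor_F X Y Z x : smooth_vf X -> smooth_vf Y -> smooth_vf Z ->
  hor X -> hor Y -> hor Z -> g x (nablaT S (ap F X) F Y x) (Z x) = 0.
Proof.
move=> HX HY HZ hX hY hZ.
have sk A B C : smooth_vf A -> smooth_vf B -> smooth_vf C ->
    g x (nablaT S A F B x) (C x) = - g x (nablaT S A F C x) (B x).
  move=> HA HB HC; rewrite (nablaTskew hg hn hF Fskew x HA HB HC).
  by rewrite (metC hg).
(* Normality and closedness combined. For [t(A, B, C) = g((nabla_{FA} F) B, C)], skew in [B] and
   [C], the cyclic values a, b, c satisfy a = c - b, b = a - c, c = b - a, and so all vanish. *)
have E A B C : smooth_vf A -> smooth_vf B -> smooth_vf C ->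
    hor A -> hor B -> hor C -> g x (nablaT S (ap F A) F B x) (C x) =
    g x (nablaT S (ap F B) F A x) (C x) + g x (nablaT S (ap F C) F A x) (B x).
  move=> HA HB HC hA hB hC.
  have lin4 (a b c d e : 'rV[R]_(p.*2.+1 + p.*2.+1)) : g x (a - b - c + d) e =
      g x a e - g x b e - g x c e + g x d e.
    by rewrite !(metDl hg) !(metNl hg).
  have := Nij x HA HB HC hA hB hC; rewrite nijE lin4 !Fskew.
  have := cF x HA HB (sF HC); rewrite !apE !(metC hg x _ (nablaT _ _ _ _ _)).
  rewrite (sk A (ap F C) B HA (sF HC) HB) (sk _ B A (sF HC) HB HA) apE.
  by lra.
have := E X Y Z HX HY HZ hX hY hZ; have := E Y Z X HY HZ HX hY hZ hX.
have := E Z X Y HZ HX HY hZ hX hY.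
have := sk _ Y Z (sF HX) HY HZ; have := sk _ X Z (sF HY) HX HZ.
have := sk _ Y X (sF HZ) HY HX.
by lra.
Qed.

Lemma nablaT_hor X Y Z x : smooth_vf X -> smooth_vf Y -> smooth_vf Z ->
  hor X -> hor Y -> hor Z -> g x (nablaT S X F Y x) (Z x) = 0.
Proof.
move=> HX HY HZ hX hY hZ.
have := nablaT_hor_F x (sF HX) HY HZ (@hor_F X) hY hZ.
rewrite (hor_FF hX) (nablaTNl hn hF x HX HY) (metNl hg) => /eqP.
by rewrite oppr_eq0 => /eqP.
Qed.

Lemma nablaT_xi X x : smooth_vf X -> nablaT S X F xi x = F x (F x (X x)).
Proof.
move=> HX; rewrite (nablaT_kernel hn x HX (apFxi Fxi)) (K1 x HX).
by rewrite (FN hF) opprK.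
Qed.

Lemma nablaT_ze X x : smooth_vf X -> nablaT S X F ze x = F x (F' x (X x)).
Proof.
move=> HX; rewrite (nablaT_kernel hn x HX (apFze Fze)) (K2 x HX).
by rewrite (FN hF) opprK.
Qed.

Lemma nablaT_xi_comp X Y x : smooth_vf X -> smooth_vf Y ->
  g x (nablaT S X F Y x) (xi x) = - g x (Y x) (F x (F x (X x))).
Proof. by move=> HX HY; rewrite (nablaTskew hg hn hF Fskew x HX HY sxi) nablaT_xi. Qed.

Lemma nablaT_ze_comp X Y x : smooth_vf X -> smooth_vf Y ->
  g x (nablaT S X F Y x) (ze x) = - g x (Y x) (F x (F' x (X x))).
Proof. by move=> HX HY; rewrite (nablaTskew hg hn hF Fskew x HX HY sze) nablaT_ze. Qed.

(** The horizontal component is zero by [nablaT_hor]; the vertical ones follow from skewness and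
    from the derivatives of [F xi = F ze = 0]. *)
Lemma nablaT_horE X Y x : smooth_vf X -> smooth_vf Y -> hor X -> hor Y ->
  nablaT S X F Y x = g x (X x) (Y x) *: xi x - g x (F x (F' x (X x))) (Y x) *: ze x.
Proof.
move=> HX HY hX hY; apply: (met_inj_vf (x := x) hg hext) => W HW.
rewrite (met_split hg FF _ (nablaT _ _ _ _ _) (W x)).
have := nablaT_hor x HX HY (sF (sF HW)) hX hY (@hor_F _); rewrite !apE => ->.
rewrite nablaT_xi_comp // nablaT_ze_comp // (metBl hg) !(metZl hg).
have := congr1 (fun A : vfield N => A x) (hor_FF hX); rewrite !apE vfNE => ->.
rewrite (metNr hg) (metC hg x (Y x)) (metC hg x (Y x)); lra.
Qed.

Lemma nablaT_hor2 X Y W x : smooth_vf X -> smooth_vf Y -> smooth_vf W ->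
  hor X -> hor W -> g x (nablaT S X F Y x) (W x) =
  - g x (xi x) (Y x) * g x (X x) (W x) + g x (ze x) (Y x) * g x (F x (F' x (X x))) (W x).
Proof.
move=> HX HY HW hX hW; rewrite (nablaTskew hg hn hF Fskew x HX HY HW).
rewrite (nablaT_horE x HX HW hX hW) (metBr hg) !(metZr hg).
by rewrite (metC hg x (Y x) (xi x)) (metC hg x (Y x) (ze x)); lra.
Qed.

Lemma F'FskewE x a b : g x (F x (F' x a)) b = - g x a (F x (F' x b)).
Proof. by rewrite Fskew F'skew opprK FF' (metNr hg) opprK. Qed.

Lemma nablaT_along_xi Y W x : smooth_vf Y -> smooth_vf W ->
  g x (nablaT S xi F Y x) (W x) = 0.
Proof.
move=> HY HW; have := cF x sxi HW HY.
rewrite nablaT_xi // (metC hg x (xi x)) nablaT_xi_comp // (metC hg x (W x)).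
rewrite -(FFsym Fskew x (Y x)) (metC hg x (W x) (F x _)); lra.
Qed.

(** In the closedness relation the two remaining terms involve [F F'], which is skew, so they add up
    to the factor 2. Along [xi] they involve the symmetric [F F] and cancel. *)
Lemma nablaT_along_ze Y W x : smooth_vf Y -> smooth_vf W ->
  g x (nablaT S ze F Y x) (W x) = 2 * g x (F x (F' x (Y x))) (W x).
Proof.
move=> HY HW; have := cF x sze HW HY.
rewrite nablaT_ze // (metC hg x (ze x)) nablaT_ze_comp // (metC hg x (W x)).
by rewrite (metC hg x (W x)) (metC hg x (Y x)) (F'FskewE x (W x)) (metC hg x (W x)); lra.
Qed.

(** Meant for [X] a bracket of horizontal fields, which has a vertical part; only its [ze] component
    contributes. *)
Lemma nablaT_hor3 X Y W x : smooth_vf X -> smooth_vf Y -> smooth_vf W ->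
  hor Y -> hor W -> g x (nablaT S X F Y x) (W x) =
  2 * g x (ze x) (X x) * g x (F x (F' x (Y x))) (W x).
Proof.
move=> HX HY HW hY hW; have HFX := sF (sF HX).
have c1 := smooth_ev2 hg sxi HX; have c2 := smooth_ev2 hg sze HX.
have H1 := smooth_vf_fmulv c1 sxi; have H2 := smooth_vf_fmulv c2 sze.
rewrite {1}(field_split FF X).
rewrite (nablaTDl hn hF x (smooth_vfD (smooth_vfN HFX) H1) H2 HY).
rewrite (nablaTDl hn hF x (smooth_vfN HFX) H1 HY) (nablaTNl hn hF x HFX HY).
rewrite (nablaTZl hn hF x c1 sxi HY) (nablaTZl hn hF x c2 sze HY).
rewrite !(metDl hg) (metNl hg) !(metZl hg) nablaT_along_xi // nablaT_along_ze //.
rewrite (nablaT_hor x HFX HY HW (@hor_F _) hY hW) /ev2; ring.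
Qed.

Lemma smooth_QX X : smooth_vf X -> smooth_vf (ap F (ap F' X)).
Proof. by move=> HX; exact: (sF (sF' HX)). Qed.

Lemma nabla_hor_xi X Y x : smooth_vf X -> smooth_vf Y -> hor Y ->
  g x (xi x) (nabla X Y x) = g x (F x (X x)) (Y x).
Proof.
move=> HX HY hY; have E : forall y, g y (xi y) (Y y) = 0 by move=> y; case: (hY y).
have := nabla_const hn x HX sxi HY E; rewrite (K1 x HX) (metNl hg); lra.
Qed.

Lemma nabla_hor_ze X Y x : smooth_vf X -> smooth_vf Y -> hor Y ->
  g x (ze x) (nabla X Y x) = g x (F' x (X x)) (Y x).
Proof.
move=> HX HY hY; have E : forall y, g y (ze y) (Y y) = 0 by move=> y; case: (hY y).
have := nabla_const hn x HX sze HY E; rewrite (K2 x HX) (metNl hg); lra.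
Qed.

(* [F]-derivative of the horizontal part of [nabla_A (nabla_B (F C))]. *)
Lemma nabla_nabla_F A B C W x : smooth_vf A -> smooth_vf B -> smooth_vf C ->
  smooth_vf W -> hor A -> hor B -> hor C -> hor W ->
  g x (nabla A (nabla B (ap F C)) x) (W x) =
  g x (F x (nabla A (nabla B C) x)) (W x)
  - g x (F x (B x)) (C x) * g x (A x) (W x)
  + g x (F' x (B x)) (C x) * g x (F x (F' x (A x))) (W x)
  - g x (B x) (C x) * g x (F x (A x)) (W x)
  + g x (F x (F' x (B x))) (C x) * g x (F' x (A x)) (W x).
Proof.
move=> HA HB HC HW hA hB hC hW.
have HBC := smooth_nabla hn HB HC.
have HQ := smooth_QX HB.
have c1 := smooth_ev2 hg HB HC; have c2 := smooth_ev2 hg HQ HC.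
have H1 := smooth_vf_fmulv c1 sxi; have H2 := smooth_vf_fmulv c2 sze.
have E : nabla B (ap F C) = ap F (nabla B C) +
    (fmulv (ev2 g B C) xi - fmulv (ev2 g (ap F (ap F' B)) C) ze).
  apply/funext => y; rewrite vfDE vfBE !vfZE apE; apply/eqP.
  by rewrite addrC -subr_eq -(nablaTE F) (nablaT_horE y HB HC hB hC).
rewrite E (nablaDr hn HA (sF HBC) (smooth_vfB H1 H2)) (nablaBr hn HA H1 H2).
rewrite (nablaZr hn c1 HA sxi) (nablaZr hn c2 HA sze) !vfDE vfNE !vfDE !vfZE.
have -> : nabla A (ap F (nabla B C)) x =
    nablaT S A F (nabla B C) x + F x (nabla A (nabla B C) x).
  by rewrite nablaTE subrK.
have [W1 W2] := hW x.
have lin6 (t a b c d e w : 'rV[R]_(p.*2.+1 + p.*2.+1)) :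
    g x (t + a + (b + c - (d + e))) w =
    g x t w + g x a w + (g x b w + g x c w - (g x d w + g x e w)).
  by rewrite !(metDl hg) (metNl hg) !(metDl hg).
rewrite lin6 !(metZl hg) W1 W2 (K1 x HA) (K2 x HA).
rewrite (nablaT_hor2 x HA HBC HW hA hW) (nabla_hor_xi x HB HC hC) (nabla_hor_ze x HB HC hC).
by rewrite !(metNl hg) /ev2 !apE; ring.
Qed.

Lemma curv_F X Y Z W x : smooth_vf X -> smooth_vf Y -> smooth_vf Z -> smooth_vf W ->
  hor X -> hor Y -> hor Z -> hor W ->
  g x (curv nabla X Y (ap F Z) x) (W x) = g x (F x (curv nabla X Y Z x)) (W x)
  + g x (F x (X x)) (Z x) * g x (Y x) (W x) - g x (F x (Y x)) (Z x) * g x (X x) (W x)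
  - g x (F' x (X x)) (Z x) * g x (F x (F' x (Y x))) (W x)
  + g x (F' x (Y x)) (Z x) * g x (F x (F' x (X x))) (W x)
  - g x (Y x) (Z x) * g x (F x (X x)) (W x) + g x (X x) (Z x) * g x (F x (Y x)) (W x)
  + g x (F x (F' x (Y x))) (Z x) * g x (F' x (X x)) (W x)
  - g x (F x (F' x (X x))) (Z x) * g x (F' x (Y x)) (W x)
  - 4 * g x (F' x (X x)) (Y x) * g x (F x (F' x (Z x))) (W x).
Proof.
move=> HX HY HZ HW hX hY hZ hW; have HL := smooth_lie hn HX HY.
(* The 4 is 2, from the derivative of [F] along [ze], times 2, from the [ze] component of the
   bracket. *)
have EL : g x (nabla (lie X Y) (ap F Z) x) (W x) = g x (F x (nabla (lie X Y) Z x)) (W x)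
    + 4 * g x (F' x (X x)) (Y x) * g x (F x (F' x (Z x))) (W x).
  have := nablaT_hor3 x HL HZ HW hZ hW; rewrite nablaTE (metBl hg).
  have -> : g x (ze x) (lie X Y x) = 2 * g x (F' x (X x)) (Y x).
    rewrite (lieE hn HX HY) vfBE (metBr hg) (nabla_hor_ze x HX HY hY).
    by rewrite (nabla_hor_ze x HY HX hX) !F'skew (metC hg x (Y x)) F'skew; lra.
  lra.
rewrite /curv !vfBE !(FB hF) !(metBl hg) EL.
rewrite (nabla_nabla_F x HX HY HZ HW hX hY hZ hW).
rewrite (nabla_nabla_F x HY HX HZ HW hY hX hZ hW); lra.
Qed.

Lemma nablaT_along_xi0 Y x : smooth_vf Y -> nablaT S xi F Y x = 0.
Proof.
move=> HY; apply: (met_inj_vf (x := x) hg hext) => W HW.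
by rewrite nablaT_along_xi // (met0l hg).
Qed.

(** Since [nabla xi = - F] and [F] is parallel along [xi], all terms collapse to [F] applied to
    [nabla_X xi]. *)
Lemma curv_xi_xi X x : smooth_vf X -> curv nabla X xi xi x = - F x (F x (X x)).
Proof.
move=> HX; have HL := smooth_lie hn HX sxi.
have E Y : smooth_vf Y -> nabla Y xi = - ap F Y.
  by move=> HY; apply/funext => y; rewrite (K1 y HY).
have E0 : nabla xi xi = 0 by apply/funext => y; rewrite (K1 y sxi) Fxi oppr0.
rewrite /curv E0 (nabla0r hn HX) !vfBE vf0E sub0r.
rewrite (E X HX) (nablaNr hn sxi (sF HX)) vfNE opprK (E _ HL) vfNE opprK apE.
have -> : nabla xi (ap F X) x = F x (nabla xi X x).
  by apply/eqP; rewrite -subr_eq0 -(nablaTE F) nablaT_along_xi0.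
by rewrite -(FD hF) (lieE hn HX sxi) vfBE addrCA subrr addr0 (K1 x HX) (FN hF).
Qed.

End HalfCurvature.

(** * Both halves for a complex Sasakian structure *)

Section SasakianCurvature.
Context {R : realType} {p : nat} {N : cmanifold R p.*2.+1} {S : ccstruct N}.
Hypothesis hS : is_complex_sasakian S.

Local Notation g := (cs_g S).
Local Notation nabla := (cs_nabla S).
Local Notation G := (cs_G S).
Local Notation H := (cs_H S).
Local Notation U := (cs_U S).
Local Notation V := (cs_V S).
Local Notation u := (cs_u S).
Local Notation v := (cs_v S).
Implicit Types (x : N) (X Y Z W : vfield N).

Lemma sas_contact : is_contact_metric S. Proof. by case: hS. Qed.
Local Notation hC := sas_contact.
Lemma sas_lc : is_levi_civita g nabla. Proof. exact: cc_levi_civita hC. Qed.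
Local Notation hg := (cs_riem hC).
Local Notation hn := sas_lc.
Lemma sas_du X Y : smooth_vf X -> smooth_vf Y ->
  forall x, ev2 g X (ap G Y) x = dform u X Y x.
Proof. by case: hS => _ _ + _; apply. Qed.
Lemma sas_dv X Y : smooth_vf X -> smooth_vf Y ->
  forall x, ev2 g X (ap H Y) x = dform v X Y x.
Proof. by case: hS => _ _ _; apply. Qed.

Lemma sas_ext x w : exists2 X : vfield N, smooth_vf X & X x = w.
Proof. exact: extend_tangent hC sas_du sas_dv x w. Qed.

Local Notation sU := (cc_U_smooth hC).
Local Notation sV := (cc_V_smooth hC).
Local Notation hGt := (cc_G_tensor hC).
Local Notation hHt := (cc_H_tensor hC).

Lemma GGE x w : G x (G x w) = - w + g x (U x) w *: U x + g x (V x) w *: V x.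
Proof. by rewrite (cc_GG hC) (cc_U_dual hC) (cc_V_dual hC). Qed.
Lemma HHE x w : H x (H x w) = - w + g x (V x) w *: V x + g x (U x) w *: U x.
Proof. by rewrite (cc_HH hC) (cc_U_dual hC) (cc_V_dual hC) addrAC. Qed.
Lemma GHE x w : G x (H x w) = - H x (G x w).
Proof. by rewrite (HG hC) opprK. Qed.

Lemma dU X Y x : smooth_vf X -> smooth_vf Y ->
  g x (nabla X U x) (Y x) - g x (nabla Y U x) (X x) = - 2 * g x (G x (X x)) (Y x).
Proof. exact: (d_nabla hg hn (gG hC) sU (cc_U_dual hC) sas_du). Qed.
Lemma dV X Y x : smooth_vf X -> smooth_vf Y ->
  g x (nabla X V x) (Y x) - g x (nabla Y V x) (X x) = - 2 * g x (H x (X x)) (Y x).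
Proof. exact: (d_nabla hg hn (gH hC) sV (cc_V_dual hC) sas_dv). Qed.
Lemma cG X Y Z x : smooth_vf X -> smooth_vf Y -> smooth_vf Z ->
  g x (Y x) (nablaT S X G Z x) + g x (Z x) (nablaT S Y G X x)
    + g x (X x) (nablaT S Z G Y x) = 0.
Proof. exact: (d_closed hg hn hGt (gG hC) sU (cc_U_dual hC) sas_du). Qed.
Lemma cH X Y Z x : smooth_vf X -> smooth_vf Y -> smooth_vf Z ->
  g x (Y x) (nablaT S X H Z x) + g x (Z x) (nablaT S Y H X x)
    + g x (X x) (nablaT S Z H Y x) = 0.
Proof. exact: (d_closed hg hn hHt (gH hC) sV (cc_V_dual hC) sas_dv). Qed.

Local Notation gUU := (gUU hC).
Local Notation gVV := (gVV hC).
Local Notation gUV := (gUV hC).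
Local Notation gVU := (gVU hC).

Lemma nablaUU x : nabla U U x = 0.
Proof. exact: (nabla_xi_xi hg hn sas_ext sU gUU (GU hC) dU). Qed.
Lemma nablaVV x : nabla V V x = 0.
Proof. exact: (nabla_xi_xi hg hn sas_ext sV gVV (HV hC) dV). Qed.

Lemma sigma_0 x : sigma S 0 x = 0.
Proof. by rewrite /sigma (nabla0l hn sU) /ev2 vf0E (met0l hg). Qed.
Lemma sigma_U x : sigma S U x = 0.
Proof. by rewrite /sigma /ev2 nablaUU (met0l hg). Qed.
Lemma sigma_V x : sigma S V x = 0.
Proof.
by rewrite /sigma /ev2 (nabla_const hn x sV sU sV gUV) nablaVV (met0r hg) oppr0.
Qed.

Lemma ap_GU : ap G U = 0. Proof. by apply/funext => x; exact: (GU hC x). Qed.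
Lemma ap_GV : ap G V = 0. Proof. by apply/funext => x; exact: (GV hC x). Qed.
Lemma ap_HU : ap H U = 0. Proof. by apply/funext => x; exact: (HU hC x). Qed.
Lemma ap_HV : ap H V = 0. Proof. by apply/funext => x; exact: (HV hC x). Qed.

(** All other terms of [S(X, U)] contain [GU], [HU], [v(U)], [sigma(0)] or [sigma(U)]. The last is
    zero by [nablaUU], already available before [sigma] is known to vanish in general. *)
Lemma nijGU X x : smooth_vf X -> nijenhuis S G X U x = 0.
Proof.
move=> HX; case: hS => _ [_ /(_ X HX x) [+ _]] _ _.
rewrite /Stensor ap_GU ap_HU sigma_0 sigma_U /ev2 /ev1 (cc_vU hC) !vf0E (met0r hg).
rewrite !mulr0 !scale0r !scaler0 apE vf0E (F0 hGt) !scaler0 subrr scaler0.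
by rewrite !subr0 !addr0.
Qed.

Lemma nijHV X x : smooth_vf X -> nijenhuis S H X V x = 0.
Proof.
move=> HX; case: hS => _ [_ /(_ X HX x) [_ +]] _ _.
rewrite /Ttensor ap_GV ap_HV sigma_0 sigma_V /ev2 /ev1 (cc_uV hC) !vf0E (met0r hg).
rewrite !mulr0 !scale0r !scaler0 apE vf0E (F0 hGt) !scaler0 subrr scaler0.
by rewrite !subr0 !addr0.
Qed.

Lemma nablaVU x : nabla V U x = 0.
Proof.
exact: (nabla_ze_xi0 hg hn sas_ext hGt sU sV gUU gVV gUV (GU hC) (GV hC) (HU hC) (HV hC)
  GGE dU dV (nijGU x sV)).
Qed.

Lemma nablaUV x : nabla U V x = 0.
Proof.
exact: (nabla_ze_xi0 hg hn sas_ext hHt sV sU gVV gUU gVU (HV hC) (HU hC) (GV hC) (GU hC)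
  HHE dV dU (nijHV x sU)).
Qed.

Lemma sigma_zero X x : smooth_vf X -> sigma S X x = 0.
Proof.
move=> HX; exact: (sigma0 hg sV (GV hC) dU nablaVU x HX).
Qed.

Lemma nablaU X x : smooth_vf X -> nabla X U x = - G x (X x).
Proof.
move=> HX; apply: (killing hg hn sas_ext hGt (gG hC) sU sV gUU (GU hC) (GV hC)
  GGE dU cG nablaVU HX) => Y HY; exact: nijGU.
Qed.

Lemma nablaV X x : smooth_vf X -> nabla X V x = - H x (X x).
Proof.
move=> HX; apply: (killing hg hn sas_ext hHt (gH hC) sV sU gVV (HV hC) (HU hC)
  HHE dV cH nablaUV HX) => Y HY; exact: nijHV.
Qed.

Local Notation horUV := (@hor _ _ _ S U V).
Local Notation horVU := (@hor _ _ _ S V U).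

Lemma horC X : horVU X -> horUV X.
Proof. by move=> hX y; have [h1 h2] := hX y. Qed.

Lemma hor_horizontal X : horUV X -> horizontal S X.
Proof. by move=> hX y; rewrite (cc_U_dual hC) (cc_V_dual hC); exact: hX. Qed.

(** On horizontal fields, once [sigma = 0], the tensor [S] differs from [[G, G]] only by vertical
    terms, invisible to a horizontal [e]. *)
Lemma nij_aux x (a e : 'rV[R]_(p.*2.+1 + p.*2.+1)) (r t : R) :
  g x (U x) e = 0 -> g x (V x) e = 0 ->
  a + r *: U x - t *: V x = 0 -> g x a e = 0.
Proof.
move=> e1 e2 E; have := congr1 (fun z => g x z e) E.
by rewrite (met0l hg) (metBl hg) (metDl hg) !(metZl hg) e1 e2; lra.
Qed.

Lemma nij_aux' x (a e : 'rV[R]_(p.*2.+1 + p.*2.+1)) (r t : R) :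
  g x (U x) e = 0 -> g x (V x) e = 0 ->
  a - r *: U x + t *: V x = 0 -> g x a e = 0.
Proof.
by move=> e1 e2; rewrite -scaleNr -[t *: _]opprK -scaleNr; exact: nij_aux.
Qed.

Lemma nijG X Y Z x : smooth_vf X -> smooth_vf Y -> smooth_vf Z ->
  horUV X -> horUV Y -> horUV Z -> g x (nijenhuis S G X Y x) (Z x) = 0.
Proof.
move=> HX HY HZ hX hY hZ.
have [uX vX] := hor_horizontal hX x; have [uY vY] := hor_horizontal hY x.
have sGX := sigma_zero x (smooth_F hGt HX); have sGY := sigma_zero x (smooth_F hGt HY).
have sX := sigma_zero x HX; have sY := sigma_zero x HY.
case: hS => _ [+ _] _ _.
move=> /(_ X Y HX HY (hor_horizontal hX) (hor_horizontal hY) x) [+ _].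
rewrite /Stensor sGX sGY sX sY /ev1 vX vY !scale0r subrr scaler0 !subr0 !addr0.
by apply: nij_aux; have [] := hZ x.
Qed.

Lemma nijH X Y Z x : smooth_vf X -> smooth_vf Y -> smooth_vf Z ->
  horVU X -> horVU Y -> horVU Z -> g x (nijenhuis S H X Y x) (Z x) = 0.
Proof.
move=> HX HY HZ /horC hX /horC hY /horC hZ.
have [uX vX] := hor_horizontal hX x; have [uY vY] := hor_horizontal hY x.
have sHX := sigma_zero x (smooth_F hHt HX); have sHY := sigma_zero x (smooth_F hHt HY).
have sX := sigma_zero x HX; have sY := sigma_zero x HY.
case: hS => _ [+ _] _ _.
move=> /(_ X Y HX HY (hor_horizontal hX) (hor_horizontal hY) x) [_ +].
rewrite /Ttensor sHX sHY sX sY /ev1 uX uY !scale0r subrr scaler0 !subr0 !addr0.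
by apply: nij_aux'; have [] := hZ x.
Qed.

Local Notation Rm := (Rm nabla sas_ext).

Definition horx x (a : 'rV[R]_(p.*2.+1 + p.*2.+1)) :=
  g x (U x) a = 0 /\ g x (V x) a = 0.

Lemma hor_extend x a : horx x a -> exists X, [/\ smooth_vf X, horUV X & X x = a].
Proof.
(* [G^2] of any field is horizontal everywhere and equals minus the identity on horizontal vectors;
   hence the extension of [- a]. *)
move=> [a1 a2]; have [A HA Ax] := sas_ext x (- a).
exists (ap G (ap G A)); split.
- exact: (smooth_F hGt (smooth_F hGt HA)).
- exact: (hor_F hg (gG hC) (GU hC) (GV hC)).
- by rewrite !apE Ax GGE !(metNr hg) a1 a2 oppr0 !scale0r !addr0 opprK.
Qed.

Lemma Rm_G x a b c d : horx x a -> horx x b -> horx x c -> horx x d ->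
  g x (Rm x a b (G x c)) d = g x (G x (Rm x a b c)) d
  + g x (G x a) c * g x b d - g x (G x b) c * g x a d
  - g x (H x a) c * g x (G x (H x b)) d + g x (H x b) c * g x (G x (H x a)) d
  - g x b c * g x (G x a) d + g x a c * g x (G x b) d
  + g x (G x (H x b)) c * g x (H x a) d - g x (G x (H x a)) c * g x (H x b) d
  - 4 * g x (H x a) b * g x (G x (H x c)) d.
Proof.
move=> /hor_extend[A [HA hA <-]] /hor_extend[B [HB hB <-]].
move=> /hor_extend[C [HC hC' <-]] /hor_extend[D [HD hD <-]].
have := curv_F hg hn sas_ext hGt hHt (gG hC) (gH hC) sU sV (GU hC) (GV hC)
  GGE GHE nablaU nablaV cG nijG x HA HB HC HD hA hB hC' hD.
rewrite (curvE hg hn sas_ext x HA HB (smooth_F hGt HC)).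
by rewrite (curvE hg hn sas_ext x HA HB HC) apE.
Qed.

Lemma Rm_H x a b c d : horx x a -> horx x b -> horx x c -> horx x d ->
  g x (Rm x a b (H x c)) d = g x (H x (Rm x a b c)) d
  + g x (H x a) c * g x b d - g x (H x b) c * g x a d
  - g x (G x a) c * g x (H x (G x b)) d + g x (G x b) c * g x (H x (G x a)) d
  - g x b c * g x (H x a) d + g x a c * g x (H x b) d
  + g x (H x (G x b)) c * g x (G x a) d - g x (H x (G x a)) c * g x (G x b) d
  - 4 * g x (G x a) b * g x (H x (G x c)) d.
Proof.
move=> /hor_extend[A [HA hA <-]] /hor_extend[B [HB hB <-]].
move=> /hor_extend[C [HC hC' <-]] /hor_extend[D [HD hD <-]].
have hVU E : horUV E -> horVU E by move=> hE y; have [] := hE y.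
have := curv_F hg hn sas_ext hHt hGt (gH hC) (gG hC) sV sU (HV hC) (HU hC)
  HHE (HG hC) nablaV nablaU cH nijH x HA HB HC HD (hVU _ hA) (hVU _ hB) (hVU _ hC') (hVU _ hD).
rewrite (curvE hg hn sas_ext x HA HB (smooth_F hHt HC)).
by rewrite (curvE hg hn sas_ext x HA HB HC) apE.
Qed.

Lemma Rm_UU x a : Rm x a (U x) (U x) = - G x (G x a).
Proof.
have [A HA <-] := sas_ext x a.
have := curv_xi_xi hg hn sas_ext hGt (gG hC) sU (GU hC) nablaU cG x HA.
by rewrite (curvE hg hn sas_ext x HA sU sU).
Qed.

Lemma Rm_VV x a : Rm x a (V x) (V x) = - H x (H x a).
Proof.
have [A HA <-] := sas_ext x a.
have := curv_xi_xi hg hn sas_ext hHt (gH hC) sV (HV hC) nablaV cH x HA.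
by rewrite (curvE hg hn sas_ext x HA sV sV).
Qed.

End SasakianCurvature.

(** * Traces on Euclidean spaces *)

Section FunctionTrace.
Context {R : realType} {n : nat}.
Local Notation Vec := 'rV[R]_n.
Implicit Types (f h : Vec -> Vec).

Definition trf f : R := \tr (lin1_mx f).

Lemma trfE f : trf f = \sum_i f (delta_mx 0 i) 0 i.
Proof. by apply: eq_bigr => i _; rewrite mxE. Qed.

Lemma eq_trf f h : f =1 h -> trf f = trf h.
Proof. by move=> E; rewrite !trfE; apply: eq_bigr => i _; rewrite E. Qed.

Lemma mul_lin1 f a : linear f -> a *m lin1_mx f = f a.
Proof.
move=> lf; rewrite [in RHS](row_sum_delta a) (linfun_sum lf) mulmx_sum_row.
apply: eq_bigr => i _; rewrite (linfunZ lf); congr (_ *: _).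
by apply/rowP => j; rewrite !mxE.
Qed.

Lemma trfD f h : trf (fun a => f a + h a) = trf f + trf h.
Proof. by rewrite !trfE -big_split; apply: eq_bigr => i _; rewrite mxE. Qed.

Lemma trfZ (k : R) f : trf (fun a => k *: f a) = k * trf f.
Proof. by rewrite !trfE mulr_sumr; apply: eq_bigr => i _; rewrite mxE. Qed.

Lemma trfN f : trf (fun a => - f a) = - trf f.
Proof. by rewrite !trfE -sumrN; apply: eq_bigr => i _; rewrite mxE. Qed.

Lemma trf_mx (L : 'M[R]_n) : trf (fun a => a *m L) = \tr L.
Proof.
rewrite trfE; apply: eq_bigr => i _; rewrite mxE (bigD1 i) //= mxE !eqxx mul1r.
by rewrite big1 ?addr0 // => j /negPf ji; rewrite mxE ji andbF mul0r.
Qed.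

Lemma trf_comp f h : linear f -> linear h -> trf (fun a => f (h a)) = trf (fun a => h (f a)).
Proof.
move=> lf lh.
have E (k l : Vec -> Vec) : linear k -> linear l ->
    trf (fun a => k (l a)) = \tr (lin1_mx l *m lin1_mx k).
  by move=> lk ll; rewrite -[RHS]trf_mx; apply: eq_trf => a; rewrite mulmxA !mul_lin1.
by rewrite !E // mxtrace_mulC.
Qed.

Lemma trf_rank1 (phi : Vec -> R) w : linear (phi : Vec -> R) ->
  trf (fun a => phi a *: w) = phi w.
Proof.
move=> lphi; rewrite trfE [in RHS](row_sum_delta w) (linfun_sum lphi).
by apply: eq_bigr => i _; rewrite mxE (linfunZ lphi) mulrC.
Qed.

Lemma trf_id : trf (fun a => a) = n%:R.
Proof.
rewrite -(mxtrace_scalar n (1 : R)) -trf_mx; apply: eq_trf => a.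
by rewrite mulmx1.
Qed.

(** The trace of [f h h] equals that of [h f h] by cyclicity and its opposite by anticommutation,
    while [f h h = - f]. *)
Lemma trf_anticomm f h : linear f -> linear h ->
  (forall a, f (h (h a)) = - f a) -> (forall a, h (f a) = - f (h a)) -> trf f = 0.
Proof.
move=> lf lh E1 E2.
have lfh : linear (fun a => f (h a)) by move=> k a b; rewrite lh lf.
have e1 : trf (fun a => f (h (h a))) = - trf f by rewrite (eq_trf E1) trfN.
have e2 : trf (fun a => f (h (h a))) = - trf (fun a => f (h (h a))).
  by rewrite [LHS](trf_comp lfh lh) -trfN; apply: eq_trf => a; exact: E2.
by lra.
Qed.

End FunctionTrace.

Section EuclideanTrace.
Context {R : realType} {n : nat}.
Local Notation Vec := 'rV[R]_n.
Variable g : Vec -> Vec -> R.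
Hypothesis gC : forall a b, g a b = g b a.
Hypothesis gl : forall b, linear (g^~ b : Vec -> R).
Hypothesis g0 : forall a, g a a = 0 -> a = 0.

Definition gram : 'M[R]_n := \matrix_(i, j) g (delta_mx 0 i) (delta_mx 0 j).

Lemma mul_gram a b : (a *m gram) 0 b = g a (delta_mx 0 b).
Proof.
rewrite [in RHS](row_sum_delta a) (linfun_sum (gl _)) mxE.
by apply: eq_bigr => i _; rewrite mxE (linfunZ (gl _)).
Qed.

Lemma met_delta_inj a b : (forall j, g a (delta_mx 0 j) = g b (delta_mx 0 j)) -> a = b.
Proof.
move=> E; apply/eqP; rewrite -subr_eq0; apply/eqP/g0; set w := a - b.
have wj j : g (delta_mx 0 j) w = 0.
  by rewrite gC /w (linfunB (gl _)) E subrr.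
rewrite [in X in g X _](row_sum_delta w) (linfun_sum (gl _)) big1 // => j _.
by rewrite (linfunZ (gl _)) wj scaler0.
Qed.

Lemma gram_unit : gram \in unitmx.
Proof.
rewrite unitmxE unitfE; apply/det0P => -[a /negP a0 aG]; apply: a0; apply/eqP.
apply: met_delta_inj => j; rewrite -mul_gram aG mxE.
by rewrite (linfun0 (gl _)).
Qed.

Lemma riesz (phi : Vec -> R) : linear (phi : Vec -> R) ->
  exists b, forall w, g b w = phi w.
Proof.
move=> lphi; pose r : Vec := \row_j phi (delta_mx 0 j).
exists (r *m invmx gram) => w.
rewrite gC [in LHS](row_sum_delta w) [in RHS](row_sum_delta w) (linfun_sum (gl _)).
rewrite (linfun_sum lphi); apply: eq_bigr => j _.
by rewrite (linfunZ (gl _)) (linfunZ lphi) gC -mul_gram mulmxKV ?gram_unit // mxE.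
Qed.

(** The coordinate basis need not be orthonormal; skewness reads [L Gm = - Gm L^T] with the Gram
    matrix [Gm], and conjugation by [Gm] preserves the trace. *)
Lemma trf_skew f : linear f -> (forall a b, g (f a) b = - g a (f b)) -> trf f = 0.
Proof.
move=> lf sk; set L := lin1_mx f.
have E : L *m gram = - (gram *m L^T).
  apply/matrixP => i j; rewrite [RHS]mxE.
  have -> : (L *m gram) i j = g (f (delta_mx 0 i)) (delta_mx 0 j).
    by rewrite -mul_gram !mxE; apply: eq_bigr => k _; rewrite mxE.
  rewrite sk; congr (- _); rewrite [in LHS](row_sum_delta (f _)) gC.
  rewrite (linfun_sum (gl _)) mxE; apply: eq_bigr => k _.
  by rewrite (linfunZ (gl _)) !mxE mulrC gC.
have : \tr L = - \tr L.
  rewrite -[in LHS](mulmxK gram_unit L) E mulNmx linearN /= mxtrace_mulC mulmxA.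
  by rewrite mulVmx ?gram_unit // mul1mx mxtrace_tr.
by rewrite /trf -/L; lra.
Qed.

End EuclideanTrace.

(** * The transverse curvature tensor *)

Section CurvatureAlgebra.
Context {R : realType} {n : nat}.
Local Notation Vec := 'rV[R]_n.
Variables (g : Vec -> Vec -> R) (G H : Vec -> Vec) (U V : Vec).
Variable Rm : Vec -> Vec -> Vec -> Vec.
Hypothesis gC : forall a b, g a b = g b a.
Hypothesis gl : forall b, linear (g^~ b : Vec -> R).
Hypothesis gpos : forall a, a != 0 -> 0 < g a a.
Hypothesis lG : linear G.
Hypothesis lH : linear H.
Hypothesis gG : forall a b, g (G a) b = - g a (G b).
Hypothesis gH : forall a b, g (H a) b = - g a (H b).
Hypothesis GU : G U = 0.
Hypothesis GV : G V = 0.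
Hypothesis HU : H U = 0.
Hypothesis HV : H V = 0.
Hypothesis gUU : g U U = 1.
Hypothesis gVV : g V V = 1.
Hypothesis GG : forall a, G (G a) = - a + g U a *: U + g V a *: V.
Hypothesis HH : forall a, H (H a) = - a + g U a *: U + g V a *: V.
Hypothesis HG : forall a, H (G a) = - G (H a).
Hypothesis Rl1 : forall b c, linear (fun a => Rm a b c).
Hypothesis RN : forall a b c, Rm a b c = - Rm b a c.
Hypothesis Rl3 : forall a b, linear (Rm a b).
Hypothesis Rskew : forall a b c d, g (Rm a b c) d = - g c (Rm a b d).
Hypothesis Rbianchi : forall a b c, Rm a b c + Rm b c a + Rm c a b = 0.
Hypothesis RUU : forall a, Rm a U U = - G (G a).
Hypothesis RVV : forall a, Rm a V V = - G (G a).

Definition hv a := g U a = 0 /\ g V a = 0.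

Hypothesis R_G : forall a b c d, hv a -> hv b -> hv c -> hv d ->
  g (Rm a b (G c)) d = g (G (Rm a b c)) d
  + g (G a) c * g b d - g (G b) c * g a d
  - g (H a) c * g (G (H b)) d + g (H b) c * g (G (H a)) d
  - g b c * g (G a) d + g a c * g (G b) d
  + g (G (H b)) c * g (H a) d - g (G (H a)) c * g (H b) d
  - 4 * g (H a) b * g (G (H c)) d.
Hypothesis R_H : forall a b c d, hv a -> hv b -> hv c -> hv d ->
  g (Rm a b (H c)) d = g (H (Rm a b c)) d
  + g (H a) c * g b d - g (H b) c * g a d
  - g (G a) c * g (H (G b)) d + g (G b) c * g (H (G a)) d
  - g b c * g (H a) d + g a c * g (H b) d
  + g (H (G b)) c * g (G a) d - g (H (G a)) c * g (G b) d
  - 4 * g (G a) b * g (H (G c)) d.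

Lemma gDl a b c : g (a + b) c = g a c + g b c. Proof. exact: (linfunD (gl c)). Qed.
Lemma gZl k a c : g (k *: a) c = k * g a c. Proof. exact: (linfunZ (gl c)). Qed.
Lemma gNl a c : g (- a) c = - g a c. Proof. exact: (linfunN (gl c)). Qed.
Lemma gBl a b c : g (a - b) c = g a c - g b c. Proof. exact: (linfunB (gl c)). Qed.
Lemma g0l c : g 0 c = 0. Proof. exact: (linfun0 (gl c)). Qed.
Lemma gDr a b c : g c (a + b) = g c a + g c b. Proof. by rewrite !(gC c) gDl. Qed.
Lemma gZr k a c : g c (k *: a) = k * g c a. Proof. by rewrite !(gC c) gZl. Qed.
Lemma gNr a c : g c (- a) = - g c a. Proof. by rewrite !(gC c) gNl. Qed.
Lemma gBr a b c : g c (a - b) = g c a - g c b. Proof. by rewrite !(gC c) gBl. Qed.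
Lemma g0r c : g c 0 = 0. Proof. by rewrite gC g0l. Qed.
Definition gE := (gBl, gBr, gDl, gDr, gZl, gZr, gNl, gNr).

Lemma g_eq0 a : g a a = 0 -> a = 0.
Proof. by move=> E; apply/eqP; apply: contra_eqT E => /gpos /lt0r_neq0. Qed.
Lemma g_inj a b : (forall c, g a c = g b c) -> a = b.
Proof. by move=> E; apply/eqP; rewrite -subr_eq0; apply/eqP/g_eq0; rewrite gBl E subrr. Qed.

Lemma hvG a : hv (G a).
Proof. by split; rewrite gC gG ?GU ?GV g0r oppr0. Qed.
Lemma hvH a : hv (H a).
Proof. by split; rewrite gC gH ?HU ?HV g0r oppr0. Qed.
Lemma GGh a : hv a -> G (G a) = - a.
Proof. by move=> [e1 e2]; rewrite GG e1 e2 !scale0r !addr0. Qed.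
Lemma HHh a : hv a -> H (H a) = - a.
Proof. by move=> [e1 e2]; rewrite HH e1 e2 !scale0r !addr0. Qed.

(** The orthogonal projection onto the horizontal vectors. *)
Definition pr a := - G (G a).
Lemma hv_pr a : hv (pr a).
Proof. by have [h1 h2] := hvG (G a); split; rewrite /pr gNr ?h1 ?h2 oppr0. Qed.
Lemma pr_id a : hv a -> pr a = a.
Proof. by move=> h; rewrite /pr GGh // opprK. Qed.
Lemma prE a : pr a = a - g U a *: U - g V a *: V.
Proof. by rewrite /pr GG !opprD opprK. Qed.
Lemma pr_lin : linear pr.
Proof. by move=> k a b; rewrite /pr !lG opprD scalerN. Qed.
Lemma gpr a b : g (pr a) b = g a (pr b).
Proof. by rewrite /pr gNl gNr !gG opprK. Qed.
Lemma prG a : pr (G a) = G a. Proof. exact/pr_id/hvG. Qed.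
Lemma prH a : pr (H a) = H a. Proof. exact/pr_id/hvH. Qed.
Lemma Gpr a : G (pr a) = G a.
Proof. by rewrite -[RHS]prG /pr (linfunN lG). Qed.
Lemma HHpr a : - H (H a) = pr a. Proof. by rewrite /pr HH GG. Qed.
Lemma Hpr a : H (pr a) = H a.
Proof. by rewrite -[RHS]prH -!HHpr (linfunN lH). Qed.

Definition corr a b c : Vec :=
  - 2 *: (g (G a) b *: G c + g (H a) b *: H c)
  + (g (G b) c *: G a + g (H b) c *: H a) - (g (G a) c *: G b + g (H a) c *: H b).

(* O'Neill: on horizontal vectors [KK] is the curvature of the transverse
   hyperkaehler structure ([corr] involves the integrability tensor
   [A_a b = g (G a) b U + g (H a) b V]). *)
Definition KK a b c : Vec := pr (Rm (pr a) (pr b) (pr c)) + corr a b c.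

Lemma corrE a b c d : g (corr a b c) d =
  - 2 * (g (G a) b * g (G c) d + g (H a) b * g (H c) d)
  + (g (G b) c * g (G a) d + g (H b) c * g (H a) d)
  - (g (G a) c * g (G b) d + g (H a) c * g (H b) d).
Proof. by rewrite /corr !gE. Qed.

Lemma corr_pr a b c : corr (pr a) (pr b) (pr c) = corr a b c.
Proof. by rewrite /corr !Gpr !Hpr -!gpr !prG !prH. Qed.

Lemma KKE a b c d : hv a -> hv b -> hv c -> hv d ->
  g (KK a b c) d = g (Rm a b c) d + g (corr a b c) d.
Proof. by move=> ha hb hc hd; rewrite /KK gDl gpr !pr_id. Qed.

Lemma KK_pr a b c : KK (pr a) (pr b) (pr c) = KK a b c.
Proof. by rewrite /KK corr_pr !(pr_id (hv_pr _)). Qed.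

Lemma hvD a b : hv a -> hv b -> hv (a + b).
Proof. by move=> [a1 a2] [b1 b2]; split; rewrite gDr ?a1 ?a2 ?b1 ?b2 addr0. Qed.
Lemma hvZ k a : hv a -> hv (k *: a).
Proof. by move=> [a1 a2]; split; rewrite gZr ?a1 ?a2 mulr0. Qed.
Lemma hvN a : hv a -> hv (- a).
Proof. by move=> [a1 a2]; split; rewrite gNr ?a1 ?a2 oppr0. Qed.

Lemma hv_KK a b c : hv (KK a b c).
Proof.
have hGH k l s t : hv (k *: G s + l *: H t).
  by apply: hvD; apply: hvZ; [exact: hvG|exact: hvH].
by apply: hvD; [exact: hv_pr|apply: hvD; [apply: hvD; [exact: hvZ|]|exact: hvN]].
Qed.

Lemma hv_eq a b : hv a -> hv b -> (forall d, hv d -> g a d = g b d) -> a = b.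
Proof.
move=> ha hb E; apply: g_inj => c.
by rewrite -(pr_id ha) -(pr_id hb) !gpr; apply: E; exact: hv_pr.
Qed.

Lemma gG_r a b : g a (G b) = - g (G a) b. Proof. by rewrite gG opprK. Qed.
Lemma gH_r a b : g a (H b) = - g (H a) b. Proof. by rewrite gH opprK. Qed.

(** The extra terms of [R_G] are exactly the defect of [corr] to commute with [G]. Since [KK]
    factors through [pr], horizontal arguments suffice. *)
Lemma KK_G a b c : KK a b (G c) = G (KK a b c).
Proof.
have Hh a' b' c' : hv a' -> hv b' -> hv c' -> KK a' b' (G c') = G (KK a' b' c').
  move=> ha hb hc; apply: hv_eq; [exact: hv_KK|exact: hvG|move=> d hd].
  have hGc := hvG c'; have hGd := hvG d.
  rewrite gG (KKE ha hb hGc hd) (KKE ha hb hc hGd) (R_G ha hb hc hd) !corrE.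
  rewrite gG HG !gG_r !(GGh ha) !(GGh hb) !(GGh hc) !gNl; ring.
by rewrite -KK_pr prG -[G c]Gpr (Hh _ _ _ (hv_pr a) (hv_pr b) (hv_pr c)) KK_pr.
Qed.

Lemma KK_H a b c : KK a b (H c) = H (KK a b c).
Proof.
have Hh a' b' c' : hv a' -> hv b' -> hv c' -> KK a' b' (H c') = H (KK a' b' c').
  move=> ha hb hc; apply: hv_eq; [exact: hv_KK|exact: hvH|move=> d hd].
  have hHc := hvH c'; have hHd := hvH d.
  rewrite gH (KKE ha hb hHc hd) (KKE ha hb hc hHd) (R_H ha hb hc hd) !corrE.
  rewrite gH !gH_r !HG !(HHh ha) !(HHh hb) !(HHh hc) !gNl; ring.
by rewrite -KK_pr prH -[H c]Hpr (Hh _ _ _ (hv_pr a) (hv_pr b) (hv_pr c)) KK_pr.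
Qed.

Lemma KK_lin3 a b : linear (KK a b).
Proof.
move=> k c c'; rewrite /KK /corr pr_lin Rl3 pr_lin !lG !lH !gDr !gZr.
by apply/rowP => i; rewrite !mxE; ring.
Qed.

Lemma KKN a b c : KK a b c = - KK b a c.
Proof.
rewrite /KK /corr RN (linfunN pr_lin) [g (G b) a]gG [g (H b) a]gH.
rewrite (gC b) (gC b).
by apply/rowP => i; rewrite !mxE; ring.
Qed.

Lemma KKskew a b c d : g (KK a b c) d = - g c (KK a b d).
Proof.
rewrite /KK gDl gDr gpr Rskew -gpr (gC c (corr _ _ _)) !corrE.
by rewrite (gG c d) (gH c d) (gC c (G d)) (gC c (H d)); ring.
Qed.

Lemma KKbianchi a b c : KK a b c + KK b c a + KK c a b = 0.
Proof.
rewrite /KK /corr.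
have := congr1 pr (Rbianchi (pr a) (pr b) (pr c)).
rewrite (linfun0 pr_lin) !(linfunD pr_lin) => E.
rewrite -[RHS]E (gG a c) (gG b a) (gG c b) (gH a c) (gH b a) (gH c b).
rewrite (gC a (G c)) (gC b (G a)) (gC c (G b)) (gC a (H c)) (gC b (H a)) (gC c (H b)).
by apply/rowP => i; rewrite !mxE; ring.
Qed.

Lemma KK_pr3 a b c : KK a b (pr c) = KK a b c.
Proof. by rewrite -[LHS]KK_pr (pr_id (hv_pr c)) KK_pr. Qed.

Lemma KK_GG a b c : KK a b (G (G c)) = - KK a b c.
Proof. by rewrite -(KK_pr3 _ _ c) -(linfunN (KK_lin3 a b)) /pr opprK. Qed.

Lemma KK_HH a b c : KK a b (H (H c)) = - KK a b c.
Proof. by rewrite -(KK_pr3 _ _ c) -(linfunN (KK_lin3 a b)) -HHpr opprK. Qed.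

Lemma lin_comp (f h : Vec -> Vec) : linear f -> linear h -> linear (fun a => f (h a)).
Proof. by move=> lf lh k a b; rewrite lh lf. Qed.

Lemma lHG : linear (fun a => H (G a)). Proof. exact: lin_comp. Qed.

(** [G \o KK b c] anticommutes with [H], because [KK b c] commutes with [H]. *)
Lemma tr_G_KK b c : trf (fun a => G (KK b c a)) = 0.
Proof.
apply: (trf_anticomm (lin_comp lG (KK_lin3 b c)) lH) => a.
  by rewrite KK_HH (linfunN lG).
by rewrite KK_H HG.
Qed.

Lemma tr_H_KK b c : trf (fun a => H (KK b c a)) = 0.
Proof.
apply: (trf_anticomm (lin_comp lH (KK_lin3 b c)) lG) => a.
  by rewrite KK_GG (linfunN lH).
by rewrite KK_G HG opprK.
Qed.

Lemma tr_HG_KK b c : trf (fun a => H (G (KK b c a))) = 0.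
Proof.
apply: (trf_anticomm (lin_comp lHG (KK_lin3 b c)) lG) => a.
  by rewrite KK_GG (linfunN lG) (linfunN lH).
by rewrite KK_G [H (G (G _))]HG opprK.
Qed.

(** * Ricci-flatness of the transverse tensor *)

Definition rhoK b c := trf (fun a => KK a b c).

(** By the Bianchi identity the two sides differ by the trace of [f \o KK b c]. *)
Lemma rhoK_sym (f : Vec -> Vec) b c : linear f ->
  (forall a b c, KK a b (f c) = f (KK a b c)) ->
  trf (fun a => f (KK b c a)) = 0 -> rhoK b (f c) = rhoK c (f b).
Proof.
move=> lf E T; rewrite /rhoK (eq_trf (fun a => E a b c)) (eq_trf (fun a => E a c b)).
rewrite -[RHS](subr0) -T -trfN -trfD; apply: eq_trf => a.
rewrite -(linfunB lf); congr (f _); rewrite [KK a c b]KKN.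
by apply/eqP; rewrite -subr_eq0 opprB opprK addrA KKbianchi.
Qed.

Lemma tr_KK b c : trf (KK b c) = 0.
Proof. exact: (trf_skew gC gl g_eq0 (KK_lin3 b c) (KKskew b c)). Qed.

Lemma rhoKC b c : rhoK b c = rhoK c b.
Proof. by apply: (rhoK_sym (f := idfun)) => //; exact: tr_KK. Qed.

Lemma rhoKN b c : rhoK b (- c) = - rhoK b c.
Proof. by rewrite /rhoK -trfN; apply: eq_trf => a; rewrite (linfunN (KK_lin3 a b)). Qed.

(** The symmetry for [HG] followed by that for [H] gives [rhoK b (H (G c)) = rhoK (G b) (H c)];
    writing [HG = - GH] and using the symmetry for [G] gives the opposite value. *)
Lemma rhoK_GH b c : rhoK (G b) (H c) = 0.
Proof.
have bG x y := rhoK_sym lG KK_G (tr_G_KK x y).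
have bH x y := rhoK_sym lH KK_H (tr_H_KK x y).
have bJ x y : rhoK x (H (G y)) = rhoK y (H (G x)).
  by apply: (rhoK_sym lHG) (tr_HG_KK x y) => a b' c'; rewrite KK_H KK_G.
have e1 : rhoK b (H (G c)) = rhoK (G b) (H c) by rewrite bJ bH.
have e2 : rhoK b (H (G c)) = - rhoK (G b) (H c) by rewrite HG rhoKN bG rhoKC.
by move: e2; rewrite e1; lra.
Qed.

Lemma rhoK0 b c : rhoK b c = 0.
Proof.
have -> : rhoK b c = rhoK (pr b) (pr c).
  by apply: eq_trf => a; rewrite -[RHS]KK_pr !(pr_id (hv_pr _)) KK_pr.
have -> : pr b = G (- G b) by rewrite (linfunN lG).
have -> : pr c = H (- H c) by rewrite (linfunN lH) HHpr.
exact: rhoK_GH.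
Qed.

(** * Ricci tensor and scalar curvature *)

Definition rho b c := trf (fun a => Rm a b c).

Lemma tr_G : trf G = 0. Proof. exact: (trf_skew gC gl g_eq0 lG gG). Qed.
Lemma tr_H : trf H = 0. Proof. exact: (trf_skew gC gl g_eq0 lH gH). Qed.

Lemma lg a : linear (g a : Vec -> R).
Proof. by move=> k x y; rewrite gDr gZr. Qed.

Lemma lgF (f : Vec -> Vec) b : linear f -> linear (fun a => g (f a) b : R).
Proof. by move=> lf k x y; rewrite lf gDl gZl. Qed.

(** The 6 is 4 from the terms with coefficient - 2 and 2 from the last pair; the middle pair has
    trace zero because [G] and [H] are skew. *)
Lemma tr_corr b c : hv b -> hv c -> trf (fun a => corr a b c) = 6 * g b c.
Proof.
move=> hb hc.
rewrite /corr trfD trfN trfD trfZ !trfD.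
rewrite (trf_rank1 (G c) (lgF b lG)) (trf_rank1 (H c) (lgF b lH)).
rewrite (trf_rank1 (G b) (lgF c lG)) (trf_rank1 (H b) (lgF c lH)).
rewrite trfZ trfZ tr_G tr_H !GGh // !HHh // !gNl (gC c b); ring.
Qed.

Lemma split_vec a : a = pr a + g U a *: U + g V a *: V.
Proof. by rewrite prE addrAC !subrK. Qed.

Lemma trf_split (f : Vec -> Vec) : linear f ->
  trf f = trf (fun a => pr (f (pr a))) + g U (f U) + g V (f V).
Proof.
move=> lf; rewrite (eq_trf (h := fun a => f (pr a) + g U a *: f U + g V a *: f V)).
  rewrite !trfD (trf_rank1 (f U) (lg U)) (trf_rank1 (f V) (lg V)); congr (_ + _ + _).
  rewrite -(trf_comp (lin_comp lf pr_lin) pr_lin); apply: eq_trf => a.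
  by rewrite (pr_id (hv_pr a)).
by move=> a; rewrite {1}(split_vec a) !(linfunD lf) !(linfunZ lf).
Qed.

(** 0 from [KK], - 6 from [corr], and 1 each from the directions [U] and [V]. *)
Lemma rho_hv b c : hv b -> hv c -> rho b c = - 4 * g b c.
Proof.
move=> hb hc; rewrite /rho (trf_split (Rl1 b c)).
rewrite (eq_trf (h := fun a => KK a b c - corr a b c)); last first.
  move=> a; rewrite /KK (pr_id hb) (pr_id hc).
  by rewrite addrK.
rewrite trfD trfN -/(rhoK b c) rhoK0 (tr_corr hb hc).
have e W : Rm b W W = - G (G b) -> g W (Rm W b c) = g b c.
  by move=> E; rewrite gC Rskew RN gNr opprK E -/(pr b) (pr_id hb) gC.
by rewrite (e U (RUU b)) (e V (RVV b)); ring.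
Qed.

Lemma tr_pr : trf pr = n%:R - 2.
Proof.
rewrite (eq_trf prE) !trfD !trfN trf_id (trf_rank1 U (lg U)) (trf_rank1 V (lg V)).
by rewrite gUU gVV; ring.
Qed.

Lemma rho_UU : rho U U = n%:R - 2.
Proof. by rewrite -tr_pr; apply: eq_trf => a; exact: RUU. Qed.

Lemma rho_VV : rho V V = n%:R - 2.
Proof. by rewrite -tr_pr; apply: eq_trf => a; exact: RVV. Qed.

Lemma rho_lin1 c : linear (fun b => rho b c : R).
Proof.
move=> k b b'; rewrite /rho -[k *: trf _]/(k * trf _) -trfZ -trfD; apply: eq_trf => a.
by rewrite RN Rl1 opprD -scalerN -!RN.
Qed.

Lemma rho_lin2 b : linear (rho b : _ -> R).
Proof.
move=> k c c'; rewrite /rho -[k *: trf _]/(k * trf _) -trfZ -trfD.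
by apply: eq_trf => a; rewrite Rl3.
Qed.

(** [scal] picks some representing matrix, with default 0: existence rules out the default, and the
    second clause gives one trace for every choice. That trace is - 4 on each of [n - 2] horizontal
    directions plus [n - 2] for each of [U] and [V]. *)
Lemma ricci_operator : exists Q : 'M[R]_n,
  (forall a b, g (a *m Q) b = rho a b) /\
  (forall Q' : 'M[R]_n, (forall a b, g (a *m Q') b = rho a b) -> \tr Q' = - 2 * (n%:R - 2)).
Proof.
have trE (Q : 'M[R]_n) : (forall a b, g (a *m Q) b = rho a b) -> \tr Q = - 2 * (n%:R - 2).
  move=> E; rewrite -trf_mx trf_split; last by move=> k a b; rewrite mulmxDl scalemxAl.
  rewrite (gC U) (gC V) !E rho_UU rho_VV (eq_trf (h := fun a => - 4 *: pr a)).
    by rewrite trfZ tr_pr; ring.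
  move=> a; apply: hv_eq; [exact: hv_pr|exact/hvZ/hv_pr|move=> d hd].
  by rewrite gpr E (pr_id hd) (rho_hv (hv_pr a) hd) gZl.
have H1 a : exists q, forall b, g q b = rho a b by exact: riesz gC gl g_eq0 _ (rho_lin2 a).
pose q i := sval (cid (H1 (delta_mx 0 i))).
have qE i b : g (q i) b = rho (delta_mx 0 i) b by rewrite /q; case: cid.
exists (\matrix_i q i); split=> // a b.
rewrite mulmx_sum_row (linfun_sum (gl b)) [in RHS](row_sum_delta a).
rewrite (linfun_sum (rho_lin1 b)); apply: eq_bigr => i _.
by rewrite rowK (linfunZ (gl b)) (linfunZ (rho_lin1 b)) qE.
Qed.

Lemma gGG a b : hv b -> g (G a) (G b) = g a b.
Proof. by move=> hb; rewrite gG GGh // gNr opprK. Qed.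
Lemma gHH a b : hv b -> g (H a) (H b) = g a b.
Proof. by move=> hb; rewrite gH HHh // gNr opprK. Qed.

(** * Curvature on a horizontal quaternionic frame *)

Section Flat.
Variable X : Vec.
Hypothesis hX : hv X.
Hypothesis gXX : g X X = 1.

Local Notation e1 := (H (G X)).
Local Notation e2 := (G X).
Local Notation e3 := (H X).

Lemma GHG : G e1 = e3. Proof. by rewrite -[LHS]opprK -HG GGh // (linfunN lH) opprK. Qed.
Lemma GHX : G e3 = - e1. Proof. by rewrite HG opprK. Qed.
Lemma HHG : H e1 = - e2. Proof. exact: HHh (hvG X). Qed.

Lemma g01 : g X e1 = 0.
Proof.
have : g X e1 = - g X e1 by rewrite {1}gH_r gG_r GHX gNl !opprK (gC e1).
by lra.
Qed.
Lemma g02 : g X e2 = 0. Proof. by have := gG X X; rewrite (gC (G X)); lra. Qed.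
Lemma g03 : g X e3 = 0. Proof. by have := gH X X; rewrite (gC (H X)); lra. Qed.
Lemma g12 : g e1 e2 = 0. Proof. by have := gH e2 e2; rewrite (gC (G X)); lra. Qed.
Lemma g13 : g e1 e3 = 0. Proof. by rewrite gH HHh // gNr gC g02 !oppr0. Qed.
Lemma g23 : g e2 e3 = 0. Proof. by rewrite gG GHX gNr g01 !oppr0. Qed.
Lemma g22 : g e2 e2 = 1. Proof. by rewrite gG GGh // gNr opprK. Qed.
Lemma g33 : g e3 e3 = 1. Proof. by rewrite gH HHh // gNr opprK. Qed.
Lemma g11 : g e1 e1 = 1. Proof. by rewrite gH HHG gNr opprK g22. Qed.

Let tab := (gXX, g01, g02, g03, g11, g12, g13, g22, g23, g33,
  etrans (gC e1 X) g01, etrans (gC e2 X) g02, etrans (gC e3 X) g03,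
  etrans (gC e2 e1) g12, etrans (gC e3 e1) g13, etrans (gC e3 e2) g23).

Ltac corr_eval := rewrite corrE ?GHG ?GHX ?HHG ?(GGh hX) ?(HHh hX) ?gNl ?gNr !tab; ring.

(** With [e2 = G X] and [e3 = G e1], the isometry [G] leaves both last slots at once, and a
    sectional curvature remains. [KK_0213] does the same with [HG]. *)
Lemma KK_0123 : g (KK X e1 e2) e3 = - g (KK X e1 e1) X.
Proof. by rewrite -GHG KK_G (gGG _ (hvH _)) KKskew gC. Qed.

Lemma KK_0213 : g (KK X e2 e1) e3 = g (KK X e2 e2) X.
Proof.
have -> : g (KK X e2 e1) e3 = - g (KK X e2 e1) (H (G e2)).
  by rewrite GGh // (linfunN lH) gNr opprK.
by rewrite KK_H [in LHS]KK_G (gHH _ (hvG _)) (gGG _ (hvG _)) KKskew opprK gC.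
Qed.

(** O'Neill lowers a sectional curvature by 3 when [G] or [H] maps one vector of the plane to plus
    or minus the other, as for [X, e2] and [e1, e2], and not at all for [X, e1]. *)
Lemma Rm_frame :
  [/\ g (Rm X e1 e1) X = g (KK X e1 e1) X,
      g (Rm X e2 e2) X = g (KK X e2 e2) X - 3,
      g (Rm e1 e2 e2) e1 = g (KK e1 e2 e2) e1 - 3,
      g (Rm X e1 e2) e3 = 2 - g (KK X e1 e1) X &
      g (Rm X e2 e1) e3 = g (KK X e2 e2) X + 1].
Proof.
have he1 := hvH e2; have he2 := hvG X; have he3 := hvH X.
have c1 : g (corr X e1 e1) X = 0 by corr_eval.
have c2 : g (corr X e2 e2) X = 3 by corr_eval.
have c3 : g (corr e1 e2 e2) e1 = 3 by corr_eval.
have c4 : g (corr X e1 e2) e3 = - 2 by corr_eval.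
have c5 : g (corr X e2 e1) e3 = - 1 by corr_eval.
have := KKE hX he1 he1 hX; have := KKE hX he2 he2 hX; have := KKE he1 he2 he2 he1.
have := KKE hX he1 he2 he3; have := KKE hX he2 he1 he3.
rewrite c1 c2 c3 c4 c5 KK_0123 KK_0213 => *; split; lra.
Qed.

(** The Bianchi identity on [X, e1, e2], paired with [e3]: commutation with [G] and [H] turns its
    three terms into sectional curvatures. *)
Lemma KK_frame_sum :
  g (KK X e1 e1) X + g (KK X e2 e2) X + g (KK e1 e2 e2) e1 = 0.
Proof.
have he1 := hvH e2; have he2 := hvG X; have he3 := hvH X.
have k6 : g (KK e1 e2 X) e3 = - g (KK e1 e2 e2) e1.
  have -> : g (KK e1 e2 X) e3 = g (KK e1 e2 (H (G e1))) (H (G e2)).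
    rewrite GHG (HHh hX) (GGh hX) (linfunN lH) (linfunN (KK_lin3 _ _)).
    by rewrite gNl gNr opprK.
  by rewrite KK_H KK_G (gHH _ (hvG _)) (gGG _ he2) KKskew gC.
have add3 a b c d : g (a + b + c) d = g a d + g b d + g c d by rewrite !gDl.
have := add3 (KK X e1 e2) (KK e1 e2 X) (KK e2 X e1) e3.
by rewrite KKbianchi g0l (KKN e2 X e1) gNl KK_0123 KK_0213 k6; lra.
Qed.

(* By [Rm_frame] and [KK_frame_sum] three of the sectional curvatures have sum
   [-6], while flatness makes them equal unless [a0 = a1 = 0]. *)
Lemma flat_coefficients (a0 a1 al be ga : R) :
  (forall a b c d, hv a -> hv b -> hv c -> hv d ->
     a0 * g (Rm a b c) d + a1 * g (Rm a c b) d + al * (g a d * g b c)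
     + be * (g a c * g b d) + ga * (g a b * g c d) = 0) ->
  [/\ a0 = 0, a1 = 0, al = 0, be = 0 & ga = 0].
Proof.
move=> E; have he1 := hvH e2; have he2 := hvG X; have he3 := hvH X.
have [r1 r2 r3 r4 r5] := Rm_frame; have ks := KK_frame_sum.
have R0 a c d : g (Rm a a c) d = 0 by have := RN a a c; move=> /(congr1 (g^~ d)); rewrite gNl; lra.
have E1 := E _ _ _ _ hX he1 hX he1; have E2 := E _ _ _ _ hX he2 hX he2.
have E3 := E _ _ _ _ he1 he2 he1 he2.
have F1 := E _ _ _ _ hX hX he1 he1; have F2 := E _ _ _ _ hX hX he2 he2.
have F3 := E _ _ _ _ he1 he1 he2 he2.
have I1 := E _ _ _ _ hX he1 he1 hX.
have Q1 := E _ _ _ _ hX he1 he2 he3; have Q2 := E _ _ _ _ hX he2 he1 he3.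
rewrite !R0 (Rskew X e1 X) (gC X (Rm _ _ _)) !tab r1 in E1.
rewrite !R0 (Rskew X e2 X) (gC X (Rm _ _ _)) !tab r2 in E2.
rewrite !R0 (Rskew e1 e2 e1) (gC e1 (Rm _ _ _)) !tab r3 in E3.
rewrite !R0 (Rskew X e1 X) (gC X (Rm _ _ _)) !tab r1 in F1.
rewrite !R0 (Rskew X e2 X) (gC X (Rm _ _ _)) !tab r2 in F2.
rewrite !R0 (Rskew e1 e2 e1) (gC e1 (Rm _ _ _)) !tab r3 in F3.
rewrite !tab r1 in I1; rewrite !tab r4 r5 in Q1 Q2.
move: (g (KK X e1 e1) X) (g (KK X e2 e2) X) (g (KK e1 e2 e2) e1) ks E1 E2 E3 F1 F2 F3 I1 Q1 Q2.
move=> k1 k2 k12 ks E1 E2 E3 F1 F2 F3 I1 Q1 Q2.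
(* The products of [a0], [a1] with the [k] now act as linear unknowns. The [E] equations give
   [be = - 2 a0], the [F] ones [ga = - 2 a1]; then [Q1] and [Q2] become [4 a0 + 2 a1 = 0] and
   [2 a0 + 4 a1 = 0], and [I1] yields [al]. *)
have s0 : a0 * (k1 + k2 + k12) = 0 by rewrite ks mulr0.
have s1 : a1 * (k1 + k2 + k12) = 0 by rewrite ks mulr0.
by split; lra.
Qed.

End Flat.

(** * The tensor B on one tangent space *)

Definition Bform (al : nat -> R) (tau : R) a b c d : R :=
  al 0%N * g (Rm a b c) d + al 1%N * g (Rm a c b) d
  + al 2%N * rho b c * g a d + al 3%N * rho a c * g b d
  + al 4%N * rho a b * g c d + al 5%N * rho a d * g b c
  + al 6%N * rho b d * g a c + al 7%N * rho c d * g a b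
  + tau * (al 8%N * g a d * g b c + al 9%N * g a c * g b d + al 10%N * g a b * g c d).

Lemma Bform_linear al tau a b c : linear (Bform al tau a b c : _ -> R).
Proof.
move=> k d d'; rewrite /Bform !gDr !gZr.
rewrite !(linfunD (rho_lin2 _)) !(linfunZ (rho_lin2 _)) /GRing.scale /=; ring.
Qed.

(** If [G] were zero, so would be [pr], whose trace is [n - 2]. *)
Lemma unit_horizontal : n%:R - 2 != 0 :> R -> exists2 X, hv X & g X X = 1.
Proof.
move=> n2; have [w Gw] : exists w, G w != 0.
  apply: contrapT => /forallNP E; move/negP: n2; apply; rewrite -tr_pr.
  rewrite (eq_trf (h := fun=> 0)) ?trfE ?big1 // => [i _|a]; first by rewrite mxE.
  have /negP := E a; rewrite negbK /pr => /eqP ->; rewrite (linfun0 lG); exact: oppr0.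
have q0 := gpos Gw; set q := g (G w) (G w) in q0.
exists ((Num.sqrt q)^-1 *: G w); first exact/hvZ/hvG.
rewrite gZl gZr -/q -{3}(sqr_sqrtr (ltW q0)).
by field; rewrite sqrtr_eq0 -ltNge.
Qed.

Lemma horizontal_flat (p : nat) (al : nat -> R) : (1 <= p)%N ->
  n%:R - 2 = 4 * p%:R :> R ->
  (forall a b c d, hv a -> hv b -> hv c -> hv d ->
     Bform al (- 2 * (n%:R - 2)) a b c d = 0) ->
  [/\ al 0%N = 0, al 1%N = 0,
      al 2%N + al 5%N + 2%:R * p%:R * al 8%N = 0,
      al 3%N + al 6%N + 2%:R * p%:R * al 9%N = 0 &
      al 4%N + al 7%N + 2%:R * p%:R * al 10%N = 0].
Proof.
move=> p1 np E.
have [|X hX gXX] := unit_horizontal.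
  by rewrite np mulf_neq0 // pnatr_eq0 -?lt0n.
have [|h0 h1 h2 h3 h4] := @flat_coefficients X hX gXX (al 0%N) (al 1%N)
  (- 4 * (al 2%N + al 5%N + 2%:R * p%:R * al 8%N))
  (- 4 * (al 3%N + al 6%N + 2%:R * p%:R * al 9%N))
  (- 4 * (al 4%N + al 7%N + 2%:R * p%:R * al 10%N)).
  move=> a b c d ha hb hc hd; have := E a b c d ha hb hc hd.
  rewrite /Bform !rho_hv // np => <-; ring.
have m4 (r : R) : - 4 * r = 0 -> r = 0 by lra.
by split=> //; exact: m4.
Qed.

End CurvatureAlgebra.

(** * The tensor B *)

Section SasakianFlatness.
Context {R : realType} {p : nat} {N : cmanifold R p.*2.+1} {S : ccstruct N}.
Hypothesis hS : is_complex_sasakian S.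
Variable x : N.

Local Notation nabla := (cs_nabla S).
Local Notation hC := (sas_contact hS).
Local Notation hg := (cs_riem hC).
Local Notation hn := (sas_lc hS).
Local Notation hext := (sas_ext hS).
Local Notation n := (p.*2.+1 + p.*2.+1)%N.
Local Notation g := (cs_g S x).
Local Notation G := (cs_G S x).
Local Notation H := (cs_H S x).
Local Notation U := (cs_U S x).
Local Notation V := (cs_V S x).
Local Notation Rx := (Rm nabla hext x).

Let gC : forall a b, g a b = g b a. Proof. exact: (metC hg). Qed.
Let gl : forall b, linear (g^~ b : 'rV[R]_n -> R).
Proof. by exact: (met_linl hg). Qed.
Let gpos : forall a, a != 0 -> 0 < g a a. Proof. by case: hg => _ _ h _; exact: h. Qed.
Let GGE' : forall a, G (G a) = - a + g U a *: U + g V a *: V.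
Proof. by move=> a; exact: (GGE hS). Qed.
Let HHE' : forall a, H (H a) = - a + g U a *: U + g V a *: V.
Proof. by move=> a; rewrite (HHE hS) addrAC. Qed.
Let RVV : forall a, Rx a V V = - G (G a).
Proof. by move=> a; rewrite (Rm_VV hS) HHE' GGE'. Qed.

Lemma dim_sub2 : n%:R - 2 = 4 * p%:R :> R.
Proof. by rewrite -addn1 -muln2 !natrD natrM; ring. Qed.

Lemma ricci_operator_x : exists Q : 'M[R]_n,
  (forall a b, g (a *m Q) b = rho Rx a b) /\
  (forall Q' : 'M[R]_n, (forall a b, g (a *m Q') b = rho Rx a b) ->
     \tr Q' = - 2 * (n%:R - 2)).
Proof.
exact: (ricci_operator gC gl gpos (G_lin hC x) (H_lin hC x) (gG hC x) (gH hC x)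
  (GU hC x) (GV hC x) (HU hC x) (HV hC x) (gUU hC x) (gVV hC x)
  GGE' HHE' (HG hC x) (Rm_lin1 hg hn hext x) (RmN hn hext x)
  (Rm_lin3 hg hn hext x) (Rm_skew hg hn hext x) (Rm_bianchi hn hext x)
  (Rm_UU hS x) RVV (@Rm_G _ _ _ _ hS x) (@Rm_H _ _ _ _ hS x)).
Qed.

(** The set behind [xget] contains the matrix of [a |-> Rx a (Y x) (Z x)]. Any other member agrees
    with it, as every tangent vector is the value of a smooth global field. *)
Lemma ricciE Y Z : smooth_vf Y -> smooth_vf Z -> ricci nabla Y Z x = rho Rx (Y x) (Z x).
Proof.
move=> HY HZ; rewrite /ricci.
case: xgetP => [L _ LE|/(_ (lin1_mx (fun a => Rx a (Y x) (Z x)))) []]; last first.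
  move=> X HX; rewrite (mul_lin1 _ (Rm_lin1 hg hn hext x _ _)).
  exact: (curvE hg hn hext x HX HY HZ).
rewrite -trf_mx; apply: eq_trf => a; have [X HX <-] := hext x a.
by rewrite -(LE X HX); exact: (curvE hg hn hext x HX HY HZ).
Qed.

Lemma scalE : scal (cs_g S) nabla x = - 2 * (n%:R - 2).
Proof.
have [Q [QE trE]] := ricci_operator_x; rewrite /scal.
case: xgetP => [L _ LE|/(_ Q) []]; last first.
  by move=> X Y HX HY; rewrite QE (ricciE HX HY).
apply: trE => a b; have [X HX <-] := hext x a; have [Y HY <-] := hext x b.
by rewrite (LE X Y HX HY) (ricciE HX HY).
Qed.

Variable al : nat -> N -> R.

Local Notation Bx := (Bform g Rx (al^~ x) (- 2 * (n%:R - 2))).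

Lemma BtensorE X Y Z W : smooth_vf X -> smooth_vf Y -> smooth_vf Z -> smooth_vf W ->
  Btensor (cs_g S) nabla al X Y Z W x = Bx (X x) (Y x) (Z x) (W x).
Proof.
move=> HX HY HZ HW; rewrite /Btensor /Bform scalE /curv4 /ev2.
rewrite (ricciE HY HZ) (ricciE HX HZ) (ricciE HX HY) (ricciE HX HW) (ricciE HY HW).
rewrite (ricciE HZ HW) (curvE hg hn hext x HX HY HZ).
by rewrite (curvE hg hn hext x HX HZ HY).
Qed.

Lemma BvecE X Y Z b : smooth_vf X -> smooth_vf Y -> smooth_vf Z ->
  g (Bvec (cs_g S) nabla al X Y Z x) b = Bx (X x) (Y x) (Z x) b.
Proof.
move=> HX HY HZ; rewrite /Bvec; have [W HW <-] := hext x b.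
case: xgetP => [c _ cE|].
  by rewrite (cE W HW) (BtensorE HX HY HZ HW).
have [c cE] := riesz gC gl (g_eq0 gpos)
  (Bform_linear gC gl (Rm_lin3 hg hn hext x) (al^~ x) (- 2 * (n%:R - 2)) (X x) (Y x) (Z x)).
by move=> /(_ c) []; move=> W' HW'; rewrite cE (BtensorE HX HY HZ HW').
Qed.

(** Every horizontal [e] is [G (- G e)], so the arguments [GX], [GY], [GZ] of the flatness condition
    reach all horizontal vectors. *)
Lemma flat_Bform a b c d : GH_B_flat S al -> hv g U V a -> hv g U V b ->
  hv g U V c -> hv g U V d -> Bx a b c d = 0.
Proof.
move=> flat ha hb hc hd.
have hG e : hv g U V e -> exists E, [/\ smooth_vf E, smooth_vf (ap (cs_G S) E) &
    ap (cs_G S) E x = e].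
  move=> he; have [E HE Ex] := hext x (- G e).
  exists E; split; [exact: HE|exact: (smooth_G hC HE)|].
  by rewrite /ap Ex (linfunN (G_lin hC x)) (GGh GGE' he) opprK.
have [A [HA HGA Ax]] := hG a ha; have [B [HB HGB Bx]] := hG b hb.
have [C [HC HGC Cx]] := hG c hc.
have [/(_ x)] := flat A B C HA HB HC.
rewrite /ap -/(ap (cs_G S) A) -/(ap (cs_G S) B) -/(ap (cs_G S) C) => E _.
rewrite -Ax -Bx -Cx -(BvecE d HGA HGB HGC).
(* Writing [d = - G^2 d] lets the self-adjoint [G^2] move onto [B(GX, GY)GZ], where flatness kills
   it. *)
have <- : pr G d = d by rewrite /pr (GGh GGE' hd) opprK.
by rewrite -(gpr gC gl (gG hC x)) /pr E oppr0 (g0l gl).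
Qed.

Lemma flat_trivial : (1 <= p)%N -> GH_B_flat S al ->
  [/\ al 0%N x = 0, al 1%N x = 0,
      al 2%N x + al 5%N x + 2%:R * p%:R * al 8%N x = 0,
      al 3%N x + al 6%N x + 2%:R * p%:R * al 9%N x = 0 &
      al 4%N x + al 7%N x + 2%:R * p%:R * al 10%N x = 0].
Proof.
move=> p1 flat; apply: (horizontal_flat (al := al^~ x) gC gl gpos (G_lin hC x) (H_lin hC x)
  (gG hC x) (gH hC x)
  (GU hC x) (GV hC x) (HU hC x) (HV hC x) (gUU hC x) (gVV hC x)
  GGE' HHE' (HG hC x) (Rm_lin1 hg hn hext x) (RmN hn hext x)
  (Rm_lin3 hg hn hext x) (Rm_skew hg hn hext x) (Rm_bianchi hn hext x)
  (Rm_UU hS x) RVV (@Rm_G _ _ _ _ hS x) (@Rm_H _ _ _ _ hS x) p1 dim_sub2).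
by move=> a b c d ha hb hc hd; exact: flat_Bform.
Qed.

End SasakianFlatness.

Theorem theorem5 (R : realType) (p : nat) (hp : (1 <= p)%N)
    (N : cmanifold R p.*2.+1) (S : ccstruct N) (hS : is_complex_sasakian S)
    (a : nat -> N -> R)
    (ha : forall i, (i <= 10)%N -> smooth_fun (a i))
    (ha0 : ~ horizontally_trivial a) :
  ~ GH_B_flat S a.
Proof. by move=> flat; apply: ha0 => x; exact: (flat_trivial hS x hp flat). Qed.
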